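(* Let $b>0$, $\alpha\in(0,\frac12)$, and let $\omega=(\omega_x)_{x\ge 1}$ be a sequence of i.i.d. real random variables with law $\mathbb{P}$ (expectation $\mathbb{E}$) such that $\mathbb{E}[\omega_1]=0$, $\sigma^2:=\mathbb{E}[\omega_1^2]\in(0,+\infty)$, and there exists $\theta_0>0$ such that $\mathbb{E}[e^{\theta\omega_1}]<\infty$ for all $|\theta|<\theta_0$. For each realization of $\omega$, let $X=(X_t)_{t\ge0}$ be the continuous-time random walk in the environment $\omega$ on $\mathbb{Z}^+$ started at $0$ (as described in the context), with quenched law $\mathtt{P}_\omega$. Then for $\mathbb{P}$-almost all realizations of $\omega$, $$\lim_{t\to\infty}\frac{X_t}{\bigl(C^*(\ln\ln t)^{-1}\ln t\bigr)^{1/\alpha}}=1,\qquad \mathtt{P}_\omega\text{-a.s.},$$ where $C^*=\dfrac{2\alpha b}{\sigma^2(1-2\alpha)}$.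
   Context: $\mathbb{Z}^+=\{0,1,2,\dots\}$. Given $\omega$, set $q_0=0$ and $q_y=\dfrac{\exp(\omega_y-by^{-\alpha})}{1+\exp(\omega_y-by^{-\alpha})}$ for integers $y\ge1$. For fixed $\omega$, the random walk $X$ is the continuous-time nearest-neighbour Markov chain on $\mathbb{Z}^+$ with transition probabilities, as $h\to0$, $\mathtt{P}_\omega[X_{t+h}=y+1\mid X_t=y]=(1-q_y)h+o(h)$ for $y\ge0$, and $\mathtt{P}_\omega[X_{t+h}=y-1\mid X_t=y]=q_yh+o(h)$ for $y\ge1$. $\mathtt{P}_\omega$ denotes the (quenched) law of $X$ started from $0$ in the fixed environment $\omega$. *)

(* Defs.v *)
From HB Require Import structures.
From mathcomp Require Import all_boot all_order all_algebra finmap.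
From mathcomp Require Import all_classical all_reals all_analysis.

Set Implicit Arguments.
Unset Strict Implicit.
Unset Printing Implicit Defensive.

Import Order.TTheory GRing.Theory Num.Theory.
Import numFieldNormedType.Exports.

Local Open Scope classical_set_scope.
Local Open Scope ring_scope.

Definition mutually_independent (d : measure_display) (T : measurableType d)
    (R : realType) (P : probability T R) (I : set nat) (X : nat -> T -> R) :=
  forall (J : {fset nat}) (B : nat -> set R),
    [set` J] `<=` I -> (forall i, i \in J -> measurable (B i)) ->
    P (\bigcap_(i in [set` J]) X i @^-1` B i) =
      (\prod_(i <- J) P (X i @^-1` B i))%E.

(* Equality of laws is only required on measurable sets: a pushforward is a
   function on all sets, with meaningless values on non-measurable ones. *)
Definition identically_distributed (d : measure_display) (T : measurableType d)
    (R : realType) (P : probability T R) (X Y : {RV P >-> R}) :=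
  forall B : set R, measurable B -> distribution P X B = distribution P Y B.

(* Only w x for x >= 1 is used. *)
Definition rwre_q (R : realType) (b alpha : R) (w : nat -> R) (y : nat) : R :=
  if y == 0%N then 0
  else let u := w y - b * y%:R `^ (- alpha) in expR u / (1 + expR u).

(* p t y z is the probability of going from y to z in time t. *)
Record transition_function (R : realType) (p : R -> nat -> nat -> R) : Prop :=
  { tf_ge0 : forall (t : R) (y z : nat), 0 <= t -> 0 <= p t y z;
    tf_sum1 : forall (t : R) (y : nat), 0 <= t ->
      (\sum_(0 <= z <oo) (p t y z)%:E = 1)%E;
    tf_0 : forall y z : nat, p 0 y z = (y == z)%:R;
    tf_semigroup : forall (s t : R) (y z : nat), 0 <= s -> 0 <= t ->
      ((p (s + t) y z)%:E = \sum_(0 <= v <oo) (p s y v * p t v z)%:E)%E }.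

(* The asymptotics depend only on small h > 0, although the equations are
   quantified over all h : R (see eqoP, eqaddoP).
   nn_only makes the chain nearest-neighbour: leaving {y - 1, y, y + 1} within
   time h has probability o(h); for y = 0 the sum ranges over {0, 1}. *)
Record nearest_neighbour_rates (R : realType) (q : nat -> R)
    (p : R -> nat -> nat -> R) : Prop :=
  { nn_up : forall (y : nat) (h : R),
      p h y y.+1 = (1 - q y) * h +o_(h \near 0^'+) h;
    nn_down : forall (y : nat) (h : R), (1 <= y)%N ->
      p h y y.-1 = q y * h +o_(h \near 0^'+) h;
    nn_only : forall (y : nat) (h : R),
      1 - \sum_(y.-1 <= z < y.+2) p h y z =o_(h \near 0^'+) h }.

(* Only times t >= 0 are relevant. *)
Record cadlag_process (R : realType) (T : Type) (X : R -> T -> nat) : Prop :=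
  { cadlag_right : forall (x : T) (t : R), 0 <= t ->
      \forall s \near t^'+, X s x = X t x;
    cadlag_left : forall (x : T) (t : R), 0 < t ->
      exists n : nat, \forall s \near t^'-, X s x = n }.

Record markov_from0 (R : realType) (p : R -> nat -> nat -> R)
    (d : measure_display) (T : measurableType d) (Q : probability T R)
    (X : R -> T -> nat) : Prop :=
  { mk_meas : forall t : R, 0 <= t -> measurable_fun [set: T] (X t);
    mk_init : Q (X 0 @^-1` [set 0%N]) = 1%E;
    mk_markov : forall (n : nat) (s : nat -> R) (y : nat -> nat) (h : R)
        (z : nat),
      0 <= s 0%N -> (forall k, (k < n)%N -> s k < s k.+1) -> 0 <= h ->
      let past := \bigcap_(k in `I_n.+1) (X (s k) @^-1` [set y k]) in
      Q (past `&` X (s n + h) @^-1` [set z]) =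
        (Q past * (p h (y n) z)%:E)%E }.

Definition quenched_walk (R : realType) (b alpha : R) (w : nat -> R)
    (d : measure_display) (T : measurableType d) (Q : probability T R)
    (X : R -> T -> nat) : Prop :=
  cadlag_process X /\
  exists p : R -> nat -> nat -> R,
    [/\ transition_function p,
        nearest_neighbour_rates (rwre_q b alpha w) p
      & markov_from0 p Q X].

(* Main.v *)
(* A potential V is attached to the environment by V(y) - V(y-1) = ln (q_y / (1 - q_y)),
   so V(y) = sum_{i <= y} (omega_i - b i^-alpha). Almost surely the largest rise
   of V before level n is H(n) (1 + o(1)), with
     H(n) = A n^alpha ln n  and  A = (1 - 2 alpha) sigma^2 / (2 b),
   and the walk needs time exp (H(n) (1 + o(1))) to pass level n for good.
   Solving H(n) = ln t for n gives the scale, with C* = alpha / A.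

   Walk: the total jump rate is 1, so a bounded function f with
   L f <= - l f + r satisfies P_t f <= exp (- l t) f + r t. A function that
   grows only across one rise of V, with L f <= 1, shows that the rise delays
   the walk. The harmonic function h(y) = sum_{z >= y} exp (V(z)), corrected by
   its Green potential on [0, n), has L G <= - l G there with l about
   exp (- H(n)), hence E (h (X_t)) is tiny after time exp (H(n) (1 + d)), and the
   maximal inequality for the supermartingale h (X_t) excludes later returns.

   Environment: exponential supermartingales and a union bound over blocks of
   length x^(2 alpha), the correlation length of the maximum of V above x,
   bound the rises from above; tilting gives a lower bound for the
   probability of one rise, and about n^(1 - 2 alpha) independent attempts are
   available below n. *)

(* The constant A is where cost meets supply. To rise by H over a stretch of length l near n, the
   sum of omega must reach H + b l n^(-alpha), at Gaussian cost (H + b l n^(-alpha))^2 / (2 l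
   sigma^2). This is least at l = H n^alpha / b, where it equals 2 b H n^(-alpha) / sigma^2, that is
   (2 b A / sigma^2) ln n. Up to logarithms there are n^(1 - 2 alpha) such stretches, so the balance
   is 2 b A = (1 - 2 alpha) sigma^2. The matching tilt is theta = 2 b n^(-alpha) / sigma^2, for
   which exp (theta (omega - b n^(-alpha))) has mean close to 1; as theta tends to 0, the law of
   omega enters only through sigma^2. The chain is known only through its rates at time 0+, without
   generator or jump times, so every estimate of the walk rests on [one_step]. Environment and walk
   meet only in [good_env], three eventual bounds on one fixed environment; hence the exceptional
   set of environments depends neither on the walk nor on its probability space. *)
Require Import Defs.
From HB Require Import structures.
From mathcomp Require Import all_boot all_order all_algebra finmap.
From mathcomp Require Import all_classical all_reals all_analysis.
From mathcomp Require Import measurable_realfun ring lra zify.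

Set Implicit Arguments.
Unset Strict Implicit.
Unset Printing Implicit Defensive.

Import Order.TTheory GRing.Theory Num.Theory.
Import numFieldNormedType.Exports.

Local Open Scope classical_set_scope.
Local Open Scope ring_scope.

(** * Semigroup of the walk *)

Section Kernel.
Context {R : realType}.

Lemma nneseries_EFin_le (u : nat -> R) (c : R) (N : nat) :
  (forall k, 0 <= u k) ->
  (forall n, (N <= n)%N -> \sum_(0 <= k < n) u k <= c) ->
  (\sum_(0 <= k <oo) (u k)%:E <= c%:E)%E.
Proof.
move=> u0 uc; apply: lime_le.
  by apply: is_cvg_nneseries => n _ _; rewrite lee_fin.
exists N => //= n Nn; rewrite sumEFin lee_fin; exact: uc.
Qed.

Lemma nneseries_EFin_ge (u : nat -> R) (n : nat) :
  (forall k, 0 <= u k) ->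
  ((\sum_(0 <= k < n) u k)%:E <= \sum_(0 <= k <oo) (u k)%:E)%E.
Proof.
move=> u0; rewrite -sumEFin; apply: nneseries_lim_ge => k _ _.
by rewrite lee_fin.
Qed.

(** Extended-real valued, so that positivity alone gives the series a meaning; for bounded [f] the
    value is finite. *)
Definition Pt (p : R -> nat -> nat -> R) (t : R) (f : nat -> R) (y : nat)
  : \bar R := (\sum_(0 <= z <oo) (p t y z * f z)%:E)%E.

Section bounded.
Variables (p : R -> nat -> nat -> R) (ptf : transition_function p).
Variables (f : nat -> R) (M : R).
Hypothesis fM : forall z, 0 <= f z <= M.

Lemma Pt_ge0 t y : 0 <= t -> (0 <= Pt p t f y)%E.
Proof.
move=> t0; apply: nneseries_ge0 => n _ _; rewrite lee_fin.
by rewrite mulr_ge0 ?(tf_ge0 ptf)//; case/andP: (fM n).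
Qed.

Lemma Pt_leM t y : 0 <= t -> (Pt p t f y <= M%:E)%E.
Proof.
move=> t0; apply: (@nneseries_EFin_le _ _ 0%N) => [k|n _].
  by rewrite mulr_ge0 ?(tf_ge0 ptf)//; case/andP: (fM k).
have M0 : 0 <= M by case/andP: (fM 0%N) => /le_trans; apply.
apply: (@le_trans _ _ (M * \sum_(0 <= k < n) p t y k)).
  rewrite mulr_sumr; apply: ler_sum => k _; rewrite mulrC.
  by apply: ler_wpM2r; [rewrite (tf_ge0 ptf)|case/andP: (fM k)].
rewrite -[leRHS]mulr1 ler_wpM2l//.
have := nneseries_EFin_ge n (fun k => tf_ge0 ptf y k t0).
by rewrite (tf_sum1 ptf y t0) lee_fin.
Qed.

Lemma Pt_fin t y : 0 <= t -> Pt p t f y \is a fin_num.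
Proof.
move=> t0; rewrite ge0_fin_numE ?Pt_ge0//.
by apply: le_lt_trans (Pt_leM y t0) _; rewrite ltry.
Qed.

Lemma Pt_fine_bound t y : 0 <= t -> 0 <= fine (Pt p t f y) <= M.
Proof.
move=> t0; rewrite fine_ge0 ?Pt_ge0//=.
by rewrite -lee_fin fineK ?Pt_fin// Pt_leM.
Qed.

Lemma PtD s t y : 0 <= s -> 0 <= t ->
  Pt p (s + t) f y = Pt p s (fun v => fine (Pt p t f v)) y.
Proof.
move=> s0 t0; rewrite /Pt.
under [RHS]eq_eseriesr => v _.
  rewrite EFinM fineK ?Pt_fin// /Pt -nneseriesZl; last first.
    by move=> z _; rewrite lee_fin mulr_ge0 ?(tf_ge0 ptf)//; case/andP: (fM z).
  over.
rewrite nneseries_interchange; last first.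
  move=> i j; rewrite -EFinM lee_fin !mulr_ge0 ?(tf_ge0 ptf)//.
  by case/andP: (fM j).
apply: eq_eseriesr => z _.
rewrite mulrC EFinM (tf_semigroup ptf _ _ s0 t0) -nneseriesZl; last first.
  by move=> v _; rewrite lee_fin !mulr_ge0 ?(tf_ge0 ptf)//.
apply: eq_eseriesr => v _.
by rewrite -!EFinM mulrC mulrA.
Qed.

End bounded.

Lemma Pt0 (p : R -> nat -> nat -> R) f y : transition_function p -> 
  (forall z, 0 <= f z) -> (Pt p 0 f y <= (f y)%:E)%E.
Proof.
move=> ptf f0; apply: (@nneseries_EFin_le _ _ 0%N) => [k|n _].
  by rewrite mulr_ge0 ?(tf_ge0 ptf).
under eq_bigr do rewrite (tf_0 ptf).
have [yn|yn] := ltnP y n.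
  rewrite big_mkord (bigD1 (Ordinal yn))//= eqxx mul1r big1 ?addr0// => i.
  by rewrite -val_eqE/= eq_sym => /negbTE ->; rewrite mul0r.
rewrite big_nat big1// => i /andP[_ iin].
by rewrite gtn_eqF ?mul0r// (leq_trans iin).
Qed.

(** The arithmetic of [one_step] at site 0; [step_alg] does the other sites. The letters [d], [m],
    [u] mark the site below, the site itself and the site above. *)
Lemma step_alg0 (pm pu fm fu h M e' e : R) :
  (pu - h) * (fu - fm) <= e' * h * M ->
  M * (1 - (pm + pu)) <= M * (e' * h) ->
  3 * M * e' * h <= e * h ->
  0 <= M * (e' * h) ->
  (pm + pu) * fm <= 1 * fm ->
  (pm * fm + pu * fu) + M * (1 - (pm + pu)) <=
  (1 - h) * fm + h * fu + e * h.
Proof.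
move=> h1 h3 h4 h6 h5.
lra.
Qed.

Lemma step_alg (pd pm pu fd fm fu q h M e' e : R) :
  (pu - (1 - q) * h) * (fu - fm) <= e' * h * M ->
  (pd - q * h) * (fd - fm) <= e' * h * M ->
  M * (1 - (pd + (pm + pu))) <= M * (e' * h) ->
  3 * M * e' * h <= e * h ->
  (pd + (pm + pu)) * fm <= 1 * fm ->
  pd * fd + (pm * fm + pu * fu) + M * (1 - (pd + (pm + pu))) <=
  (1 - h) * fm + h * (q * fd + (1 - q) * fu) + e * h.
Proof.
move=> h1 h2 h3 h4 h5.
lra.
Qed.

Lemma sum_near3 (g : nat -> R) (y : nat) :
  \sum_(y.+1.-1 <= z < y.+3) g z = g y + (g y.+1 + g y.+2).
Proof.
rewrite /= -[X in \sum_(X <= _ < _) _]add0n -[y.+3]/(3 + y)%N big_addn.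
by rewrite addnK big_nat_recl// big_nat_recl// big_nat1 !add0n !addrA.
Qed.

(** The range of admissible h is the same for all functions with values in [0, M]. This uniformity
    allows the estimate to be applied to the functions P_T f at all grid times T at once. *)
Lemma one_step (q : nat -> R) (p : R -> nat -> nat -> R) (M : R) (y : nat)
    (e : R) :
  transition_function p -> nearest_neighbour_rates q p -> q 0%N = 0 ->
  0 < e -> 0 <= M ->
  \forall h \near 0^'+, forall f : nat -> R, (forall z, 0 <= f z <= M) ->
    (Pt p h f y <= ((1 - h) * f y + h * (q y * f y.-1 + (1 - q y) * f y.+1)
                   + e * h)%:E)%E.
Proof.
move=> ptf nn q0 e0 M0.
(* Three errors of size M e' h must fit into e h: the rates up and down, and the mass that leaves
   the three sites. *)
pose e' := e / (3 * M + 1).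
have e'0 : 0 < e' by rewrite divr_gt0//; lra.
have e'e : 3 * M * e' <= e.
  rewrite /e' mulrA ler_pdivrMr; last by lra.
  by rewrite mulrC; apply: ler_wpM2l; lra.
have [nnU nnD nnO] := nn.
have nnUy := eqaddoE (funext (nnU y)).
have nnDy := fun y1 => eqaddoE (funext (fun h => nnD y h y1)).
have nnOy := eqoE (funext (nnO y)).
move: nnUy => /eqaddoP /(_ _ e'0) nnUy.
move: nnOy => /eqoP /(_ _ e'0) nnOy.
have nnDy' : \forall h \near 0^'+, (1 <= y)%N ->
   `|p h y y.-1 - q y * h| <= e' * `|h|.
  have [y1|y1] := boolP (1 <= y)%N; last by near=> h.
  have /eqaddoP /(_ _ e'0) := nnDy y1.
  by apply: filterS => h + _.
near=> h => f fM.
have h0 : 0 < h by [].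
have hU : `|p h y y.+1 - (1 - q y) * h| <= e' * h.
  rewrite -[X in e' * X](gtr0_norm h0).
  by near: h; exact: nnUy.
have hO : `|1 - \sum_(y.-1 <= z < y.+2) p h y z| <= e' * h.
  rewrite -[X in e' * X](gtr0_norm h0).
  by near: h; exact: nnOy.
have hD : (1 <= y)%N -> `|p h y y.-1 - q y * h| <= e' * h.
  rewrite -[X in e' * X](gtr0_norm h0).
  by near: h; exact: nnDy'.
have p0 z : 0 <= p h y z by rewrite (tf_ge0 ptf)// ltW.
(* Outside the three sites f is at most M, and the mass there is at most what they leave of 1. *)
have main : (Pt p h f y <= (\sum_(y.-1 <= z < y.+2) p h y z * f z
     + M * (1 - \sum_(y.-1 <= z < y.+2) p h y z))%:E)%E.
  apply: (@nneseries_EFin_le _ _ y.+2) => [k|n yn].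
    by rewrite mulr_ge0//; case/andP: (fM k).
  have y1 : (y.-1 <= y.+2)%N by rewrite (leq_trans (leq_pred _))// ltnW.
  have s1 : \sum_(0 <= k < n) p h y k <= 1.
    have := nneseries_EFin_ge n p0.
    by rewrite (tf_sum1 ptf y (ltW h0)) lee_fin.
  have split3 g : \sum_(0 <= k < n) g k = \sum_(0 <= k < y.-1) g k
      + \sum_(y.-1 <= k < y.+2) g k + \sum_(y.+2 <= k < n) g k :> R.
    rewrite (@big_cat_nat _ _ _ y.-1)//=; last exact: leq_trans yn.
    by rewrite (@big_cat_nat _ _ _ y.+2 y.-1 n)//= addrA.
  have hb a c : \sum_(a <= k < c) p h y k * f k <= M * \sum_(a <= k < c) p h y k.
    rewrite mulr_sumr; apply: ler_sum => k _; rewrite mulrC.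
    by apply: ler_wpM2r => //; case/andP: (fM k).
  rewrite split3 in s1; rewrite split3.
  have := hb 0%N y.-1; have := hb y.+2 n.
  have := ler_wpM2l M0 s1.
  by lra.
apply: (le_trans main); rewrite lee_fin.
have /andP[fy0 fyM] := fM y; have /andP[fu0 fuM] := fM y.+1.
have /andP[fd0 fdM] := fM y.-1.
have key a x z : 0 <= x <= M -> 0 <= z <= M -> `|a| <= e' * h ->
    a * (x - z) <= e' * h * M.
  move=> /andP[x0 xM] /andP[z0 zM] ah; apply: (le_trans (ler_norm _)).
  rewrite normrM ler_pM//.
  by rewrite ler_norml; apply/andP; split; lra.
have hM := ler_wpM2r (ltW h0) e'e.
have k1 := key _ _ _ (fM y.+1) (fM y) hU.
have k3 : M * (1 - \sum_(y.-1 <= z < y.+2) p h y z) <= M * (e' * h).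
  by apply: ler_wpM2l => //; apply: le_trans hO; exact: ler_norm.
have s1 : \sum_(y.-1 <= z < y.+2) p h y z <= 1.
  apply: (@le_trans _ _ (\sum_(0 <= z < y.+2) p h y z)).
    rewrite [leRHS](@big_cat_nat _ _ _ y.-1)//=; last first.
      by rewrite (leq_trans (leq_pred _))// ltnW.
    by rewrite lerDr sumr_ge0.
  have := nneseries_EFin_ge y.+2 p0.
  by rewrite (tf_sum1 ptf y (ltW h0)) lee_fin.
have Meh : 0 <= M * (e' * h) := mulr_ge0 M0 (mulr_ge0 (ltW e'0) (ltW h0)).
clear main hO.
destruct y as [|y].
  move: s1 k3; rewrite /= !(big_ltn (m := 0%N))// !(big_ltn (m := 1%N))// !big_geq//.
  rewrite !addr0 q0 => s1 k3; rewrite q0 subr0 mul1r in k1.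
  rewrite subr0 mul0r mul1r add0r.
  exact: (step_alg0 k1 k3 hM Meh (ler_wpM2r fy0 s1)).
have k2 := key _ _ _ (fM y) (fM y.+1) (hD isT).
rewrite !sum_near3 in s1 k3; rewrite !sum_near3.
exact: (step_alg k1 k2 k3 hM (ler_wpM2r fy0 s1)).
Unshelve. all: by end_near.
Qed.

End Kernel.

(** * Lyapunov bounds for the semigroup *)

Section Lyapunov.
Context {R : realType}.

(** The discrete form of integrating t^k / k! to t^(k+1) / (k+1)!. *)
Lemma bernoulli_exprD (t h : R) (k : nat) : 0 <= t -> 0 <= h ->
  t ^+ k.+1 + k.+1%:R * (h * t ^+ k) <= (t + h) ^+ k.+1.
Proof.
move=> t0 h0; elim: k => [|k IH]; first by rewrite !expr1 expr0 mulr1 mul1r.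
rewrite [leRHS]exprS; apply: (@le_trans _ _ ((t + h) * (t ^+ k.+1 + k.+1%:R * (h * t ^+ k)))); last first.
  by rewrite ler_wpM2l// addr_ge0.
have e : k.+2%:R = k.+1%:R + 1 :> R by rewrite -natr1.
rewrite e -subr_ge0.
have -> : (t + h) * (t ^+ k.+1 + k.+1%:R * (h * t ^+ k)) -
   (t ^+ k.+2 + (k.+1%:R + 1) * (h * t ^+ k.+1)) = k.+1%:R * (h ^+ 2 * t ^+ k).
  by rewrite (exprS t k.+1) (exprS t k); ring.
by rewrite !mulr_ge0// exprn_ge0.
Qed.

(** One grid step, from T to T + h, in [Pt_lyapunov_approx]: [U] and [Au] stand for P_T f at y and
    averaged over the neighbours of y, [a] for the error term at level k, [b] and [b'] for that at
    level k + 1 at the times T and T + h. *)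
Lemma gronwall_step_alg (U Au Af fy E E' r T h l a b b' e1 : R) :
  0 <= h -> h <= 1 -> 0 <= T -> 0 <= r -> 0 <= e1 -> 0 <= b -> 0 <= fy ->
  0 <= E -> E <= 1 ->
  E * (1 - l * h) <= E' -> b + h * a <= b' ->
  U <= E * fy + r * T + b + e1 * T ->
  Au <= E * Af + r * T + a ->
  Af <= (1 - l) * fy + r ->
  (1 - h) * U + h * Au + e1 * h <= E' * fy + r * (T + h) + b' + e1 * (T + h).
Proof.
move=> h0 h1 T0 r0 e10 b0 fy0 E0 E1 EE bb UU AU AF.
have k1 : (1 - h) * U <= (1 - h) * (E * fy + r * T + b + e1 * T).
  by apply: ler_wpM2l => //; rewrite subr_ge0.
have k2 : h * Au <= h * (E * Af + r * T + a) by apply: ler_wpM2l.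
have k3 : h * E * Af <= h * E * ((1 - l) * fy + r).
  by apply: ler_wpM2l => //; exact: mulr_ge0.
have k4 : h * r * E <= h * r * 1 by apply: ler_wpM2l => //; exact: mulr_ge0.
have k5 : E * (1 - l * h) * fy <= E' * fy by apply: ler_wpM2r.
have k6 : 0 <= h * b by exact: mulr_ge0.
have k7 : 0 <= h * (e1 * T) by rewrite !mulr_ge0.
clear -k1 k2 k3 k4 k5 k6 k7 bb.
lra.
Qed.

(** One step of the jump chain. As the total jump rate is 1 at every site, the generator is
    [avg q f y - f y]; at 0 the value [f 0.-1] has weight [q 0 = 0]. *)
Definition avg (q : nat -> R) (f : nat -> R) (y : nat) : R :=
  q y * f y.-1 + (1 - q y) * f y.+1.

Variables (q : nat -> R) (p : R -> nat -> nat -> R).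
Hypotheses (ptf : transition_function p) (nn : nearest_neighbour_rates q p).
Hypotheses (q0 : q 0%N = 0) (q01 : forall y, 0 <= q y <= 1).

(* Induction on k: the bound at the neighbours of y is inserted into the one-step
   estimate, and a discrete Gronwall argument turns M t^k / k! into
   M t^(k+1) / (k+1)!. No continuity of the semigroup is needed. *)
Lemma Pt_lyapunov_approx (f : nat -> R) (M l r : R) (k : nat) :
  (forall z, 0 <= f z <= M) -> 0 <= l -> 0 <= r ->
  (forall y, avg q f y <= (1 - l) * f y + r) ->
  forall t y, 0 <= t ->
  fine (Pt p t f y) <= expR (- (l * t)) * f y + r * t + M * (t ^+ k / k`!%:R).
Proof.
move=> fM l0 r0 hf.
have M0 : 0 <= M by case/andP: (fM 0%N) => /le_trans; apply.
have f0 z : 0 <= f z by case/andP: (fM z).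
elim: k => [|k IH] t y t0.
  rewrite expr0 fact0 divr1 mulr1.
  case/andP: (Pt_fine_bound ptf fM y t0) => _ /le_trans; apply.
  by rewrite lerDr addr_ge0 ?mulr_ge0// expR_ge0.
pose B (t : R) := expR (- (l * t)) * f y + r * t + M * (t ^+ k.+1 / k.+1`!%:R).
have B0 : fine (Pt p 0 f y) <= B 0.
  rewrite /B !mulr0 oppr0 expR0 mul1r addr0 expr0n/= mul0r mulr0 addr0.
  by rewrite -lee_fin fineK ?(Pt_fin ptf fM)// Pt0.
rewrite -/(B t); apply/ler_addgt0Pr => e e0.
(* Over time t the one-step errors add up to e1 t, which is at most e. *)
pose e1 := e / (t + 1).
have e10 : 0 < e1 by rewrite divr_gt0// ltr_wpDl.
have [d /= d0 hd] := one_step y ptf nn q0 e10 M0.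
have [t0'|] := ltP 0 t; last first.
  by move=> t0'; rewrite (_ : t = 0) ?(le_trans B0) ?lerDl ?ltW//; apply/le_anti/andP.
pose m := Num.min (d / 2) 1.
have m0 : 0 < m by rewrite lt_min ltr01 andbT divr_gt0.
pose N := (Num.truncn (t / m)).+1.
have N0 : 0 < N%:R :> R by rewrite ltr0n.
have tN : t / m < N%:R by rewrite /N truncnS_gt.
pose h := t / N%:R.
have h0 : 0 < h by rewrite divr_gt0.
have hm : h < m by rewrite /h ltr_pdivrMr// mulrC -ltr_pdivrMr.
have h1 : h <= 1 by rewrite (le_trans (ltW hm))// ge_min lexx orbT.
have hdd : h < d.
  by rewrite (lt_le_trans hm)// ge_min ler_pdivrMr// ler_peMr ?orbT ?ler1n// ltW.
have step := hd h; rewrite /= sub0r normrN gtr0_norm// in step.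
have {}step := step hdd h0.
have claim (j : nat) : fine (Pt p (j%:R * h) f y) <= B (j%:R * h) + e1 * (j%:R * h).
  elim: j => [|j IHj]; first by rewrite mul0r mulr0 addr0.
  have T0 : 0 <= j%:R * h by rewrite mulr_ge0// ltW.
  have -> : j.+1%:R * h = j%:R * h + h by rewrite -natr1 mulrDl mul1r.
  (* The short step comes first: P_(h+T) f = P_h (P_T f), so that [one_step] acts on P_T f, which
     again has values in [0, M]. *)
  rewrite [in leLHS]addrC (PtD ptf fM y (ltW h0) T0).
  have := step _ (fun z => Pt_fine_bound ptf fM z T0).
  rewrite -[in X in X -> _](@fineK _ (Pt _ _ _ _)) ?lee_fin; last first.
    by apply: (Pt_fin ptf (M := M)) => // [z|]; [exact: Pt_fine_bound|exact: ltW].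
  move=> /le_trans; apply.
  set T := j%:R * h in T0 IHj *.
  apply: (@gronwall_step_alg _ _ (avg q f y) (f y) (expR (- (l * T))) (expR (- (l * (T + h)))) r T h l
     (M * (T ^+ k / k`!%:R)) (M * (T ^+ k.+1 / k.+1`!%:R))
     (M * ((T + h) ^+ k.+1 / k.+1`!%:R)) e1) => //.
  - exact: ltW.
  - exact: ltW.
  - by rewrite mulr_ge0// divr_ge0// exprn_ge0.
  - by rewrite expR_le1 oppr_le0 mulr_ge0.
  - have -> : - (l * (T + h)) = - (l * T) + - (l * h) by ring.
    rewrite expRD ler_wpM2l ?expR_ge0//.
    exact: expR_ge1Dx.
  - rewrite [X in _ + X]mulrCA -mulrDr ler_wpM2l// factS natrM invfM.
    have kf : 0 < k`!%:R :> R by rewrite ltr0n fact_gt0.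
    have := ler_wpM2r (ltW (_ : 0 < k.+1%:R^-1 * k`!%:R^-1)) (bernoulli_exprD k T0 (ltW h0)).
    rewrite mulr_gt0 ?invr_gt0// => /(_ isT); apply: le_trans.
    rewrite mulrDl lerD2l [leRHS]mulrACA mulfV ?mul1r ?pnatr_eq0//.
    by rewrite mulrA.
  - have /andP[qy0 qy1] := q01 y.
    have i1 := ler_wpM2l qy0 (IH T y.-1 T0).
    have qy1' : 0 <= 1 - q y by rewrite subr_ge0.
    have i2 := ler_wpM2l qy1' (IH T y.+1 T0).
    apply: (le_trans (lerD i1 i2)); rewrite /avg le_eqVlt; apply/orP; left; apply/eqP.
    ring.
have := claim N.
have -> : N%:R * h = t by rewrite /h mulrC divfK ?gt_eqF.
move=> /le_trans; apply; rewrite lerD2l /e1 mulrAC ler_pdivrMr; last lra.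
by rewrite ler_wpM2l ?(ltW e0)// lerDl.
Qed.

(** The error M t^k / k! of the approximate version is M times a term of a convergent exponential
    series, so it vanishes as k grows. *)
Lemma Pt_lyapunov (f : nat -> R) (M l r : R) :
  (forall z, 0 <= f z <= M) -> 0 <= l -> 0 <= r ->
  (forall y, avg q f y <= (1 - l) * f y + r) ->
  forall t y, 0 <= t -> (Pt p t f y <= (expR (- (l * t)) * f y + r * t)%:E)%E.
Proof.
move=> fM l0 r0 hf t y t0.
rewrite -[leLHS]fineK ?(Pt_fin ptf fM)// lee_fin.
have cv : expR (- (l * t)) * f y + r * t + M * (t ^+ k / k`!%:R) @[k --> \oo]
    --> expR (- (l * t)) * f y + r * t + M * 0.
  apply: cvgD; first exact: cvg_cst.
  apply: cvgMr; have /cvg_series_cvg_0 := @is_cvg_series_exp_coeff R t.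
  by apply: cvg_trans; apply: near_eq_cvg; near=> k; rewrite exp_coeffE/= mulrC.
rewrite mulr0 addr0 in cv.
rewrite -(cvg_lim _ cv)//; apply: limr_ge; first by apply/cvg_ex; eexists; exact: cv.
by apply: nearW => k; exact: Pt_lyapunov_approx.
Unshelve. all: by end_near.
Qed.

End Lyapunov.

(** * A maximal inequality in continuous time *)

Section MaximalInequality.
Context {R : realType}.
Variables (p : R -> nat -> nat -> R) (ptf : transition_function p).
Context (d : measure_display) (T : measurableType d) (Q : probability T R).
Variables (X : R -> T -> nat) (mk : markov_from0 p Q X) (cad : cadlag_process X).

Definition past (n : nat) (s : nat -> R) (y : nat -> nat) : set T :=
  \bigcap_(k in `I_n.+1) (X (s k) @^-1` [set y k]).

Lemma measurable_state (t : R) (A : set nat) : 0 <= t -> measurable (X t @^-1` A).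
Proof.
by move=> t0; rewrite -[X in measurable X]setTI; apply: (mk_meas mk t0).
Qed.

Lemma measurable_past n s y : (forall k, (k <= n)%N -> 0 <= s k) ->
  measurable (past n s y).
Proof.
move=> s0; apply: bigcap_measurable; first by exists 0%N.
by move=> k /= kn; apply: measurable_state; exact: s0.
Qed.

Definition grid_exceeds (f : nat -> R) (a t h : R) (K : nat) : set T :=
  \bigcup_(j in `I_K.+1) (X (t + j%:R * h) @^-1` [set z | a <= f z]).

Lemma measurable_grid f a t h K : 0 <= t -> 0 <= h ->
  measurable (grid_exceeds f a t h K).
Proof.
move=> t0 h0; apply: bigcup_measurable => k _; apply: measurable_state.
by rewrite addr_ge0// mulr_ge0.
Qed.

Lemma incr_times_ge0 n (s : nat -> R) : 0 <= s 0%N ->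
  (forall k, (k < n)%N -> s k < s k.+1) -> forall k, (k <= n)%N -> 0 <= s k.
Proof.
move=> s0 inc; elim=> [//|k IHk kn].
by rewrite (le_trans (IHk (ltnW kn)))// ltW// inc.
Qed.

(** Doob's inequality along a grid, for a supermartingale up to the drift r. The induction on the
    number of remaining grid points must allow an arbitrary observed past: while f is below a, the
    event is split by the state at the next grid time, and the Markov property appends that state to
    the past. *)
Lemma past_grid_le (f : nat -> R) (a h r : R) :
  (forall z, 0 <= f z) -> 0 < a -> 0 < h -> 0 <= r ->
  (forall y, (Pt p h f y <= (f y + r * h)%:E)%E) ->
  forall (K n : nat) (s : nat -> R) (y : nat -> nat),
  0 <= s 0%N -> (forall k, (k < n)%N -> s k < s k.+1) ->
  (Q (past n s y `&` grid_exceeds f a (s n) h K) <=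
     Q (past n s y) * ((f (y n) + r * (K%:R * h)) / a)%:E)%E.
Proof.
move=> f0 a0 h0 r0 Pf K n s y s0 inc.
have bound0 z m : 0 <= (f z + r * (m%:R * h)) / a.
  by rewrite divr_ge0 ?(ltW a0)// addr_ge0// !mulr_ge0// ltW.
(* If the level is already reached, the factor on the right is at least 1. *)
have [af|] := leP a (f (y n)).
  have sge := incr_times_ge0 s0 inc.
  have mp := measurable_past y sge.
  apply: (@le_trans _ _ (Q (past n s y))).
    apply: le_measure; rewrite ?inE//; apply: measurableI => //.
    by apply: measurable_grid; [exact: sge|exact: ltW].
  rewrite -[leLHS]mule1; apply: lee_wpmul2l => //.
  rewrite lee_fin ler_pdivlMr// mul1r (le_trans af)// lerDl.
  by rewrite !mulr_ge0// ltW.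
elim: K n s y s0 inc => [|K IH] n s y s0 inc af.
  rewrite (_ : _ `&` _ = set0) ?measure0 ?mule_ge0 ?lee_fin//.
  rewrite -subset0 => x [/= px [j /= j0]].
  have -> : j = 0%N by case: j j0.
  by rewrite /= mul0r addr0 (px n)//= leNgt af.
have sge := incr_times_ge0 s0 inc.
have mp := measurable_past y sge.
(* The past extended by the time s n + h and the state z. *)
pose s' k := if (k <= n)%N then s k else s n + h.
pose y' z k := if (k <= n)%N then y k else z.
have pastS z : past n.+1 s' (y' z) = past n s y `&` X (s n + h) @^-1` [set z].
  apply/seteqP; split=> x /=.
    move=> px; split.
      move=> k /= kn; have := px k; rewrite /= /s' /y'.
      by move: (kn); rewrite ltnS => -> /(_ (ltnW kn)).
    by have := px n.+1; rewrite /= /s' /y' ltnn => /(_ (ltnSn _)).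
  move=> [px xz] k /=; rewrite ltnS leq_eqVlt => /orP[/eqP ->|kn].
    by rewrite /s' /y' ltnn.
  by move: (kn); rewrite /s' /y' ltnS => ->; exact: px.
have s'n : s' n.+1 = s n + h by rewrite /s' ltnn.
have s'0 : 0 <= s' 0%N by rewrite /s'.
have inc' k : (k < n.+1)%N -> s' k < s' k.+1.
  rewrite ltnS /s' => kn; rewrite kn; move: kn; rewrite leq_eqVlt => /orP[/eqP ->|kn].
    by rewrite ltnn ltrDl.
  by rewrite kn inc.
have snh0 : 0 <= s n + h by rewrite addr_ge0 ?sge// ltW.
have cover : past n s y `&` grid_exceeds f a (s n) h K.+1 `<=`
   \bigcup_z (past n.+1 s' (y' z) `&` grid_exceeds f a (s' n.+1) h K).
  move=> x [px [[|j] /= jK aj]].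
    by move: aj; rewrite mul0r addr0 (px n)//= leNgt af.
  exists (X (s n + h) x) => //; split; first by rewrite pastS.
  exists j => //=; move: aj; rewrite s'n.
  by have -> : s n + j.+1%:R * h = s n + h + j%:R * h by rewrite -natr1; ring.
have m1 z : measurable (past n.+1 s' (y' z) `&` grid_exceeds f a (s' n.+1) h K).
  apply: measurableI.
    by rewrite pastS; apply: measurableI => //; exact: measurable_state.
  by apply: measurable_grid; rewrite ?s'n// ltW.
apply: (@le_trans _ _ (\sum_(0 <= z <oo) Q (past n.+1 s' (y' z) `&` grid_exceeds f a (s' n.+1) h K))%E).
  apply: measure_sigma_subadditive => //.
  by apply: measurableI => //; apply: measurable_grid; rewrite ?sge// ltW.
pose c := r * (K%:R * h).
have c0 : 0 <= c by rewrite !mulr_ge0// ltW.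
apply: (@le_trans _ _ (\sum_(0 <= z <oo) (Q (past n s y) * (((p h (y n) z * f z)%:E + (r * (K%:R * h) * p h (y n) z)%:E) * a^-1%:E)))%E).
  apply: lee_nneseries => [z _ _//|z _].
  have pz : 0 <= p h (y n) z by apply: (tf_ge0 ptf); exact: ltW.
  have key : (Q (past n.+1 s' (y' z) `&` grid_exceeds f a (s' n.+1) h K) <=
     Q (past n.+1 s' (y' z)) * ((f (y' z n.+1) + r * (K%:R * h)) / a)%:E)%E.
    have [af'|af'] := leP a (f (y' z n.+1)); last exact: IH.
    apply: (@le_trans _ _ (Q (past n.+1 s' (y' z)))).
      apply: le_measure; rewrite ?inE//.
      by rewrite pastS; apply: measurableI => //; exact: measurable_state.
    rewrite -[leLHS]mule1; apply: lee_wpmul2l => //.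
    rewrite lee_fin ler_pdivlMr// mul1r (le_trans af')// lerDl.
    by rewrite !mulr_ge0// ltW.
  apply: (le_trans key).
  rewrite pastS (mk_markov mk) ?s0 ?(ltW h0)// {1}/y' ltnn -muleA; apply: lee_wpmul2l => //.
  rewrite -EFinD -!EFinM lee_fin [leLHS]mulrA ler_wpM2r ?invr_ge0 ?(ltW a0)//.
  by rewrite mulrDr [X in _ + X <= _]mulrC.
have -> : Q (past n s y) = (fine (Q (past n s y)))%:E.
  by rewrite fineK// fin_num_measure.
rewrite nneseriesZl; last first.
  move=> z _; rewrite -EFinD -EFinM lee_fin.
  have pz : 0 <= p h (y n) z by apply: (tf_ge0 ptf); exact: ltW.
  by rewrite divr_ge0 ?(ltW a0)// addr_ge0// !mulr_ge0// ltW.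
apply: lee_wpmul2l; first by rewrite lee_fin fine_ge0.
under eq_eseriesr do rewrite muleC.
have pz z : 0 <= p h (y n) z by apply: (tf_ge0 ptf); exact: ltW.
rewrite nneseriesZl; last first.
  by move=> z _; rewrite -EFinD lee_fin addr_ge0// !mulr_ge0// ltW.
rewrite nneseriesD; last 2 first.
- by move=> z _ _; rewrite lee_fin mulr_ge0.
- by move=> z _ _; rewrite lee_fin !mulr_ge0// ltW.
under [X in (_ * (_ + X))%E]eq_eseriesr do rewrite EFinM.
rewrite nneseriesZl; last by move=> z _; rewrite lee_fin.
rewrite (tf_sum1 ptf _ (ltW h0)) mule1.
rewrite [leRHS](_ : _ = a^-1%:E * (f (y n) + r * (K.+1%:R * h))%:E)%E; last first.
  by rewrite -EFinM mulrC.
apply: lee_wpmul2l; first by rewrite lee_fin invr_ge0 ltW.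
have := leeD (Pf (y n)) (lexx (r * (K%:R * h))%:E).
move=> /le_trans; apply; rewrite -EFinD lee_fin -addrA lerD2l -mulrDr.
by rewrite ler_wpM2l// -natr1 mulrDl mul1r addrC.
Qed.

(* The walk is observed on dyadic grids of mesh 2^-m; right-continuity of the
   paths makes this enough. *)
Lemma walk_maximal_inequality (f : nat -> R) (a t c r : R) (J : nat -> nat) :
  (forall z, 0 <= f z) -> 0 < a -> 0 < t -> 0 <= r ->
  (forall h y, 0 <= h -> (Pt p h f y <= (f y + r * h)%:E)%E) ->
  (forall m, 2 * J m <= J m.+1)%N ->
  (forall m, r * ((J m)%:R * (2 ^+ m)^-1) <= c) ->
  exists D : set T, [/\ measurable D,
    (Q D <= (Pt p t f 0%N + c%:E) * a^-1%:E)%E &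
    forall x s, t <= s -> (exists m, s < t + (J m)%:R * (2 ^+ m)^-1) ->
      a <= f (X s x) -> D x].
Proof.
move=> f0 a0 t0 r0 Pf JS Jc.
pose h m : R := (2 ^+ m)^-1.
have h0 m : 0 < h m by rewrite invr_gt0 exprn_gt0.
pose D m := grid_exceeds f a t (h m) (J m).
have mD m : measurable (D m) by apply: measurable_grid; exact: ltW.
have QD m : (Q (D m) <= (Pt p t f 0%N + c%:E) * a^-1%:E)%E.
  (* The walk starts at 0 only almost surely, so the argument is run on [A] and its null complement
     is added. *)
  pose A := X 0 @^-1` [set 0%N].
  have mA : measurable A by exact: measurable_state.
  have QA : Q (~` A) = 0%E by rewrite probability_setC// (mk_init mk) subee.
  (* The observed past is (0 at time 0, z at time t), of probability at most p t 0 z; summing over z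
     turns the grid bound into P_t f (0). *)
  pose s k := if k == 0%N then 0 else t.
  pose y z k := if k == 0%N then 0%N else z.
  have inc k : (k < 1)%N -> s k < s k.+1 by case: k.
  have mp z : measurable (past 1 s (y z)).
    by apply: measurable_past => -[|k]//= _; rewrite /s/= ltW.
  have Qp z : (Q (past 1 s (y z)) <= (p t 0%N z)%:E)%E.
    have /= E := @mk_markov _ _ _ _ _ _ mk 0%N (fun=> 0) (fun=> 0%N) t z (lexx 0)
      (fun k (k0 : (k < 0)%N) => False_ind _ (notF k0)) (ltW t0).
    apply: (@le_trans _ _ (Q (\bigcap_(k < 1) X 0 @^-1` [set 0%N] `&` X (0 + t) @^-1` [set z]))).
      apply: le_measure; rewrite ?inE//.
        apply: measurableI; last by apply: measurable_state; rewrite add0r ltW.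
        by apply: bigcap_measurable => //; exists 0%N.
      move=> x px; split; first by move=> k /= _; exact: (px 0%N isT).
      by rewrite add0r; exact: (px 1%N isT).
    rewrite E -[leRHS]mul1e; apply: lee_wpmul2r.
      by rewrite lee_fin (tf_ge0 ptf)// ltW.
    by apply: probability_le1; apply: bigcap_measurable => //; exists 0%N.
  apply: (@le_trans _ _ (Q ((D m `&` A) `|` (~` A)))).
    apply: le_measure; rewrite ?inE//.
      by apply: measurableU; [exact: measurableI|exact: measurableC].
    by move=> x Dx; have [Ax|Ax] := pselect (A x); [left|right].
  apply: (@le_trans _ _ (Q (D m `&` A) + Q (~` A))%E).
    by apply: measureU2; [exact: measurableI|exact: measurableC].
  rewrite QA adde0.
  have cover : D m `&` A `<=` \bigcup_z (past 1 s (y z) `&` grid_exceeds f a (s 1%N) (h m) (J m)).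
    move=> x [Dx Ax]; exists (X t x) => //; split=> //.
    by move=> [|[|k]].
  apply: (@le_trans _ _ (\sum_(0 <= z <oo) Q (past 1 s (y z) `&` grid_exceeds f a (s 1%N) (h m) (J m)))%E).
    apply: measure_sigma_subadditive => //; last exact: measurableI.
    by move=> z; apply: measurableI; [exact: mp|exact: mD].
  have pz z : 0 <= p t 0%N z by apply: (tf_ge0 ptf); exact: ltW.
  have c0 : 0 <= c by apply: le_trans (Jc 0%N); rewrite !mulr_ge0// ?invr_ge0 ?exprn_ge0.
  apply: (@le_trans _ _ (\sum_(0 <= z <oo) (a^-1%:E * ((p t 0%N z * f z)%:E + (c * p t 0%N z)%:E)))%E).
    apply: lee_nneseries => [z _ _//|z _].
    have := past_grid_le f0 a0 (h0 m) r0 (fun y => Pf _ y (ltW (h0 m))) (J m) (y z) (lexx 0 : 0 <= s 0%N) inc.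
    move=> /le_trans; apply.
    apply: (@le_trans _ _ ((p t 0%N z)%:E * ((f z + c) / a)%:E)%E).
      apply: (@le_trans _ _ ((p t 0%N z)%:E * ((f (y z 1%N) + r * ((J m)%:R * h m)) / a)%:E)%E).
        apply: lee_wpmul2r => //.
        by rewrite lee_fin divr_ge0 ?(ltW a0)// addr_ge0// !mulr_ge0// ltW.
      apply: lee_wpmul2l; first by rewrite lee_fin.
      by rewrite lee_fin ler_wpM2r ?invr_ge0 ?(ltW a0)// lerD2l; exact: Jc.
    rewrite -EFinD -!EFinM lee_fin le_eqVlt; apply/orP; left; apply/eqP.
    ring.
  rewrite nneseriesZl; last by move=> z _; rewrite -EFinD lee_fin addr_ge0// !mulr_ge0.
  rewrite muleC; apply: lee_wpmul2r; first by rewrite lee_fin invr_ge0 ltW.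
  rewrite nneseriesD; last 2 first.
  - by move=> z _ _; rewrite lee_fin mulr_ge0.
  - by move=> z _ _; rewrite lee_fin !mulr_ge0.
  under [X in (_ + X <= _)%E]eq_eseriesr do rewrite EFinM.
  rewrite nneseriesZl; last by move=> z _; rewrite lee_fin.
  by rewrite (tf_sum1 ptf _ (ltW t0)) mule1.
(* Halving the mesh while at least doubling the number of points keeps all old grid points, so the
   events increase and their union has the common bound. *)
have ndD : nondecreasing_seq D.
  apply/nondecreasing_seqP => m; apply/subsetPset => x [j /= jJ aj].
  exists (2 * j)%N => /=; first by rewrite ltnS (leq_trans _ (JS m))// leq_mul2l.
  have -> // : t + (2 * j)%:R * h m.+1 = t + j%:R * h m.
  by rewrite natrM /h exprS invfM mulrACA mulfV ?mul1r// pnatr_eq0.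
have mUD : measurable (\bigcup_m D m) by exact: bigcup_measurable.
exists (\bigcup_m D m); split => //.
  have cv := nondecreasing_cvg_mu (mu := Q) mD mUD ndD.
  rewrite -(cvg_lim _ cv)//; apply: lime_le; first by apply/cvg_ex; eexists; exact: cv.
  by apply: nearW => m; exact: QD.
move=> x s ts [m0 sm0] afs.
have s0 : 0 <= s by rewrite (le_trans _ ts)// ltW.
have [dl /= dl0 hdl] := cadlag_right cad x s0.
have nd : {homo (fun m => (J m)%:R * h m) : m n / (m <= n)%N >-> m <= n}.
  apply/nondecreasing_seqP => m; rewrite /h exprS invfM mulrA ler_wpM2r//.
  by rewrite ler_pdivlMr// -natrM ler_nat mulnC.
(* To the right of s the path is constant for a time dl and the horizon of grid m0 is not yet over;
   a mesh below g puts a grid point, the j-th below, in this window. *)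
pose g := Num.min dl (t + (J m0)%:R * h m0 - s).
have gdl : g <= dl by rewrite ge_min lexx.
have gJ : g <= t + (J m0)%:R * h m0 - s by rewrite ge_min lexx orbT.
have g0 : 0 < g by rewrite lt_min dl0 subr_gt0.
pose m := maxn m0 (Num.truncn g^-1).+1.
have hm : h m < g.
  rewrite /h invf_plt ?posrE ?exprn_gt0//.
  apply: (lt_le_trans (truncnS_gt _)).
  rewrite -natrX ler_nat; apply: leq_trans (ltnW (ltn_expl m _)) => //.
  exact: leq_maxr.
pose j := (Num.truncn ((s - t) / h m)).+1.
have jgt : (s - t) / h m < j%:R := truncnS_gt _.
have jle : j%:R <= (s - t) / h m + 1.
  rewrite -natr1 lerD2r; have := truncn_itv (_ : 0 <= (s - t) / h m).
  rewrite divr_ge0 ?subr_ge0 ?(ltW (h0 m))// => /(_ isT) /andP[]//.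
have js : s < t + j%:R * h m.
  by rewrite -ltrBlDl -ltr_pdivrMr.
have jsg : t + j%:R * h m <= s + h m.
  rewrite -(lerD2l (- t)) addrA addNr add0r.
  have -> : - t + (s + h m) = ((s - t) / h m + 1) * h m.
    by rewrite mulrDl divfK ?gt_eqF// mul1r addrA [- t + s]addrC.
  by rewrite ler_wpM2r// ltW.
exists m => //; exists j => /=.
  rewrite ltnS -(ler_nat R) -(ler_pM2r (h0 m)).
  apply: (@le_trans _ _ ((J m0)%:R * h m0)); last by apply: nd; exact: leq_maxl.
  by clear -gJ hm jsg; lra.
rewrite (hdl (t + j%:R * h m))//=.
rewrite ltr0_norm ?subr_lt0// opprB.
by clear -gdl hm jsg; lra.
Qed.

End MaximalInequality.

(** * Lyapunov functions built from the potential *)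

Section LyapunovFunctions.
Context {R : realType}.
Variables (q U : nat -> R).
Hypotheses (q00 : q 0%N = 0) (q01 : forall y, 0 <= q y < 1).
Hypotheses (U0 : forall y, 0 < U y).
Hypothesis qU : forall y, q y.+1 * U y = (1 - q y.+1) * U y.+1.

Lemma q_range y : 0 <= q y <= 1.
Proof. by case/andP: (q01 y) => -> /ltW. Qed.

Let p0 y : 0 < 1 - q y.
Proof. by rewrite subr_gt0; case/andP: (q01 y). Qed.

(** Increments of the scale function of the walk, cut off outside [y0, n) and normalised to 1 at y0;
    [U] plays the role of exp V. *)
Definition valley_weight (y0 n z : nat) : R :=
  if (y0 <= z < n)%N then U z / U y0 else 0.

Definition valley_fun (y0 n y : nat) : R := \sum_(0 <= z < y) valley_weight y0 n z.

Lemma valley_weight_ge0 y0 n z : 0 <= valley_weight y0 n z.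
Proof.
rewrite /valley_weight; case: ifP => // _.
by rewrite divr_ge0// ltW.
Qed.

Lemma valley_funS y0 n y :
  valley_fun y0 n y.+1 = valley_fun y0 n y + valley_weight y0 n y.
Proof. by rewrite /valley_fun big_nat_recr. Qed.

Lemma valley_fun_mono y0 n y z : (y <= z)%N ->
  valley_fun y0 n y <= valley_fun y0 n z.
Proof.
move=> yz; rewrite /valley_fun (big_cat_nat _ yz)//= lerDl.
by rewrite sumr_ge0// => *; exact: valley_weight_ge0.
Qed.

Lemma valley_fun_bound y0 n y : 0 <= valley_fun y0 n y <= valley_fun y0 n n.
Proof.
apply/andP; split; first by rewrite sumr_ge0// => *; exact: valley_weight_ge0.
have [yn|ny] := leqP y n; first exact: valley_fun_mono.
rewrite /valley_fun (big_cat_nat _ (ltnW ny))//= [X in _ + X]big_nat.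
rewrite [X in _ + X]big1 ?addr0// => i /andP[ni _].
by rewrite /valley_weight [(i < n)%N]ltnNge ni andbF.
Qed.

Lemma valley_fun_ge y0 n z : (y0 <= z < n)%N -> U z / U y0 <= valley_fun y0 n n.
Proof.
move=> /andP[yz zn]; apply: (le_trans _ (valley_fun_mono _ _ zn)).
rewrite valley_funS /valley_weight yz zn lerDr.
by have /andP[] := valley_fun_bound y0 n z.
Qed.

(** Strictly inside [y0, n) the function is harmonic by [qU]. At y0 the first increment, equal to 1,
    appears with weight 1 - q; at n the increments stop, which only lowers the average. *)
Lemma avg_valley_fun y0 n y :
  avg q (valley_fun y0 n) y <= valley_fun y0 n y + 1.
Proof.
have q1 z : 1 - q z <= 1 by rewrite gerBl; case/andP: (q01 z).
have w0 := valley_weight_ge0 y0 n.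
have v0 : valley_weight y0 n y0 <= 1.
  rewrite /valley_weight leqnn/=; case: ifP => // _.
  by rewrite divff// gt_eqF.
case: y => [|y]; rewrite /avg /=.
  rewrite q00 mul0r add0r subr0 mul1r valley_funS lerD2l.
  rewrite /valley_weight; case: ifP => [/andP[]|_]; last exact: ler01.
  by rewrite leqn0 => /eqP -> _; rewrite divff// gt_eqF.
have [qy0 _] := andP (q01 y.+1).
rewrite !valley_funS.
set F := valley_fun y0 n y; set a := valley_weight _ _ _; set c := valley_weight _ _ _.
have key : (1 - q y.+1) * c <= q y.+1 * a + 1.
  have [->|cn0] := eqVneq c 0; first by rewrite mulr0 addr_ge0// mulr_ge0// w0.
  have yn : (y0 <= y.+1 < n)%N.
    by apply: contra_neqT cn0; rewrite /c /valley_weight => /negbTE ->.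
  case/andP: yn; rewrite leq_eqVlt => /orP[/eqP ye yn|y0y yn].
    have c1 : c <= 1 by rewrite /c -ye.
    apply: (@le_trans _ _ 1); last by rewrite lerDr mulr_ge0// w0.
    by rewrite -[leRHS]mul1r ler_pM// ?(ltW (p0 _))// w0.
  have y0y' : (y0 <= y)%N by rewrite -ltnS.
  rewrite /a /c /valley_weight y0y' (ltnW yn) (ltnW y0y) yn /=.
  by rewrite !mulrA qU lerDl.
clear -key; lra.
Qed.

Variable (h : nat -> R).
Hypotheses (h_ge0 : forall y, 0 <= h y) (hS : forall y, h y = h y.+1 + U y).

Let h_gt0 y : 0 < h y.
Proof. by rewrite hS ltr_wpDl. Qed.

Lemma h_mono y z : (y <= z)%N -> h z <= h y.
Proof.
move=> /subnK <-; elim: (z - y)%N => [|k IH]; first by rewrite add0n.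
by apply: le_trans IH; rewrite addSn [leRHS]hS lerDl ltW.
Qed.

(** Below w the function is constant and above w it is harmonic by [qU]; at w only the step up
    changes the value, by [U w]. *)
Lemma avg_hmax w y :
  avg q (fun z => h (maxn z w)) y = h (maxn y w) - (if y == w then (1 - q w) * U w else 0).
Proof.
rewrite /avg; case: y => [|y].
  rewrite q00 mul0r add0r subr0 mul1r.
  case: w => [|w]; first by rewrite eqxx q00 subr0 mul1r !maxn0 [in RHS]hS addrK.
  by rewrite !maxnE/= subn0 subSS subn0 add0n add1n subr0.
have [yw|yw|yw] := ltngtP y.+1 w.
- have -> : maxn y.+1.-1 w = w by apply/maxn_idPr; rewrite /= (leq_trans _ (ltnW yw)).
  have -> : maxn y.+2 w = w by apply/maxn_idPr.
  by ring.
- rewrite /=.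
  have -> : maxn y w = y by apply/maxn_idPl.
  have -> : maxn y.+2 w = y.+2 by apply/maxn_idPl; rewrite (leq_trans (ltnW yw)).
  rewrite (hS y) (hS y.+1); have := qU y.
  by set a := U y; set c := U y.+1; move=> e; rewrite subr0 !mulrDr e; ring.
- rewrite -yw /=.
  have -> : maxn y y.+1 = y.+1 by apply/maxn_idPr.
  have -> : maxn y.+2 y.+1 = y.+2 by apply/maxn_idPl.
  by rewrite (hS y.+1); ring.
Qed.

(** Dividing [h (maxn _ w)] by U w (1 - q w) makes its defect at w equal to 1. With weights [h w]
    the sum over w < n therefore has defect h on [0, n): it is the Green potential of h, and
    [green_total] bounds its ratio to h, because h decreases. *)
Definition green_total (n : nat) : R := \sum_(0 <= w < n) h w / (U w * (1 - q w)).

(* The function h (maxn _ w) is superharmonic, with a defect only at w. *)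
Definition escape_fun (n y : nat) : R :=
  h y + \sum_(0 <= w < n) (h w / (U w * (1 - q w)) / green_total n) * h (maxn y w).

Let gt0 w : 0 < h w / (U w * (1 - q w)).
Proof. by rewrite divr_gt0// mulr_gt0. Qed.

Lemma green_total_gt0 n : (0 < n)%N -> 0 < green_total n.
Proof.
case: n => // n _; rewrite /green_total big_nat_recl// ltr_pwDl// sumr_ge0// => *.
exact: ltW.
Qed.

Lemma escape_fun_bound n y : (0 < n)%N -> h y <= escape_fun n y <= 2 * h y.
Proof.
move=> n0; have S0 := green_total_gt0 n0; rewrite /escape_fun; apply/andP; split.
  by rewrite lerDl sumr_ge0// => w _; rewrite mulr_ge0// divr_ge0// ltW.
rewrite mulr2n mulrDl mul1r lerD2l.
apply: (@le_trans _ _ (\sum_(0 <= w < n) (h w / (U w * (1 - q w)) / green_total n) * h y)).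
  apply: ler_sum => w _; rewrite ler_wpM2l//; first by rewrite divr_ge0// ltW.
  by apply: h_mono; exact: leq_maxl.
by rewrite -mulr_suml -mulr_suml -/(green_total n) divff ?mul1r// gt_eqF.
Qed.

Lemma avg_escape_fun n y : (0 < n)%N ->
  avg q (escape_fun n) y <=
  escape_fun n y - (if (y < n)%N then h y / green_total n else 0).
Proof.
move=> n0; have S0 := green_total_gt0 n0.
pose c w := h w / (U w * (1 - q w)) / green_total n.
have avgh : avg q h y <= h y.
  have := avg_hmax 0 y; rewrite /avg !maxn0 => ->.
  case: eqP => _; rewrite ?subr0// gerBl mulr_ge0// ltW//.
have -> : avg q (escape_fun n) y = avg q h y + \sum_(0 <= w < n) c w * avg q (fun z => h (maxn z w)) y.
  rewrite /avg /escape_fun !mulrDr addrACA; congr (_ + _).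
  rewrite !mulr_sumr -big_split/=; apply: eq_bigr => w _; rewrite -/(c w); ring.
rewrite /escape_fun -[leRHS]addrA; apply: (lerD avgh).
rewrite [leLHS](eq_bigr (fun w => c w * h (maxn y w) - c w * (if y == w then (1 - q w) * U w else 0))); last first.
  by move=> w _; rewrite avg_hmax mulrBr.
rewrite sumrB lerD2l lerN2.
case: ifP => yn; last first.
  rewrite sumr_ge0// => w _; rewrite mulr_ge0//; first by rewrite divr_ge0// ltW.
  by case: ifP => // _; rewrite mulr_ge0// ltW.
rewrite big_mkord (bigD1 (Ordinal yn))//= eqxx big1 ?addr0; last first.
  by move=> i; rewrite -val_eqE/= eq_sym => /negbTE ->; rewrite mulr0.
rewrite /c [U y * _]mulrC mulrAC divfK ?lexx// mulf_neq0// gt_eqF//.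
Qed.

End LyapunovFunctions.

(** * Delay and escape of the walk *)

Section WalkEstimates.
Context {R : realType}.
Variables (q U : nat -> R).
Hypotheses (q00 : q 0%N = 0) (q01 : forall y, 0 <= q y < 1).
Hypotheses (U0 : forall y, 0 < U y).
Hypothesis qU : forall y, q y.+1 * U y = (1 - q y.+1) * U y.+1.
Variables (p : R -> nat -> nat -> R).
Hypotheses (ptf : transition_function p) (nn : nearest_neighbour_rates q p).
Context (d : measure_display) (T : measurableType d) (Q : probability T R).
Variables (X : R -> T -> nat) (mk : markov_from0 p Q X) (cad : cadlag_process X).

(** The drift of [valley_fun] is at most 1, so its mean grows at most linearly in time, whereas it
    is at least U z0 / U y0 from n on. The time window starts at 1 since the maximal inequality asks
    for a positive starting time. *)
Lemma valley_crossing (N n y0 z0 : nat) : (y0 <= z0 < n)%N ->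
  exists D : set T, [/\ measurable D,
    (Q D <= ((N%:R + 1) * (U y0 / U z0))%:E)%E &
    forall x s, 1 <= s -> s < 1 + N%:R -> (n <= X s x)%N -> D x].
Proof.
move=> yzn; pose F := valley_fun U y0 n.
have F0 z : 0 <= F z by case/andP: (valley_fun_bound U0 y0 n z).
have lyap (t : R) y : 0 <= t -> (Pt p t F y <= (F y + 1 * t)%:E)%E.
  move=> t0.
  have h1 z : avg q F z <= (1 - 0) * F z + 1.
    by rewrite subr0 mul1r; exact: avg_valley_fun.
  have := Pt_lyapunov ptf nn q00 (q_range q01) (valley_fun_bound U0 y0 n)
    (lexx _) ler01 h1 y t0.
  by rewrite mul0r oppr0 expR0 !mul1r.
have Fn : 0 < F n.
  by apply: lt_le_trans (valley_fun_ge U0 yzn); rewrite divr_gt0.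
(* N 2^m points of mesh 2^-m cover a horizon of length N, over which the drift adds up to c = N. *)
have [] := walk_maximal_inequality ptf mk cad (c := N%:R)
  (J := fun m => (N * 2 ^ m)%N) F0 Fn ltr01 ler01 lyap.
- by move=> m; rewrite expnS mulnCA.
- by move=> m; rewrite mul1r natrM natrX mulfK// expf_neq0// pnatr_eq0.
move=> D [mD QD hD]; exists D; split => //.
  apply: (le_trans QD).
  apply: (@le_trans _ _ (((1 + N%:R)%:E) * (F n)^-1%:E)%E).
    apply: lee_wpmul2r; first by rewrite lee_fin invr_ge0 ltW.
    rewrite EFinD leeD2r//; apply: (le_trans (lyap 1 0%N ler01)).
    by rewrite mul1r lee_fin /F /valley_fun big_geq ?add0r.
  rewrite -EFinM lee_fin addrC ler_wpM2l ?addr_ge0//.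
  rewrite -[U y0 / _]invf_div lef_pV2 ?posrE ?divr_gt0//.
  exact: valley_fun_ge.
move=> x s s1 sN nX; apply: (hD x s s1).
  by exists 0%N; rewrite expn0 muln1 expr0 invr1 mulr1.
exact: valley_fun_mono.
Qed.

Variable (h : nat -> R).
Hypotheses (h_ge0 : forall y, 0 <= h y) (hS : forall y, h y = h y.+1 + U y).

Lemma no_return (n m : nat) (t : R) : (0 < n)%N -> 0 < t ->
  exists D : set T, [/\ measurable D,
    (Q D <= ((2 * expR (- (t / (2 * green_total q U h n))) * h 0%N
       + h n * t / green_total q U h n) / h m)%:E)%E &
    forall x s, t <= s -> (X s x <= m)%N -> D x].
Proof.
move=> n0 t0; set S := green_total q U h n.
have S0 : 0 < S by exact: green_total_gt0.
pose G := escape_fun q U h n.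
have Gb y : h y <= G y <= 2 * h y by exact: escape_fun_bound.
have hm := h_mono U0 hS.
have G0 y : 0 <= G y by case/andP: (Gb y) => /(le_trans (h_ge0 y)).
have GM y : 0 <= G y <= 2 * h 0%N.
  rewrite G0; case/andP: (Gb y) => _ /le_trans; apply.
  by rewrite ler_wpM2l// hm.
have avgG y : avg q G y <= G y - (if (y < n)%N then h y / S else 0).
  exact: avg_escape_fun.
have h0 : 0 < h m by rewrite hS ltr_wpDl.
have lyap0 (u : R) y : 0 <= u -> (Pt p u G y <= (G y + 0 * u)%:E)%E.
  move=> u0.
  have h1 z : avg q G z <= (1 - 0) * G z + 0.
    rewrite subr0 mul1r addr0; apply: (le_trans (avgG z)).
    by rewrite gerBl; case: ifP => // _; rewrite divr_ge0// ltW.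
  have := Pt_lyapunov ptf nn q00 (q_range q01) GM (lexx _) (lexx _) h1 y u0.
  by rewrite mul0r oppr0 expR0 mul1r.
have l0 : 0 <= (2 * S)^-1 by rewrite invr_ge0 mulr_ge0// ltW.
have lyapl : (Pt p t G 0%N <= (expR (- (t / (2 * S))) * G 0%N + h n / S * t)%:E)%E.
  have hn0 : 0 <= h n / S by rewrite divr_ge0// ltW.
  suff h1 y : avg q G y <= (1 - (2 * S)^-1) * G y + h n / S.
    have := Pt_lyapunov ptf nn q00 (q_range q01) GM l0 hn0 h1 0%N (ltW t0).
    by rewrite [_^-1 * t]mulrC.
  apply: (le_trans (avgG y)); have /andP[_ G2] := Gb y.
  have hh : (2 * S)^-1 * G y <= h y / S.
    rewrite ler_pdivlMr// mulrC mulrA invfM mulrCA mulfV ?gt_eqF// mulr1.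
    by rewrite ler_pdivrMl.
  rewrite [in leRHS]mulrDl mul1r mulNr -[leRHS]addrA lerD2l.
  case: ifP => yn.
    by apply: (@le_trans _ _ (- ((2 * S)^-1 * G y))); rewrite ?lerN2// lerDl.
  rewrite oppr0 addrC subr_ge0; apply: (le_trans hh).
  by rewrite ler_wpM2r ?invr_ge0 ?(ltW S0)// hm// leqNgt yn.
(* 4^m points of mesh 2^-m cover a length 2^m, hence in the end all times after t; this is
   affordable as the drift is r = 0. *)
have [] := walk_maximal_inequality ptf mk cad (c := 0)
  (J := fun m => (4 ^ m)%N) G0 h0 t0 (lexx _) lyap0.
- by move=> k; rewrite expnS leq_mul.
- by move=> k; rewrite mul0r.
move=> D [mD QD hD]; exists D; split => //.
  apply: (le_trans QD); rewrite adde0 EFinM; apply: lee_wpmul2r.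
    by rewrite lee_fin invr_ge0 ltW.
  apply: (le_trans lyapl); rewrite lee_fin.
  apply: lerD; last by rewrite mulrAC.
  rewrite -mulrA mulrCA ler_wpM2l ?expR_ge0//.
  by case/andP: (Gb 0%N).
move=> x s ts Xm; apply: (hD x s ts).
  pose k := (Num.truncn (s - t)).+1; exists k.
  have : s - t < k%:R := truncnS_gt _.
  rewrite -ltrBlDl => /lt_le_trans; apply.
  rewrite natrX -expr_div_n (_ : 4%:R / 2 = 2%:R); last first.
    by rewrite -[4%N]/(2 * 2)%N natrM mulfK ?pnatr_eq0.
  by rewrite -natrX ler_nat ltnW// ltn_expl.
by apply: le_trans (hm _ _ Xm) _; case/andP: (Gb (X s x)).
Qed.

End WalkEstimates.

(** * Asymptotic comparisons *)

Section Asymptotics.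
Context {R : realType}.
Implicit Types (x e c C K M : R).

Lemma ln_le_powR e x : 0 < e -> 0 < x -> ln x <= x `^ e / e.
Proof.
move=> e0 x0; rewrite ler_pdivlMr// mulrC -ln_powR.
by apply: ltW; apply: ln_sublinear; exact: powR_gt0.
Qed.

Lemma near_powR_ge e M : 0 < e -> \forall x \near +oo, M <= x `^ e.
Proof.
move=> e0; near=> x.
have M0 : 0 < Num.max M 1 by rewrite lt_max ltr01 orbT.
have x0 : 0 < x by [].
apply: (@le_trans _ _ (Num.max M 1)); first by rewrite le_max lexx.
have -> : Num.max M 1 = (Num.max M 1 `^ e^-1) `^ e.
  by rewrite -powRrM mulVf ?gt_eqF// powRr1// ltW.
apply: ge0_ler_powR; rewrite ?nnegrE ?powR_ge0 ?ltW//.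
Unshelve. all: by end_near.
Qed.

Lemma near_ln_ge M : \forall x \near +oo, M <= ln x.
Proof.
near=> x; have -> : M = ln (expR M) by rewrite expRK.
rewrite (@ler_ln R) ?posrE ?expR_gt0//.
Unshelve. all: by end_near.
Qed.

Lemma near_ln_le_powR e c : 0 < e -> 0 < c -> \forall x \near +oo, ln x <= c * x `^ e.
Proof.
move=> e0 c0; have e20 : 0 < e / 2 by rewrite divr_gt0.
near=> x; have x0 : 0 < x by [].
apply: (le_trans (ln_le_powR e20 x0)).
have -> : x `^ e = x `^ (e / 2) * x `^ (e / 2).
  by rewrite -powRD ?(gt_eqF x0) ?implybT// -splitr.
rewrite mulrA mulrC ler_wpM2r ?powR_ge0//.
rewrite -ler_pdivrMl//.
by near: x; exact: near_powR_ge.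
Unshelve. all: by end_near.
Qed.

Lemma near_powR_ln_le (a e c C : R) : a < e -> 0 < c ->
  \forall x \near +oo, C * (x `^ a * ln x) <= c * x `^ e.
Proof.
move=> ae c0; have C0 : 0 < `|C| + 1 by rewrite ltr_wpDl.
near=> x.
have x1 : 1 < x by [].
have x0 : 0 < x by rewrite (lt_trans ltr01).
have lx : ln x <= c / (`|C| + 1) * x `^ (e - a).
  by near: x; apply: near_ln_le_powR; rewrite ?subr_gt0 ?divr_gt0.
apply: (@le_trans _ _ ((`|C| + 1) * (x `^ a * ln x))).
  rewrite ler_wpM2r ?mulr_ge0 ?powR_ge0 ?ln_ge0 ?ltW//.
  by rewrite ltr_pwDr// ler_norm.
have -> : c * x `^ e = (`|C| + 1) * (x `^ a * (c / (`|C| + 1) * x `^ (e - a))).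
  have -> : x `^ e = x `^ a * x `^ (e - a).
    by rewrite -powRD ?(gt_eqF x0) ?implybT// addrC subrK.
  by field; rewrite gt_eqF.
by rewrite ler_wpM2l ?(ltW C0)// ler_wpM2l ?powR_ge0.
Unshelve. all: by end_near.
Qed.

Lemma near_exp_powR_ge (k : nat) (K c e : R) : 0 < c -> 0 < e ->
  \forall x \near +oo, K * x ^+ k <= expR (c * x `^ e).
Proof.
move=> c0 e0; near=> x.
have x0 : 0 < x by [].
apply: (@le_trans _ _ ((`|K| + 1) * x ^+ k)).
  by rewrite ler_wpM2r ?exprn_ge0 ?(ltW x0)// ler_wpDr// ler_norm.
have K1 : 0 < `|K| + 1 by rewrite ltr_wpDl.
rewrite -[leLHS]lnK ?posrE ?mulr_gt0 ?exprn_gt0// ler_expR.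
rewrite lnM ?posrE ?exprn_gt0// lnXn// [c]splitr mulrDl; apply: lerD.
  rewrite -ler_pdivrMl ?divr_gt0//.
  by near: x; exact: near_powR_ge.
rewrite -[_ *+ k]mulr_natl.
have -> : k%:R * ln x = k%:R * (x `^ 0 * ln x) by rewrite powRr0 mul1r.
by near: x; apply: near_powR_ln_le => //; rewrite divr_gt0.
Unshelve. all: by end_near.
Qed.

Definition barrier (A alpha x : R) : R := A * (x `^ alpha * ln x).

Section barrier.
Variables (A alpha : R).
Hypotheses (A0 : 0 < A) (al0 : 0 < alpha).

Lemma barrier_mono x y : 1 <= x -> x <= y -> barrier A alpha x <= barrier A alpha y.
Proof.
move=> x1 xy; have x0 := lt_le_trans ltr01 x1; have y0 := lt_le_trans x0 xy.
rewrite ler_wpM2l ?(ltW A0)// ler_pM ?powR_ge0 ?ln_ge0//.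
  by apply: ge0_ler_powR; rewrite ?nnegrE ?(ltW x0) ?(ltW y0) ?(ltW al0).
by rewrite ler_ln ?posrE.
Qed.

Lemma barrier_ge0 x : 1 <= x -> 0 <= barrier A alpha x.
Proof. by move=> x1; rewrite !mulr_ge0 ?(ltW A0) ?powR_ge0 ?ln_ge0. Qed.

Lemma near_exp_barrier_ge (k : nat) (K c : R) : 0 < c ->
  \forall x \near +oo, K * x ^+ k <= expR (c * barrier A alpha x).
Proof.
move=> c0; near=> x.
apply: (@le_trans _ _ (expR (c * A * x `^ alpha))).
  by near: x; apply: near_exp_powR_ge => //; exact: mulr_gt0.
rewrite ler_expR -mulrA ler_wpM2l ?(ltW c0)// ler_wpM2l ?(ltW A0)//.
rewrite ler_peMr ?powR_ge0//.
by near: x; exact: near_ln_ge.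
Unshelve. all: by end_near.
Qed.

Lemma near_barrier_le (c C e : R) : 0 < c -> alpha < e ->
  \forall x \near +oo, C * barrier A alpha x <= c * x `^ e.
Proof.
move=> c0 ae; near=> x; rewrite /barrier mulrA.
by near: x; exact: near_powR_ln_le.
Unshelve. all: by end_near.
Qed.

End barrier.

Lemma near_natr (Q : R -> Prop) :
  (\forall x \near +oo, Q x) -> \forall n \near \oo, Q n%:R.
Proof.
move=> [M [Mr hM]]; near=> n; apply: hM.
by near: n; exact: nbhs_infty_gtr.
Unshelve. all: by end_near.
Qed.

(** Telescoping against 2 - 1 / (n + 1); the term k = 0 vanishes because the inverse of 0 is 0. *)
Lemma sum_inv_sqr_le n : \sum_(0 <= k < n) (k%:R ^- 2 : R) <= 2.
Proof.
have base : \sum_(0 <= k < 2) (k%:R ^- 2 : R) = 1.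
  by rewrite big_nat_recr//= big_nat1 expr0n/= invr0 expr1n invr1 add0r.
case: n => [|[|n]]; first by rewrite big_geq.
  by rewrite big_nat1 expr0n/= invr0.
suff : \sum_(0 <= k < n.+2) (k%:R ^- 2 : R) <= 2 - n.+1%:R^-1.
  by move=> /le_trans; apply; rewrite gerBl invr_ge0.
elim: n => [|n IH]; first by rewrite base invr1; lra.
rewrite big_nat_recr//=; apply: (le_trans (lerD IH (lexx _))).
rewrite -addrA lerD2l lerNr opprD opprK lerBrDl -lerBrDr.
have n10 : 0 < n.+1%:R :> R by rewrite ltr0n.
have n20 : 0 < n.+2%:R :> R by rewrite ltr0n.
have -> : n.+1%:R^-1 - n.+2%:R^-1 = (n.+1%:R * n.+2%:R)^-1 :> R.
  rewrite -[LHS](mulfK (_ : n.+1%:R * n.+2%:R != 0)) ?mulf_neq0 ?gt_eqF//.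
  rewrite mulrBl mulKf ?gt_eqF// [n.+1%:R * _]mulrC mulKf ?gt_eqF//.
  by rewrite -[n.+2%:R]natr1 [_ + 1]addrC addrK mul1r [1 + _]addrC.
rewrite lef_pV2 ?posrE ?mulr_gt0 ?exprn_gt0//.
by rewrite expr2 ler_wpM2r ?(ltW n20)// ler_nat.
Qed.

(** All but finitely many terms are below k^-2, and each of the others is at most 1. *)
Lemma sum_exp_powR_bounded c e : 0 < c -> 0 < e ->
  exists C, forall m n, \sum_(m <= k < n) expR (- (c * k%:R `^ e)) <= C.
Proof.
move=> c0 e0.
have [N _ hN] := near_natr (near_exp_powR_ge 2 1 c0 e0).
exists (N.+1%:R + 2) => m n.
have le1 k : expR (- (c * k%:R `^ e)) <= 1.
  by rewrite expR_le1 oppr_le0 mulr_ge0 ?powR_ge0// ltW.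
have ge0 k : 0 <= expR (- (c * k%:R `^ e)) by exact: expR_ge0.
have [nm|mn] := leqP n m; first by rewrite big_geq// addr_ge0.
apply: (@le_trans _ _ (\sum_(0 <= k < n) expR (- (c * k%:R `^ e)))).
  rewrite [leRHS](big_cat_nat _ (ltnW mn))//= lerDr.
  by apply: sumr_ge0 => k _.
apply: (@le_trans _ _ (\sum_(0 <= k < n) ((if (k < N.+1)%N then 1 else 0) + k%:R ^- 2))).
  apply: ler_sum => k _; case: ifP => kN.
    by rewrite ler_wpDr// invr_ge0 exprn_ge0.
  have Nk : (N < k)%N by rewrite ltnNge -ltnS kN.
  rewrite add0r expRN; have := hN k (ltnW Nk); rewrite /= mul1r => h.
  by rewrite lef_pV2 ?posrE ?expR_gt0 ?exprn_gt0 ?ltr0n// (leq_trans _ Nk).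
rewrite big_split/=; apply: lerD; last exact: sum_inv_sqr_le.
rewrite -big_mkcond/= big_nat_cond.
apply: (@le_trans _ _ (\sum_(0 <= k < N.+1) 1)); last by rewrite sumr_const_nat subn0.
have [nN|Nn] := leqP n N.+1.
  rewrite [leRHS](big_cat_nat _ nN)//= -[leLHS]addr0; apply: lerD; last exact: sumr_ge0.
  by rewrite -big_nat_cond big_mkcond ler_sum// => k _; case: ifP.
rewrite -big_nat_cond (big_cat_nat _ (ltnW Nn))//= -[leRHS]addr0; apply: lerD.
  by rewrite big_mkcond ler_sum// => k _; case: ifP.
by rewrite big_nat_cond big1// => k /andP[/andP[Nk _]]; rewrite ltnNge Nk.
Qed.

End Asymptotics.

(** * The walk in a good environment *)

Section BorelCantelli.
Context {R : realType} {d : measure_display} {T : measurableType d}.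
Variable Q : probability T R.

(** The first Borel-Cantelli lemma, with each bad event merely covered by a measurable set: for the
    walk the bad events range over uncountably many times. The rate n^-2 is the common target of the
    probability bounds. *)
Lemma ae_eventually_not (bad : nat -> T -> Prop) :
  (\forall n \near \oo, exists D : set T, [/\ measurable D,
     (Q D <= (n%:R ^- 2)%:E)%E & forall x, bad n x -> D x]) ->
  {ae Q, forall x, \forall n \near \oo, ~ bad n x}.
Proof.
move=> [N _ hN].
have /choice[D hD] : forall n, exists D : set T, [/\ measurable D,
    (Q D <= (n%:R ^- 2)%:E)%E & forall x, (N <= n)%N -> bad n x -> D x].
  move=> n; have [Nn|nN] := leqP N n.
    by have [D [mD QD bD]] := hN n Nn; exists D; split => // x _; exact: bD.
  exists set0; split => //.
  by rewrite measure0 lee_fin invr_ge0 exprn_ge0.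
have mD n : measurable (D n) by have [] := hD n.
have sumD : (\sum_(n <oo) Q (D n) < +oo)%E.
  apply: (@le_lt_trans _ _ (\sum_(0 <= n <oo) (n%:R ^- 2)%:E)%E).
    by apply: lee_nneseries => // n _; have [] := hD n.
  apply: (@le_lt_trans _ _ 2%:E); last exact: ltry.
  apply: (@nneseries_EFin_le _ _ _ 0%N) => [k|n _].
    by rewrite invr_ge0 exprn_ge0.
  exact: sum_inv_sqr_le.
have Q0 := lim_sup_set_cvg0 mD sumD.
exists (lim_sup_set D); split => //.
  apply: bigcap_measurable => // n _.
  by apply: bigcup_measurable => k _; exact: mD.
move=> x /= nx n _; apply: contrapT => H; apply: nx.
exists (maxn n N) => // k /=; rewrite geq_max => /andP[nk Nk] bk; apply: H.
by exists k => //; have [_ _] := hD k; apply.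
Qed.

End BorelCantelli.

(** * Good environments and the decay of the potential *)

Section Environment.
Context {R : realType}.
Variables (b alpha A : R) (w : nat -> R).
Hypotheses (b0 : 0 < b) (al0 : 0 < alpha) (al1 : alpha < 1 / 2) (A0 : 0 < A).

Definition wsum (x : nat) : R := \sum_(1 <= i < x.+1) w i.

Definition potential (x : nat) : R :=
  \sum_(1 <= i < x.+1) (w i - b * i%:R `^ (- alpha)).

(** All that the walk needs from the environment. [good_lln] makes the fluctuations negligible
    against the drift of V, which is of order x^(1 - alpha), so V falls over macroscopic distances;
    [good_barrier] serves the escape of the walk, [good_valley] its delay. *)
Record good_env : Prop := {
  good_lln : forall e, 0 < e ->
    \forall x \near \oo, `|wsum x| <= e * x%:R `^ (1 - alpha);
  good_barrier : forall e, 0 < e -> \forall y \near \oo, forall z, (y <= z)%N ->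
    potential z - potential y <= (1 + e) * barrier A alpha y%:R;
  good_valley : forall e, 0 < e -> \forall n \near \oo, exists y z : nat,
    (y <= z < n)%N /\ (1 - e) * barrier A alpha n%:R <= potential z - potential y }.

Let pot_incr (m z : nat) : (m <= z)%N -> potential z - potential m =
  wsum z - wsum m - b * \sum_(m.+1 <= i < z.+1) i%:R `^ (- alpha).
Proof.
move=> mz.
have e f : \sum_(m.+1 <= i < z.+1) f i =
    \sum_(1 <= i < z.+1) f i - \sum_(1 <= i < m.+1) f i :> R.
  by rewrite (@big_cat_nat _ _ _ m.+1 1 z.+1)//= addrAC subrr add0r.
rewrite e /potential /wsum !sumrB -!mulr_sumr; ring.
Qed.

Let powR_1B (z : nat) : (0 < z)%N ->
  z%:R `^ (1 - alpha) = z%:R * z%:R `^ (- alpha) :> R.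
Proof.
by move=> z0; rewrite powRD ?powRr1// pnatr_eq0 -lt0n z0 implybT.
Qed.

Let kap0 : 0 < 1 - alpha. Proof. by move: al1; lra. Qed.

Lemma powR_natr_mono (e : R) (m n : nat) : 0 <= e -> (m <= n)%N ->
  m%:R `^ e <= n%:R `^ e :> R.
Proof. by move=> e0 mn; apply: ge0_ler_powR; rewrite ?nnegrE// ler_nat. Qed.

(** Between (1 - e) z and z the drift takes at least b e z^(1 - alpha); the fluctuations at the two
    ends cost b e / 4 each, which leaves b e / 2. The law of large numbers is a separate hypothesis
    because [as_barrier] uses the lemma before a good environment is available. *)
Lemma potential_drop (e : R) :
  (forall e', 0 < e' -> \forall x \near \oo, `|wsum x| <= e' * x%:R `^ (1 - alpha)) ->
  0 < e -> e < 1 -> exists2 c, 0 < c &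
  \forall m \near \oo, forall z : nat, m%:R <= (1 - e) * z%:R ->
    potential z - potential m <= - (c * z%:R `^ (1 - alpha)).
Proof.
move=> lln e0 e1; pose k := b * e / 4.
have k0 : 0 < k by rewrite divr_gt0// mulr_gt0.
exists (b * e / 2); first by rewrite divr_gt0// mulr_gt0.
have [N _ hN] := lln _ k0.
exists N.+1 => // m /= Nm z mz.
have mz' : (m <= z)%N.
  rewrite -(ler_nat R) (le_trans mz)// ler_piMl//.
  by move: e0; lra.
have z0 : (0 < z)%N by rewrite (leq_trans _ (leq_trans Nm mz')).
rewrite pot_incr//.
have hz := hN z (ltnW (leq_trans Nm mz')).
have hm := hN m (ltnW Nm).
have mono := powR_natr_mono (ltW kap0) mz'.
have hm' := le_trans hm (ler_wpM2l (ltW k0) mono).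
have low : e * z%:R `^ (1 - alpha) <= \sum_(m.+1 <= i < z.+1) i%:R `^ (- alpha).
  apply: (@le_trans _ _ (\sum_(m.+1 <= i < z.+1) z%:R `^ (- alpha))); last first.
    rewrite big_nat [leRHS]big_nat; apply: ler_sum => i /andP[mi iz].
    rewrite !powRN lef_pV2 ?posrE ?powR_gt0 ?ltr0n// ?(leq_trans _ mi)//.
    by apply: powR_natr_mono; rewrite ?(ltW al0).
  rewrite sumr_const_nat subSS -[leRHS]mulr_natl powR_1B// mulrA.
  rewrite ler_wpM2r ?powR_ge0// natrB//.
  by move: mz; lra.
have := ler_wpM2l (ltW b0) low.
move: hz hm'; rewrite !ler_norml => /andP[_ h1] /andP[h2 _].
move: h1 h2; rewrite /k; set Z := z%:R `^ _; set Sg := \sum_(_ <= i < _) _.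
clearbody Z Sg; move: (wsum z) (wsum m); move=> a c; lra.
Qed.

Hypothesis good : good_env.

(** Crude but sufficient: in [near_lower_event] it competes with a double exponential. *)
Lemma potential_lower : \forall m \near \oo, - ((b + 1) * m%:R) <= potential m.
Proof.
have [N _ hN] := good_lln good ltr01.
exists N.+1 => // m /= Nm; have m0 : (0 < m)%N by rewrite (leq_trans _ Nm).
have := hN m (ltnW Nm); rewrite mul1r ler_norml => /andP[h1 _].
have h2 : m%:R `^ (1 - alpha) <= m%:R :> R.
  by apply: ler1_powR; rewrite ?ler1n// gerBl ltW.
have h3 : \sum_(1 <= i < m.+1) i%:R `^ (- alpha) <= m%:R :> R.
  apply: (@le_trans _ _ (\sum_(1 <= i < m.+1) 1)); last by rewrite sumr_const_nat subn1.
  rewrite big_nat [leRHS]big_nat; apply: ler_sum => i /andP[i1 _].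
  rewrite powRN invf_le1 ?powR_gt0 ?ltr0n//.
  by rewrite -[leLHS](powRr0 i%:R) ler_powR ?ler1n// ltW.
have -> : potential m = wsum m - b * \sum_(1 <= i < m.+1) i%:R `^ (- alpha).
  by rewrite /potential sumrB mulr_sumr.
have := ler_wpM2l (ltW b0) h3.
move: h1 h2; move: (wsum m) (\sum_(_ <= i < _) _) => ? ?; lra.
Qed.

Definition expV (z : nat) : R := expR (potential z).

Lemma expV_gt0 z : 0 < expV z. Proof. exact: expR_gt0. Qed.

Lemma expV_tail (e : R) : 0 < e -> e < 1 -> exists C c, [/\ 0 < C, 0 < c &
  \forall m \near \oo, forall n N : nat, m%:R <= (1 - e) * n%:R ->
  \sum_(n <= z < N) expV z <= expV m * (C * expR (- (c * n%:R `^ (1 - alpha))))].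
Proof.
move=> e0 e1; have [c c0 [M _ hM]] := potential_drop (good_lln good) e0 e1.
have c20 : 0 < c / 2 by rewrite divr_gt0.
have [C hC] := sum_exp_powR_bounded c20 kap0.
(* Half of the rate stays in front as a factor, the other half makes the series over z converge. *)
exists (`|C| + 1), (c / 2); split => //.
exists M => // m /= Mm n N mn.
rewrite [leRHS]mulrA.
apply: (@le_trans _ _ (\sum_(n <= z < N) expV m * expR (- (c / 2 * n%:R `^ (1 - alpha))) * expR (- (c / 2 * z%:R `^ (1 - alpha))))).
  rewrite big_nat [leRHS]big_nat; apply: ler_sum => z /andP[nz _].
  rewrite -!expRD ler_expR.
  have := hM m Mm z; have nz' : n%:R <= z%:R :> R by rewrite ler_nat.
  have : (1 - e) * n%:R <= (1 - e) * z%:R.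
    by rewrite ler_wpM2l// subr_ge0 ltW.
  move=> /(le_trans mn) mz /(_ mz).
  have := ler_wpM2l (ltW c20) (powR_natr_mono (ltW kap0) nz).
  move: (potential z) (potential m) (n%:R `^ _) (z%:R `^ _) => ? ? ? ?; lra.
rewrite -mulr_sumr mulrAC ler_wpM2r ?expR_ge0// ler_wpM2l ?expR_ge0//.
by rewrite (le_trans (hC n N))// ler_wpDr// ler_norm.
Qed.

(** The tail sum of exp V, finite by [expV_tail] and written as limit minus partial sum. The last
    clause transfers bounds from finite sums to it. *)
Lemma escape_potential : exists h : nat -> R, [/\ forall y, 0 <= h y,
   forall y, h y = h y.+1 + expV y &
   forall y B, (forall N, (y <= N)%N -> \sum_(y <= z < N) expV z <= B) -> h y <= B].
Proof.
have e1 : 0 < 1 / 2 :> R by lra.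
have e2 : 1 / 2 < 1 :> R by lra.
have [C [c [C0 c0 [M _ hM]]]] := expV_tail e1 e2.
pose s := series expV.
have sE n : s n = \sum_(0 <= z < n) expV z by [].
have ge0 : forall z, 0 <= expV z by move=> z; exact: expR_ge0.
have nds : nondecreasing_seq s.
  apply/nondecreasing_seqP => n.
  by rewrite !sE big_nat_recr//= lerDl.
have cvs : cvgn s.
  apply: nondecreasing_is_cvgn => //.
  exists (s (2 * M)%N + expV M * (C * expR (- (c * (2 * M)%:R `^ (1 - alpha))))).
  move=> _ [n _ <-].
  have [nM|Mn] := leqP n (2 * M).
    apply: (le_trans (nds _ _ nM)); rewrite lerDl.
    by rewrite !mulr_ge0 ?expR_ge0// ltW.
  rewrite [leLHS]sE (big_cat_nat _ (ltnW Mn))//= -sE lerD2l.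
  apply: hM => //=; rewrite natrM; move: (M%:R : R); move=> x; lra.
exists (fun y => limn s - s y); split => [y|y|y B hB].
- by rewrite subr_ge0; exact: nondecreasing_cvgn_le.
- by rewrite !sE big_nat_recr//= opprD -addrA subrK.
- rewrite lerBlDr; apply: limr_le => //; near=> N.
  have yN : (y <= N)%N by near: N; exact: nbhs_infty_ge.
  by rewrite !sE (big_cat_nat _ yN)//= addrC lerD2r hB.
Unshelve. all: by end_near.
Qed.

End Environment.

Section QuenchedEvents.
Context {R : realType}.
Variables (b alpha A : R) (w : nat -> R).
Hypotheses (b0 : 0 < b) (al0 : 0 < alpha) (al1 : alpha < 1 / 2) (A0 : 0 < A).
Hypothesis good : good_env b alpha A w.

Let q := rwre_q b alpha w.
Let U := expV b alpha w.
Let H := barrier A alpha.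

Lemma rwre_q0 : q 0%N = 0. Proof. by []. Qed.

Let U0 z : 0 < U z. Proof. exact: expV_gt0. Qed.

Lemma rwre_q01 y : 0 <= q y < 1.
Proof.
rewrite /q /rwre_q; case: ifP => _; first by rewrite lexx ltr01.
set u := _ - _; have u0 := expR_gt0 u.
rewrite divr_ge0 ?addr_ge0 ?(ltW u0)//=.
by rewrite ltr_pdivrMr ?mul1r ?ltrDr// addr_gt0.
Qed.

Lemma rwre_qS_gt0 y : 0 < q y.+1.
Proof. by rewrite /q /rwre_q/= divr_gt0 ?expR_gt0// addr_gt0 ?expR_gt0. Qed.

Lemma rwre_q_expV y : q y.+1 * U y = (1 - q y.+1) * U y.+1.
Proof.
have -> : U y.+1 = U y * expR (w y.+1 - b * y.+1%:R `^ (- alpha)).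
  by rewrite -expRD /U /expV /potential [in LHS]big_nat_recr.
rewrite /q /rwre_q/=; set u := _ - _; have u0 := expR_gt0 u.
by field; rewrite gt_eqF// addr_gt0.
Qed.

Lemma rwre_q_lt1 y : 0 < 1 - q y.
Proof. by rewrite subr_gt0; case/andP: (rwre_q01 y). Qed.

Variable h : nat -> R.
Hypotheses (h_ge0 : forall y, 0 <= h y) (hS : forall y, h y = h y.+1 + U y).
Hypothesis hB : forall y B,
  (forall N, (y <= N)%N -> \sum_(y <= z < N) U z <= B) -> h y <= B.

Let hU y : U y <= h y. Proof. by rewrite hS lerDr. Qed.
Let h_gt0 y : 0 < h y. Proof. exact: lt_le_trans (U0 y) (hU y). Qed.

(** The ratio is the sum of exp (V z - V y) over z >= y. The y terms below 2 y are bounded by the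
    barrier, and beyond 2 y the fall of V leaves a constant. *)
Lemma near_escape_ratio (dl : R) : 0 < dl -> exists C, 0 < C /\
  \forall y \near \oo, h y / U y <= y%:R * expR ((1 + dl) * H y%:R) + C.
Proof.
move=> dl0; have e1 : 0 < 1 / 2 :> R by lra.
have e2 : 1 / 2 < 1 :> R by lra.
have [C [c [C0 c0 [M _ hM]]]] := expV_tail b0 al0 al1 good e1 e2.
have [N _ hN] := good_barrier good dl0.
exists C; split => //; exists (maxn M N) => // y /=; rewrite geq_max => /andP[My Ny].
rewrite ler_pdivrMr// mulrC; apply: hB => n yn.
have tail k : (2 * y <= k)%N -> \sum_(k <= z < n) U z <= U y * C.
  move=> yk; apply: (@le_trans _ _ (U y * (C * expR (- (c * k%:R `^ (1 - alpha)))))).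
    apply: (hM y My); rewrite -[leLHS]mul1r.
    have : (2 * y)%:R <= k%:R :> R by rewrite ler_nat.
    rewrite natrM; lra.
  rewrite ler_wpM2l ?(ltW (U0 y))// ler_piMr ?(ltW C0)//.
  by rewrite expR_le1 oppr_le0 mulr_ge0 ?powR_ge0// ltW.
have body k : (k <= 2 * y)%N ->
    \sum_(y <= z < k) U z <= U y * (y%:R * expR ((1 + dl) * H y%:R)).
  move=> ky; apply: (@le_trans _ _ (\sum_(y <= z < k) U y * expR ((1 + dl) * H y%:R))).
    rewrite big_nat [leRHS]big_nat; apply: ler_sum => z /andP[yz _].
    rewrite -expRD ler_expR -lerBlDl; exact: hN.
  rewrite sumr_const_nat -[leLHS]mulr_natl mulrCA ler_wpM2l ?(ltW (U0 y))//.
  by rewrite ler_wpM2r ?expR_ge0// ler_nat leq_subLR addnn -mul2n.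
rewrite mulrDr; have [nk|kn] := leqP n (2 * y)%N.
  by rewrite -[leLHS]addr0; apply: lerD; [exact: body|rewrite mulr_ge0// ltW].
have y2 : (y <= 2 * y)%N by rewrite leq_pmull.
by rewrite (big_cat_nat y2 (ltnW kn))//=; apply: lerD; [exact: body|exact: tail].
Qed.

(** There are n terms, each at most a linear factor times exp ((1 + dl / 2) H(n)); the other half of
    dl absorbs the powers of n. *)
Lemma near_green_total (dl : R) : 0 < dl ->
  \forall n \near \oo, green_total q U h n <= expR ((1 + dl) * H n%:R).
Proof.
move=> dl0; have dl20 : 0 < dl / 2 by rewrite divr_gt0.
have [C [C0 [M0 _ hM0]]] := near_escape_ratio dl20.
pose M := M0.+1.
pose C' := \sum_(0 <= y < M) h y / U y.
have W0 y : 0 <= h y / U y by rewrite divr_ge0// ltW.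
have C'0 : 0 <= C' by exact: sumr_ge0.
have K0 := near_natr (near_exp_barrier_ge A0 al0 2 (2 * (1 + C + C')) dl20).
near=> n.
have Mn : (M <= n)%N by near: n; exact: nbhs_infty_ge.
have n1 : 1 <= n%:R :> R by rewrite ler1n (leq_trans _ Mn).
pose E := expR ((1 + dl / 2) * H n%:R).
have E1 : 1 <= E.
  rewrite -[leLHS]expR0 ler_expR mulr_ge0 ?addr_ge0 ?(ltW dl20)//.
  exact: barrier_ge0.
pose B := n%:R * E + C + C'.
have WB y : (y <= n)%N -> h y / U y <= B.
  move=> yn; have [My|yM] := leqP M y.
    apply: (le_trans (hM0 y (ltnW My))); rewrite ler_wpDr// lerD2r.
    have y1 : 1 <= y%:R :> R by rewrite ler1n (leq_trans _ My).
    rewrite ler_pM ?expR_ge0 ?ler_nat// ler_expR ler_wpM2l ?addr_ge0 ?(ltW dl20)//.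
    by apply: barrier_mono => //; rewrite ler_nat.
  apply: (@le_trans _ _ C').
    rewrite /C' big_mkord (bigD1 (Ordinal yM))//= lerDl.
    exact: sumr_ge0.
  by rewrite lerDr addr_ge0 ?(ltW C0)// mulr_ge0// expR_ge0.
apply: (@le_trans _ _ (\sum_(0 <= y < n) (B + B))).
  rewrite /green_total big_nat [leRHS]big_nat; apply: ler_sum => -[|y] /andP[_ yn].
    rewrite rwre_q0 subr0 mulr1 (le_trans (WB _ (ltnW yn)))// lerDl.
    by rewrite (le_trans (W0 0%N))// WB// ltnW.
  (* No lower bound on 1 - q is at hand. Writing 1 = (1 - q) + q in the numerator and using [qU]
     removes it. *)
  have -> : h y.+1 / (U y.+1 * (1 - q y.+1)) = h y.+1 / U y.+1 + h y.+1 / U y.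
    have e : U y.+1 * (1 - q y.+1) = q y.+1 * U y by rewrite mulrC rwre_q_expV.
    have qn := rwre_qS_gt0 y; have := rwre_q_lt1 y.+1.
    have u0 := U0 y; have u1 := U0 y.+1.
    have -> : U y.+1 = q y.+1 * U y / (1 - q y.+1).
      by rewrite -e mulfK// gt_eqF// rwre_q_lt1.
    by move=> p0; field; rewrite !gt_eqF.
  apply: lerD; first by apply: WB; exact: ltnW.
  apply: (le_trans _ (WB y _)); last by rewrite ltnW// ltnW.
  by rewrite ler_wpM2r ?invr_ge0 ?(ltW (U0 y))// [leRHS]hS lerDl ltW.
rewrite sumr_const_nat subn0 -[leLHS]mulr_natl.
apply: (@le_trans _ _ (E * (2 * (1 + C + C') * n%:R ^+ 2))); last first.
  have -> : (1 + dl) * H n%:R = (1 + dl / 2) * H n%:R + dl / 2 * H n%:R by field.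
  rewrite expRD ler_wpM2l ?expR_ge0//.
  by near: n.
have BE : B <= (1 + C + C') * (n%:R * E).
  have nE : 1 <= n%:R * E by rewrite mulr_ege1.
  rewrite /B !mulrDl mul1r; apply: lerD; last by rewrite ler_peMr.
  by apply: lerD => //; rewrite ler_peMr// ltW.
apply: (@le_trans _ _ (n%:R * ((1 + C + C') * (n%:R * E) + (1 + C + C') * (n%:R * E)))).
  by rewrite ler_wpM2l// lerD.
by rewrite le_eqVlt; apply/orP; left; apply/eqP; ring.
Unshelve. all: by end_near.
Qed.

End QuenchedEvents.

(** * Probability bounds for crossing and return *)

Section QuenchedWalk.
Context {R : realType}.
Variables (b alpha A : R) (w : nat -> R).
Hypotheses (b0 : 0 < b) (al0 : 0 < alpha) (al1 : alpha < 1 / 2) (A0 : 0 < A).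
Hypothesis good : good_env b alpha A w.

Let q := rwre_q b alpha w.
Let U := expV b alpha w.
Let H := barrier A alpha.

Variables (p : R -> nat -> nat -> R).
Hypotheses (ptf : transition_function p) (nn : nearest_neighbour_rates q p).
Context (d : measure_display) (T : measurableType d) (Q : probability T R).
Variables (X : R -> T -> nat) (mk : markov_from0 p Q X) (cad : cadlag_process X).

(** A valley of depth (1 - dl / 2) H(n) against a time exp ((1 - dl) H(n)): the quotient exp (- dl
    H(n) / 2) beats every power of n. *)
Lemma near_upper_event (dl : R) : 0 < dl -> dl < 1 ->
  \forall n \near \oo, exists D : set T, [/\ measurable D,
    (Q D <= (n%:R ^- 2)%:E)%E &
    forall x, (exists s, [/\ 1 <= s, s <= expR ((1 - dl) * H n%:R)
      & (n <= X s x)%N]) -> D x].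
Proof.
move=> dl0 dl1; have dl20 : 0 < dl / 2 by rewrite divr_gt0.
have K0 := near_natr (near_exp_barrier_ge A0 al0 2 3 dl20).
have V0 := good_valley good dl20.
near=> n.
have n1 : 1 <= n%:R :> R by rewrite ler1n; near: n; exact: nbhs_infty_ge.
have [y [z [yzn Vyz]]] : exists y z : nat,
    (y <= z < n)%N /\ (1 - dl / 2) * H n%:R <= potential b alpha w z - potential b alpha w y.
  by near: n.
pose t := expR ((1 - dl) * H n%:R).
have t1 : 1 <= t.
  rewrite -[leLHS]expR0 ler_expR mulr_ge0 ?subr_ge0 ?(ltW dl1)//.
  exact: barrier_ge0.
pose N := (Num.truncn t).+1.
have [D [mD QD hD]] := valley_crossing (rwre_q0 b alpha w) (rwre_q01 b alpha w)
  (expV_gt0 b alpha w) (rwre_q_expV b alpha w) ptf nn mk cad N yzn.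
exists D; split => //; last first.
  move=> x [s [s1 st nX]]; apply: (hD x s) => //.
  apply: (le_lt_trans st); apply: (lt_trans (truncnS_gt _)).
  by rewrite -/N ltrDr.
apply: (le_trans QD); rewrite lee_fin.
have Nt : N%:R + 1 <= 3 * t.
  rewrite /N -natr1; have /truncn_itv/andP[+ _] := expR_ge0 ((1 - dl) * H n%:R).
  by rewrite -/t => h; lra.
apply: (@le_trans _ _ (3 * t * expR (- ((1 - dl / 2) * H n%:R)))).
  rewrite ler_pM//; first by rewrite divr_ge0// ltW// expV_gt0.
  by rewrite /expV -expRB ler_expR lerNr opprB.
rewrite -mulrA -expRD.
have -> : (1 - dl) * H n%:R - (1 - dl / 2) * H n%:R = - (dl / 2 * H n%:R) by field.
rewrite expRN ler_pdivrMr ?expR_gt0// mulrC -ler_pdivrMr ?invr_gt0 ?exprn_gt0//; last first.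
  by rewrite (lt_le_trans ltr01).
rewrite invrK.
by near: n.
Unshelve. all: by end_near.
Qed.

(** Apply [no_return] with S at most exp ((1 + dl / 2) H(n)); each of its two errors gets half of
    n^-2. In the first, t / (2 S) is exponentially large in H(n), far beyond the linear exponent
    lost in bounding h m from below. In the second, h n / h m is at most a constant times exp (- c
    n^(1 - alpha)), which beats t because H(n) is of order n^alpha ln n and alpha < 1 - alpha. *)
Lemma near_lower_event (e dl : R) : 0 < e -> e < 1 -> 0 < dl ->
  \forall n \near \oo, exists D : set T, [/\ measurable D,
    (Q D <= (n%:R ^- 2)%:E)%E &
    forall x, (exists s, expR ((1 + dl) * H n%:R) <= s /\
      (X s x <= Num.truncn ((1 - e) * n%:R))%N) -> D x].
Proof.
move=> e0 e1 dl0; have dl20 : 0 < dl / 2 by rewrite divr_gt0.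
have kap0 : 0 < 1 - alpha by move: al1; lra.
have kap : alpha < 1 - alpha by move: al1; lra.
have [h [h_ge0 hS hB]] := escape_potential b0 al0 al1 good.
have hU y : U y <= h y by rewrite hS lerDr.
have S0 := near_green_total b0 al0 al1 A0 good h_ge0 hS hB dl20.
have [C [c [C0 c0 T0]]] := expV_tail b0 al0 al1 good e0 e1.
have [M1 _ hM1] := T0.
have [M2 _ hM2] := potential_lower b0 al0 good.
have c20 : 0 < c / 2 by rewrite divr_gt0.
have K1 := near_natr (near_exp_barrier_ge A0 al0 1 (2 * (b + 2)) dl20).
have K2 := near_natr (near_exp_powR_ge 2 (4 * h 0%N) ltr01 ltr01).
have K3 := near_natr (near_exp_powR_ge 2 (2 * C) c20 kap0).
have K4 := near_natr (near_barrier_le A (1 + dl) c20 kap).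
have L := near_natr (nbhs_pinfty_ge (num_real ((maxn M1 M2).+1%:R / (1 - e)))).
near=> n.
have n1 : 1 <= n%:R :> R by rewrite ler1n; near: n; exact: nbhs_infty_ge.
have n0 : (0 < n)%N by rewrite -(ler1n R).
have ngt0 : 0 < n%:R :> R by rewrite ltr0n.
pose t := expR ((1 + dl) * H n%:R).
have t0 : 0 < t by exact: expR_gt0.
pose m := Num.truncn ((1 - e) * n%:R).
have mlt : m%:R <= (1 - e) * n%:R.
  have /truncn_itv/andP[] // : 0 <= (1 - e) * n%:R.
  by rewrite mulr_ge0// subr_ge0 ltW.
have Mm : (maxn M1 M2 < m)%N.
  rewrite truncn_ge_nat; last by rewrite mulr_ge0// subr_ge0 ltW.
  rewrite mulrC -ler_pdivrMr ?subr_gt0//.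
  by near: n.
have M1m : (M1 <= m)%N by rewrite ltnW// (leq_ltn_trans (leq_maxl _ M2)).
have M2m : (M2 <= m)%N by rewrite ltnW// (leq_ltn_trans (leq_maxr M1 _)).
have [D [mD QD hD]] := no_return (rwre_q0 b alpha w) (rwre_q01 b alpha w)
  (expV_gt0 b alpha w) (rwre_q_expV b alpha w) ptf nn mk cad h_ge0 hS m n0 t0.
exists D; split => //; last by move=> x [s [ts Xm]]; exact: (hD x s).
apply: (le_trans QD); rewrite lee_fin.
have SE : green_total q U h n <= expR ((1 + dl / 2) * H n%:R) by near: n.
set S := green_total _ _ _ _ in SE *.
have U00 : U 0%N = 1 by rewrite /U /expV /potential big_geq// expR0.
have S1 : 1 <= S.
  rewrite /S /green_total -[n](prednK n0) big_nat_recl//.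
  rewrite [q 0%N]rwre_q0 subr0 mulr1 U00 divr1 ler_wpDr//.
    apply: sumr_ge0 => i _; rewrite divr_ge0// mulr_ge0 ?(ltW (expV_gt0 _ _ _ _))//.
    exact: (ltW (rwre_q_lt1 _ _ _ _)).
  by rewrite -U00 hU.
have Sgt0 : 0 < S := lt_le_trans ltr01 S1.

have Um : expR (- ((b + 1) * m%:R)) <= U m by rewrite ler_expR; exact: hM2.
have hm0 : 0 < h m := lt_le_trans (expR_gt0 _) (le_trans Um (hU m)).
have half : n%:R ^- 2 = (2 * n%:R ^+ 2)^-1 + (2 * n%:R ^+ 2)^-1 :> R.
  by rewrite (invfM 2) -mulrDl -[2^-1]mul1r -splitr mul1r.
rewrite mulrDl half; apply: lerD.
  have B1 : (b + 2) * n%:R <= t / (2 * S).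
    rewrite ler_pdivlMr ?mulr_gt0//.
    have : 2 * (b + 2) * n%:R ^+ 1 <= expR (dl / 2 * H n%:R) by near: n.
    rewrite expr1 => h1.
    have -> : t = expR (dl / 2 * H n%:R) * expR ((1 + dl / 2) * H n%:R).
      by rewrite -expRD /t; congr expR; field.
    apply: le_trans (ler_pM _ _ h1 SE); last exact: ltW.
      by rewrite le_eqVlt; apply/orP; left; apply/eqP; ring.
    by rewrite !mulr_ge0// addr_ge0// ltW.
  rewrite ler_pdivrMr//.
  apply: (@le_trans _ _ ((2 * n%:R ^+ 2)^-1 * expR (- ((b + 1) * m%:R)))); last first.
    rewrite ler_wpM2l ?invr_ge0 ?mulr_ge0 ?exprn_ge0//.
    exact: le_trans Um (hU m).
  rewrite ler_pdivlMl ?mulr_gt0 ?exprn_gt0//.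
  have mn : m%:R <= n%:R :> R.
    by rewrite (le_trans mlt)// ler_piMl// gerBl ltW.
  apply: (@le_trans _ _ (expR (1 * n%:R `^ 1) * expR (- ((b + 2) * n%:R)))); last first.
    rewrite -expRD ler_expR powRr1// mul1r.
    have := ler_wpM2l (ltW (addr_gt0 b0 ltr01)) mn.
    by move: (m%:R : R) => ?; lra.
  have -> : 2 * n%:R ^+ 2 * (2 * expR (- (t / (2 * S))) * h 0%N) =
    (4 * h 0%N * n%:R ^+ 2) * expR (- (t / (2 * S))) by ring.
  apply: ler_pM; rewrite ?expR_ge0 ?mulr_ge0 ?exprn_ge0//; last by rewrite ler_expR lerN2.
  by near: n.
have B2 : h n <= U m * (C * expR (- (c * n%:R `^ (1 - alpha)))).
  by apply: hB => N _; exact: hM1.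
apply: (@le_trans _ _ (h n * t / h m)).
  rewrite ler_wpM2r ?invr_ge0 ?(ltW hm0)// ler_pdivrMr//.
  by rewrite ler_peMr// mulr_ge0// ltW.
rewrite ler_pdivrMr//.
apply: (@le_trans _ _ (U m * (C * expR (- (c * n%:R `^ (1 - alpha)))) * t)).
  by rewrite ler_wpM2r// ltW.
apply: (@le_trans _ _ ((2 * n%:R ^+ 2)^-1 * U m)); last first.
  by rewrite ler_wpM2l// invr_ge0 mulr_ge0// exprn_ge0.
rewrite [leRHS]mulrC -mulrA ler_wpM2l ?(ltW (expV_gt0 _ _ _ _))//.
have tb : t <= expR (c / 2 * n%:R `^ (1 - alpha)).
  by rewrite ler_expR; near: n.
rewrite -mulrA.
apply: (@le_trans _ _ (C * expR (- (c / 2 * n%:R `^ (1 - alpha))))).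
  rewrite ler_wpM2l ?(ltW C0)//.
  have -> : expR (- (c / 2 * n%:R `^ (1 - alpha))) = expR (- (c * n%:R `^ (1 - alpha))) * expR (c / 2 * n%:R `^ (1 - alpha)).
    by rewrite -expRD; congr expR; field.
  by rewrite ler_wpM2l// expR_ge0.
rewrite expRN ler_pdivrMr ?expR_gt0// mulrC -ler_pdivrMr; last first.
  by rewrite invr_gt0 mulr_gt0// exprn_gt0.
rewrite invrK.
have -> : C * (2 * n%:R ^+ 2) = 2 * C * n%:R ^+ 2 by ring.
by near: n.
Unshelve. all: by end_near.
Qed.

End QuenchedWalk.

(** * Inversion of the barrier height *)

Section Inversion.
Context {R : realType}.
Variables (alpha A : R).
Hypotheses (al0 : 0 < alpha) (A0 : 0 < A).
Let H := barrier A alpha.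

Definition inv_scale (t : R) : R :=
  (alpha / A * (ln (ln t))^-1 * ln t) `^ (1 / alpha).

Lemma near_ln (P : R -> Prop) :
  (\forall x \near +oo, P x) -> \forall t \near +oo, P (ln t).
Proof.
move=> [M [Mr hM]]; near=> t; apply: hM.
have : M + 1 <= ln t by near: t; exact: near_ln_ge.
by move=> h; lra.
Unshelve. all: by end_near.
Qed.

Lemma near_inv_scale_powR : \forall t \near +oo,
  0 < inv_scale t /\ inv_scale t `^ alpha = alpha / A * (ln (ln t))^-1 * ln t.
Proof.
near=> t.
have t1 : 1 <= ln t by near: t; exact: near_ln_ge.
have l1 : 1 <= ln (ln t) by near: t; exact: (near_ln (near_ln_ge 1)).
have p0 : 0 < alpha / A * (ln (ln t))^-1 * ln t.
  by rewrite mulr_gt0 ?(lt_le_trans ltr01 t1)// mulr_gt0 ?divr_gt0// invr_gt0 (lt_le_trans ltr01 l1).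
split; first exact: powR_gt0.
by rewrite /inv_scale -powRrM mul1r mulVf ?gt_eqF// powRr1// ltW.
Unshelve. all: by end_near.
Qed.

Lemma near_inv_scale_ge (M : R) : \forall t \near +oo, M <= inv_scale t.
Proof.
pose M' := Num.max M 1.
have M'0 : 0 < M' by rewrite lt_max ltr01 orbT.
pose c := alpha / A / M' `^ alpha.
have c0 : 0 < c by rewrite !divr_gt0// powR_gt0.
near=> t.
have [p0 pE] : 0 < inv_scale t /\ inv_scale t `^ alpha = alpha / A * (ln (ln t))^-1 * ln t.
  by near: t; exact: near_inv_scale_powR.
have t1 : 1 <= ln t by near: t; exact: near_ln_ge.
have l1 : 1 <= ln (ln t) by near: t; exact: (near_ln (near_ln_ge 1)).
have l0 : 0 < ln (ln t) := lt_le_trans ltr01 l1.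
have lc : ln (ln t) <= c * (ln t) `^ 1.
  near: t; exact: (near_ln (near_ln_le_powR ltr01 c0)).
apply: (@le_trans _ _ M'); first by rewrite le_max lexx.
rewrite leNgt; apply/negP => lt.
have : inv_scale t `^ alpha < M' `^ alpha.
  by apply: gt0_ltr_powR; rewrite ?nnegrE ?(ltW p0) ?(ltW M'0).
rewrite pE; apply/negP; rewrite -leNgt.
rewrite mulrAC ler_pdivlMr//.
rewrite powRr1 in lc; last exact: le_trans ler01 t1.
rewrite -ler_pdivlMl ?powR_gt0// (le_trans lc)// /c.
by rewrite le_eqVlt; apply/orP; left; apply/eqP; ring.
Unshelve. all: by end_near.
Qed.

(** Taking logarithms in the definition of the scale, alpha ln (k a(t)) = ln ln t - ln ln ln t + c
    with a constant c. Hence it is asymptotic to ln ln t, which cancels the factor (ln ln t)^-1 in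
    a(t)^alpha. *)
Lemma near_barrier_inv_scale (k e : R) : 0 < k -> 0 < e ->
  \forall t \near +oo,
    k `^ alpha * (1 - e) * ln t <= H (k * inv_scale t) <= k `^ alpha * (1 + e) * ln t.
Proof.
move=> k0 e0; pose c := alpha * ln k + ln (alpha / A).
have e20 : 0 < e / 2 by rewrite divr_gt0.
near=> t.
have [p0 pE] : 0 < inv_scale t /\ inv_scale t `^ alpha = alpha / A * (ln (ln t))^-1 * ln t.
  by near: t; exact: near_inv_scale_powR.
have t1 : 1 <= ln t by near: t; exact: near_ln_ge.
have l1 : 1 <= ln (ln t) by near: t; exact: (near_ln (near_ln_ge 1)).
have ll1 : 1 <= ln (ln (ln t)).
  by near: t; exact: (near_ln (near_ln (near_ln_ge 1))).
have lc : ln (ln (ln t)) <= e / 2 * (ln (ln t)) `^ 1.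
  by near: t; exact: (near_ln (near_ln (near_ln_le_powR ltr01 e20))).
have lb : `|c| / (e / 2) <= ln (ln t).
  by near: t; exact: (near_ln (near_ln_ge (`|c| / (e / 2)))).
have t0 : 0 < ln t := lt_le_trans ltr01 t1.
have l0 : 0 < ln (ln t) := lt_le_trans ltr01 l1.
rewrite powRr1 ?(ltW l0)// in lc.
rewrite ler_pdivrMr// in lb.
have aA : 0 < alpha / A by rewrite divr_gt0.
have lnE : alpha * ln (k * inv_scale t) = c + ln (ln t) - ln (ln (ln t)).
  rewrite lnM ?posrE// mulrDr -[X in _ + X]ln_powR pE.
  rewrite /c; move: (alpha / A) aA => r r0.
  rewrite lnM ?posrE ?mulr_gt0 ?invr_gt0// lnM ?posrE ?invr_gt0//.
  by rewrite lnV ?posrE//; ring.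
have -> : H (k * inv_scale t) =
    k `^ alpha * (((c + ln (ln t) - ln (ln (ln t))) / ln (ln t)) * ln t).
  rewrite -lnE /H /barrier powRM ?(ltW k0) ?(ltW p0)// pE.
  by field; rewrite !gt_eqF.
rewrite -[_ * (1 - e) * _]mulrA -[_ * (1 + e) * _]mulrA !ler_pM2l ?powR_gt0//.
rewrite !ler_pM2r//.
rewrite ler_pdivlMr// ler_pdivrMr//.
have := ler_norm c; have := lerNnormlW (lexx `|c|).
move: (ln (ln (ln t))) (ln (ln t)) lc lb ll1 l1 => y x lc lb ll1 l1 h1 h2.
by apply/andP; split; lra.
Unshelve. all: by end_near.
Qed.

(** Passage from times tied to integer levels to all times: t is compared with the integer levels
    [n1] just above (1 + eta / 2) a(t) and [n2] just below (1 - eta / 2) a(t). The precision runs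
    through 1 / (k + 2), so that countably many almost sure events suffice. *)
Lemma sandwich_cvg (X : R -> nat) :
  (forall k : nat, \forall n \near \oo, forall s, 1 <= s ->
     s <= expR ((1 - k.+2%:R^-1) * H n%:R) -> (X s < n)%N) ->
  (forall k : nat, \forall n \near \oo, forall s,
     expR ((1 + k.+2%:R^-1) * H n%:R) <= s ->
     (Num.truncn ((1 - k.+2%:R^-1) * n%:R : R) < X s)%N) ->
  (X t)%:R / inv_scale t @[t --> +oo] --> (1 : R).
Proof.
move=> up lo; apply/cvgrPdist_le => eta0 eta00.
pose eta := Num.min eta0 1.
have eta01 : 0 < eta by rewrite lt_min eta00 ltr01.
have eta1 : eta <= 1 by rewrite ge_min lexx orbT.
have etae : eta <= eta0 by rewrite ge_min lexx.
pose k1 : R := 1 + eta / 2; pose k2 : R := 1 - eta / 2.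
have p1 : 1 `^ alpha = 1 :> R by rewrite powR1.
have k11 : 1 < k1 by rewrite /k1; lra.
have k20 : 0 < k2 by rewrite /k2; lra.
have k21 : k2 < 1 by rewrite /k2; lra.
pose g1 := k1 `^ alpha; pose g2 := k2 `^ alpha.
have g11 : 1 < g1.
  by rewrite -[ltLHS]p1 gt0_ltr_powR// nnegrE ltW// (lt_trans ltr01).
have g20 : 0 < g2 by rewrite powR_gt0.
have g21 : g2 < 1.
  by rewrite -[ltRHS]p1 gt0_ltr_powR// nnegrE ltW.
(* The last two terms give (1 - e)^2 g1 >= 1 and (1 + e)^2 g2 <= 1 ([c1], [c2]): one factor comes
   from the hypotheses [up] and [lo], the other from [near_barrier_inv_scale]. The bound eta / 4
   pays for the factor 1 - e in front of n2. *)
pose m := Num.min (eta / 4) (Num.min ((g1 - 1) / (2 * g1)) ((1 - g2) / (3 * g2))).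
have m0 : 0 < m.
  rewrite !lt_min divr_gt0//= !divr_gt0 ?subr_gt0 ?mulr_gt0//.
  exact: lt_trans ltr01 g11.
pose k := Num.truncn m^-1; pose e : R := k.+2%:R^-1.
have e0 : 0 < e by rewrite invr_gt0.
have em : e <= m.
  rewrite invf_ple ?posrE// ltW// (lt_le_trans (truncnS_gt _))//.
  by rewrite ler_nat.
move: em; rewrite !le_min => /andP[e4 /andP[eg1 eg2]].
have g10 : 0 < g1 := lt_trans ltr01 g11.
rewrite ler_pdivlMr ?mulr_gt0// in eg1.
rewrite ler_pdivlMr ?mulr_gt0// in eg2.
have c1 : 1 <= (1 - e) * (g1 * (1 - e)) by nra.
have c2 : (1 + e) * (g2 * (1 + e)) <= 1 by nra.
have e1 : e < 1 by lra.
have [N1 _ hN1] := up k.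
have [N2 _ hN2] := lo k.
near=> t.
have t1 : 1 <= t by [].
have lnt : 0 <= ln t by rewrite ln_ge0.
have tE : t = expR (ln t) by rewrite lnK// posrE (lt_le_trans ltr01).
have a4 : 4 / eta <= inv_scale t by near: t; exact: near_inv_scale_ge.
have aN1 : N1%:R <= inv_scale t by near: t; exact: near_inv_scale_ge.
have aN2 : N2.+2%:R / k2 <= inv_scale t by near: t; exact: near_inv_scale_ge.
have a1 : 1 <= inv_scale t by near: t; exact: near_inv_scale_ge.
have /andP[B1 _] : k1 `^ alpha * (1 - e) * ln t <= H (k1 * inv_scale t) <= k1 `^ alpha * (1 + e) * ln t.
  by near: t; exact: (near_barrier_inv_scale (lt_trans ltr01 k11) e0).
have /andP[_ B2] : k2 `^ alpha * (1 - e) * ln t <= H (k2 * inv_scale t) <= k2 `^ alpha * (1 + e) * ln t.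
  by near: t; exact: (near_barrier_inv_scale k20 e0).
set a := inv_scale t in a4 aN1 aN2 a1 B1 B2 *.
have a0 : 0 < a := lt_le_trans ltr01 a1.
have ka : a <= k1 * a by rewrite ler_peMl ?(ltW a0) ?(ltW k11).
pose n1 := (Num.truncn (k1 * a)).+1.
have n1gt : k1 * a < n1%:R := truncnS_gt _.
have X1 : (X t)%:R <= k1 * a.
  have : (X t < n1)%N.
    apply: (hN1 n1) => //=.
      by rewrite -(ler_nat R) (le_trans aN1)// (le_trans ka)// ltW.
    rewrite {1}tE ler_expR -/e.
    apply: (@le_trans _ _ ((1 - e) * H (k1 * a))).
      apply: (@le_trans _ _ ((1 - e) * (g1 * (1 - e) * ln t))).
        by rewrite mulrA -[leLHS]mul1r ler_wpM2r.
      by rewrite ler_wpM2l// subr_ge0 ltW.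
    rewrite ler_wpM2l ?subr_ge0 ?(ltW e1)//.
    by apply: barrier_mono; rewrite ?(ltW n1gt)// (le_trans a1).
  rewrite ltnS -(ler_nat R) => /le_trans; apply.
  have /truncn_itv/andP[] // : 0 <= k1 * a.
  by rewrite (le_trans _ ka)// ltW.
pose n2 := Num.truncn (k2 * a).
have k2a0 : 0 <= k2 * a by rewrite mulr_ge0// ltW.
have /truncn_itv/andP[n2le n2gt] := k2a0.
have n2N : (N2 < n2)%N.
  rewrite truncn_ge_nat// mulrC -ler_pdivrMr//; apply: le_trans aN2.
  by rewrite ler_wpM2r ?invr_ge0 ?(ltW k20)// ler_nat.
have X2 : (1 - e) * n2%:R <= (X t)%:R.
  have : (Num.truncn ((1 - e) * n2%:R) < X t)%N.
    apply: (hN2 n2 (ltnW n2N) t).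
    rewrite [leRHS]tE ler_expR -/e.
    apply: (@le_trans _ _ ((1 + e) * H (k2 * a))).
      rewrite ler_wpM2l ?addr_ge0 ?(ltW e0)//.
      apply: barrier_mono => //.
      by rewrite ler1n (leq_ltn_trans _ n2N).
    apply: (@le_trans _ _ ((1 + e) * (g2 * (1 + e) * ln t))).
      by rewrite ler_wpM2l ?addr_ge0 ?(ltW e0).
    by rewrite mulrA -[leRHS]mul1r ler_wpM2r.
  rewrite -(ler_nat R); apply: le_trans; apply: ltW; exact: truncnS_gt.
apply: le_trans etae; rewrite distrC ler_norml.
rewrite lerBrDr lerBlDr ler_pdivlMr// ler_pdivrMr//; apply/andP; split; last first.
  apply: (le_trans X1); rewrite ler_wpM2r ?(ltW a0)//.
  by rewrite /k1; lra.
apply: le_trans X2.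
rewrite ler_pdivrMr// in a4.
have n2gt' : k2 * a - 1 <= n2%:R.
  by rewrite lerBlDr natr1 ltW.
have e1' : 0 <= 1 - e by rewrite subr_ge0 ltW.
apply: le_trans (ler_wpM2l e1' n2gt').
have h1 : (1 - eta / 4) * (k2 * a) <= (1 - e) * (k2 * a).
  by rewrite ler_wpM2r// lerD2l lerN2.
have h2 : 0 <= eta * eta * a by rewrite !mulr_ge0// ltW.
by move: h1; rewrite /k2; move: h2 a4 (ltW e0); lra.
Unshelve. all: by end_near.
Qed.

End Inversion.

Lemma quenched_limit {R : realType} (b alpha A : R) (w : nat -> R) :
  0 < b -> 0 < alpha -> alpha < 1 / 2 -> 0 < A -> good_env b alpha A w ->
  forall (d : measure_display) (T : measurableType d) (Q : probability T R)
    (X : R -> T -> nat), quenched_walk b alpha w Q X ->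
  {ae Q, forall x : T, (X t x)%:R / inv_scale alpha A t @[t --> +oo] --> (1 : R)}.
Proof.
move=> b0 al0 al1 A0 good d T Q X [cad [p [ptf nn mk]]].
have k0 k : 0 < k.+2%:R^-1 :> R by rewrite invr_gt0.
have k1 k : k.+2%:R^-1 < 1 :> R by rewrite invf_lt1// ltr1n.
have up := ae_foralln (fun k => ae_eventually_not
  (near_upper_event al0 A0 good ptf nn mk cad (k0 k) (k1 k))).
have lo := ae_foralln (fun k => ae_eventually_not
  (near_lower_event b0 al0 al1 A0 good ptf nn mk cad (k0 k) (k1 k) (k0 k))).
apply: filterS2 up lo => x up lo.
apply: sandwich_cvg => // k.
  apply: filterS (up k) => n nbad s s1 st; rewrite ltnNge; apply/negP => nX.
  by apply: nbad; exists s.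
apply: filterS (lo k) => n nbad s st; rewrite ltnNge; apply/negP => nX.
by apply: nbad; exists s.
Qed.

(** * Independence and exponential moments *)

Section Independence.
Context {R : realType} {d : measure_display} {Omega : measurableType d}.
Variable P : probability Omega R.

Definition indep_rv (X Y : Omega -> R) := forall A B : set R,
  measurable A -> measurable B ->
  P (X @^-1` A `&` Y @^-1` B) = (P (X @^-1` A) * P (Y @^-1` B))%E.

Lemma ge0_indep_integralM (X Y : Omega -> R) :
  measurable_fun setT X -> measurable_fun setT Y ->
  (forall w, 0 <= X w) -> (forall w, 0 <= Y w) -> indep_rv X Y ->
  (\int[P]_w (X w * Y w)%:E = \int[P]_w (X w)%:E * \int[P]_w (Y w)%:E)%E.
Proof.
move=> mX mY X0 Y0 XY.
pose XX : {RV P >-> R} := mfun_Sub (mem_set mX).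
pose YY : {RV P >-> R} := mfun_Sub (mem_set mY).
have mXY : measurable_fun setT (fun w => (X w, Y w)) by exact/measurable_fun_pair.
pose XY2 : {RV P >-> (R * R)%type} := mfun_Sub (mem_set mXY).
(* Absolute values make the integrand nonnegative on the whole plane, as Tonelli requires; on the
   range of (X, Y) they change nothing. *)
pose f (z : (R * R)%type) : \bar R := (`|z.1| * `|z.2|)%:E.
have mf : measurable_fun setT f.
  apply/measurable_EFinP; apply: measurable_funM.
    by apply: measurableT_comp => //; exact: measurable_fst.
  by apply: measurableT_comp => //; exact: measurable_snd.
have f0 z : (0 <= f z)%E by rewrite lee_fin mulr_ge0.
have mabs : measurable_fun [set: R] (fun x : R => `|x|%:E).
  by apply/measurable_EFinP; exact: normr_measurable.
have -> : (\int[P]_w (X w * Y w)%:E = \int[distribution P XY2]_z f z)%E.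
  rewrite ge0_integral_distribution//; apply: eq_integral => w _ /=.
  by rewrite /f/= !ger0_norm.
have -> : (\int[distribution P XY2]_z f z =
    \int[(distribution P XX \x distribution P YY)%E]_z f z)%E.
  apply: eq_measure_integral => A mA _; apply/esym.
  by apply: product_measure_unique => [B C mB mC|//]; exact: (XY B C mB mC).
have inner x : (\int[distribution P YY]_y f (x, y) =
    `|x|%:E * \int[distribution P YY]_y `|y|%:E)%E.
  rewrite -ge0_integralZl ?lee_fin//.
rewrite fubini_tonelli1// /fubini_F/=.
under eq_integral do rewrite inner.
rewrite ge0_integralZr//; last first.
  by apply: integral_ge0 => y _; rewrite lee_fin.
rewrite !ge0_integral_distribution//; try by move=> y; rewrite lee_fin.
by congr (_ * _)%E; apply: eq_integral => w _ /=; rewrite ger0_norm.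
Qed.

Variable omega : nat -> {RV P >-> R}.
Hypothesis hindep : mutually_independent P [set x | (1 <= x)%N]
                (fun x => omega x : Omega -> R).

(** Finite-dimensional cylinders, a pi-system generating the sigma-algebra of the coordinates in
    I. *)
Definition rects (I : set nat) : set (set Omega) :=
  [set C | exists (J : {fset nat}) (B : nat -> set R),
    [/\ [set` J] `<=` I, forall i, measurable (B i) &
        C = \bigcap_(i in [set` J]) (omega i @^-1` B i)]].

Lemma measurable_rv (i : nat) (B : set R) : measurable B -> measurable (omega i @^-1` B).
Proof. by move=> mB; rewrite -[X in measurable X]setTI; exact: measurable_funP. Qed.

Lemma rects_measurable I : rects I `<=` measurable.
Proof.
move=> C [J [B [_ mB ->]]]; apply: fin_bigcap_measurable => // i _.
exact: measurable_rv.
Qed.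

(** Extension by the full line outside J, so that two cylinders can be intersected over the union of
    their supports. *)
Let cut (J : {fset nat}) (B : nat -> set R) i := if i \in J then B i else setT.

Let mcut J B : (forall i, measurable (B i)) -> forall i, measurable (cut J B i).
Proof. by move=> mB i; rewrite /cut; case: ifP. Qed.

Let cutI (J1 J2 : {fset nat}) B1 B2 :
  \bigcap_(i in [set` J1]) (omega i @^-1` B1 i) `&`
  \bigcap_(i in [set` J2]) (omega i @^-1` B2 i) =
  \bigcap_(i in [set` (J1 `|` J2)%fset]) (omega i @^-1` (cut J1 B1 i `&` cut J2 B2 i)).
Proof.
apply/seteqP; split => [w [w1 w2] i /= _|w H].
  by rewrite /cut; split; case: ifP => // iJ; [exact: w1|exact: w2].
split=> i /= iJ.
  by have /= := H i; rewrite in_fsetU iJ /= /cut iJ => /(_ isT) [].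
by have /= := H i; rewrite in_fsetU iJ orbT /cut iJ => /(_ isT) [].
Qed.

Lemma rects_setI_closed I : setI_closed (rects I).
Proof.
move=> C1 C2 [J1 [B1 [J1I mB1 ->]]] [J2 [B2 [J2I mB2 ->]]].
exists (J1 `|` J2)%fset, (fun i => cut J1 B1 i `&` cut J2 B2 i); split => //.
- by move=> i /=; rewrite in_fsetU => /orP[/J1I|/J2I].
- by move=> i; apply: measurableI; exact: mcut.
Qed.

Lemma rects_indep I1 I2 A1 A2 : I1 `<=` [set x | (1 <= x)%N] ->
  I2 `<=` [set x | (1 <= x)%N] -> I1 `&` I2 = set0 ->
  rects I1 A1 -> rects I2 A2 -> P (A1 `&` A2) = (P A1 * P A2)%E.
Proof.
move=> I1p I2p I12 [J1 [B1 [J1I mB1 ->]]] [J2 [B2 [J2I mB2 ->]]].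
rewrite cutI !hindep; last 6 first.
- exact: subset_trans J2I I2p.
- by move=> i _; exact: mB2.
- exact: subset_trans J1I I1p.
- by move=> i _; exact: mB1.
- by move=> i /=; rewrite in_fsetU => /orP[/J1I/I1p|/J2I/I2p].
- by move=> i _; apply: measurableI; exact: mcut.
have J12 i : i \in J1 -> i \in J2 -> False.
  by move=> /J1I i1 /J2I i2; have : (I1 `&` I2) i by []; rewrite I12.
rewrite (big_fsetID _ (mem J1))/=; congr (_ * _)%E.
  have -> : [fset x | x in (J1 `|` J2)%fset & x \in J1]%fset = J1.
    by apply/fsetP => i; rewrite !inE; case: (i \in J1); rewrite ?andbT ?andbF.
  rewrite [LHS]big_seq_cond [RHS]big_seq_cond; apply: eq_bigr => i /andP[iJ _].
  by rewrite /cut iJ; case: ifPn => [/(J12 _ iJ)//|_]; rewrite setIT.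
have -> : [fset x | x in (J1 `|` J2)%fset & x \notin J1]%fset = J2.
  apply/fsetP => i; rewrite !inE; have [i1|i1] := boolP (i \in J1); rewrite ?andbF ?andbT//.
  by apply/esym/negbTE/negP => /(J12 _ i1).
rewrite [LHS]big_seq_cond [RHS]big_seq_cond; apply: eq_bigr => i /andP[iJ _].
by rewrite /cut iJ; case: ifPn => [/J12/(_ iJ)//|_]; rewrite setTI.
Qed.

Lemma sigma_rects_measurable I : <<s rects I >> `<=` measurable.
Proof. apply: smallest_sub; [exact: sigma_algebra_measurable|exact: rects_measurable]. Qed.

Let dynkin_indep (B : set Omega) : measurable B ->
  dynkin [set A | measurable A /\ P (A `&` B) = (P A * P B)%E].
Proof.
move=> mB; split => [|A [mA AB]|F tF hF].
- by split; rewrite ?setTI ?probability_setT ?mul1e.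
- split; first exact: measurableC.
  have fB : P B \is a fin_num by exact: fin_num_measure.
  have fA : P A \is a fin_num by exact: fin_num_measure.
  have Bfin : (P B < +oo)%E by rewrite ltey_eq fB.
  rewrite setIC -setDE measureD//.
  rewrite [X in (_ - P X)%E]setIC AB probability_setC//.
  rewrite -[LHS]/(P B - P A * P B)%E; move: (P A) (P B) fA fB => [a| |]// [c| |]// _ _.
  by rewrite muleBl// mul1e.
- split; first by apply: bigcup_measurable => k _; have [] := hF k.
  have mF k : measurable (F k) by have [] := hF k.
  rewrite setI_bigcupl measure_bigcup//; last 2 first.
  + by move=> k _; exact: measurableI.
  + by apply: trivIset_setIr.
  rewrite measure_bigcup// -[RHS]muleC -[in RHS](fineK (fin_num_measure P _ mB)).
  rewrite -nneseriesZl; last by move=> k _.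
  apply: eq_eseriesr => k _; have [_ e] := hF k; rewrite -[LHS]/(P (F k `&` B)) e.
  by rewrite muleC fineK// fin_num_measure.
Qed.

(** The pi-lambda theorem, once in each argument. *)
Lemma sigma_rects_indep I1 I2 A1 A2 : I1 `<=` [set x | (1 <= x)%N] ->
  I2 `<=` [set x | (1 <= x)%N] -> I1 `&` I2 = set0 ->
  <<s rects I1 >> A1 -> <<s rects I2 >> A2 ->
  P (A1 `&` A2) = (P A1 * P A2)%E.
Proof.
move=> I1p I2p I12 sA1 sA2.
have step B : measurable B -> forall I,
   (forall A, rects I A -> P (A `&` B) = (P A * P B)%E) ->
   forall A, <<s rects I >> A -> P (A `&` B) = (P A * P B)%E.
  move=> mB I hI A sA.
  suff : <<s rects I >> `<=` [set A | measurable A /\ P (A `&` B) = (P A * P B)%E].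
    by move=> /(_ _ sA)[].
  apply: lambda_system_subset => //.
  - exact: rects_setI_closed.
  - by apply/dynkin_lambda_system; exact: dynkin_indep.
  - by move=> C rC; split; [exact: rects_measurable rC|exact: hI].
apply: (step _ _ _ _ _ sA1); first exact: sigma_rects_measurable sA2.
move=> A rA; rewrite setIC muleC.
apply: (step _ _ _ _ _ sA2); first exact: rects_measurable rA.
by move=> B rB; rewrite setIC muleC; exact: rects_indep rA rB.
Qed.

(** Measurability for the sub-sigma-algebra is expressed by changing the type of the domain, so that
    the closure lemmas for measurable functions apply to it directly. *)
Definition depends_on (I : set nat) (f : Omega -> R) :=
  measurable_fun [set: g_sigma_algebraType (rects I)]
    (f : g_sigma_algebraType (rects I) -> R).

Lemma depends_on_measurable I f : depends_on I f -> measurable_fun setT f.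
Proof.
by move=> mf _ B mB; apply: (@sigma_rects_measurable I); exact: mf.
Qed.

Lemma depends_on_sub I1 I2 f : I1 `<=` I2 -> depends_on I1 f -> depends_on I2 f.
Proof.
move=> I12 mf mT B mB.
have : <<s rects I1 >> ([set: Omega] `&` f @^-1` B) by exact: mf.
apply: sub_smallest2r; first exact: smallest_sigma_algebra.
move=> C [J [B' [JI mB' ->]]]; exists J, B'; split => //.
exact: subset_trans JI I12.
Qed.

Lemma depends_on_coord (I : set nat) i : I i -> depends_on I (omega i).
Proof.
move=> Ii _ B mB; rewrite setTI; apply: sub_gen_smallest.
exists [fset i]%fset, (fun=> B); split => //.
  by move=> j /=; rewrite in_fset1 => /eqP ->.
apply/seteqP; split => w /= H; first by move=> j /=; rewrite in_fset1 => /eqP ->.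
by apply: (H i); rewrite /= in_fset1.
Qed.

Lemma depends_on_indep I1 I2 f g : I1 `<=` [set x | (1 <= x)%N] ->
  I2 `<=` [set x | (1 <= x)%N] -> I1 `&` I2 = set0 ->
  depends_on I1 f -> depends_on I2 g -> indep_rv f g.
Proof.
move=> I1p I2p I12 mf mg A B mA mB; apply: (sigma_rects_indep I1p I2p I12).
  by have := mf measurableT A mA; rewrite setTI.
by have := mg measurableT B mB; rewrite setTI.
Qed.

End Independence.

(** * The moment generating function near 0 *)

Section ExpTaylor.
Context {R : realType}.

(** The remainder series starts at order 3, and (k + 3)! >= k! compares it with |x|^3 exp |x|. *)
Lemma expR_taylor2 (x : R) :
  `|expR x - (1 + x + x ^+ 2 / 2)| <= `|x| ^+ 3 * expR `|x|.
Proof.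
pose s := series (exp_coeff x).
have sE n : s (n + 3)%N = (1 + x + x ^+ 2 / 2) + \sum_(0 <= k < n) exp_coeff x (k + 3).
  rewrite /s /series/= (@big_cat_nat _ _ _ 3 0)//=; last by rewrite addnC.
  congr (_ + _).
    by rewrite !big_nat_recr//= big_geq// exp_coeffE/= !invr1 expr0 expr1 !mul1r add0r -[2`!]/2%N mulrC.
  by rewrite -{1}[3%N]add0n big_addn addnK.
have bnd n : `|s (n + 3)%N - (1 + x + x ^+ 2 / 2)| <= `|x| ^+ 3 * expR `|x|.
  rewrite sE addrC addKr; apply: (le_trans (ler_norm_sum _ _ _)).
  apply: (@le_trans _ _ (\sum_(0 <= k < n) `|x| ^+ 3 * exp_coeff `|x| k)).
    apply: ler_sum => k _; rewrite !exp_coeffE/= normrM normrX exprD.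
    rewrite ger0_norm ?invr_ge0// [leRHS]mulrC -[leRHS]mulrA ler_wpM2r ?mulr_ge0 ?exprn_ge0//.
    rewrite lef_pV2 ?posrE ?ltr0n ?fact_gt0// ler_nat.
    by rewrite leq_fact// leq_addr.
  rewrite -mulr_sumr ler_wpM2l ?exprn_ge0//.
  rewrite /expR.
  have nd : nondecreasing_seq (series (exp_coeff `|x|)).
    apply/nondecreasing_seqP => m; rewrite /series/= big_nat_recr//= lerDl.
    by rewrite exp_coeffE/= mulr_ge0// ?invr_ge0 ?exprn_ge0.
  exact: nondecreasing_cvgn_le nd (is_cvg_series_exp_coeff _) n.
have cv : (fun n => `|s (n + 3)%N - (1 + x + x ^+ 2 / 2)|) @ \oo --> `|expR x - (1 + x + x ^+ 2 / 2)|.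
  apply: cvg_norm; apply: cvgB; last exact: cvg_cst.
  rewrite (cvg_shiftn 3 s).
  exact: is_cvg_series_exp_coeff.
rewrite -(cvg_lim _ cv)//; apply: limr_le; first by apply/cvg_ex; eexists; exact: cv.
by apply: nearW.
Qed.

End ExpTaylor.

Section Mgf.
Context {R : realType} {d : measure_display} {Omega : measurableType d}.
Variables (P : probability Omega R) (Y : {RV P >-> R}) (s2 : R).
Hypothesis hmean : ('E_P[Y] = 0)%E.
Hypothesis hvar : ('E_P[fun w => (Y w ^+ 2)%R] = s2%:E)%E.
Hypothesis hexp : exists2 theta0 : R, 0 < theta0 &
  forall theta : R, `|theta| < theta0 ->
    ('E_P[fun w => expR (theta * Y w)%R] < +oo)%E.

(** Real-valued, so an infinite integral would be read as 0; this is why [mgf_bounds] also states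
    the equality with the extended integral. *)
Definition mgf (th : R) : R := \int[P]_w expR (th * Y w).

Lemma measurable_expM (th : R) : measurable_fun setT (fun w => expR (th * Y w)).
Proof.
apply: (measurableT_comp (f := expR)); first exact: measurable_expR.
by apply: measurable_funM => //; exact: measurable_cst.
Qed.

Let intE (f : Omega -> R) : measurable_fun setT f -> (forall w, 0 <= f w) ->
  (\int[P]_w (f w)%:E < +oo)%E -> P.-integrable setT (EFin \o f).
Proof.
move=> mf f0 fi; apply/integrableP; split; first exact/measurable_EFinP.
by under eq_integral => w _ do rewrite /= ger0_norm//.
Qed.

Let intP (f : Omega -> R) (g : Omega -> R) : measurable_fun setT f ->
  P.-integrable setT (EFin \o g) -> (forall w, `|f w| <= g w) ->
  P.-integrable setT (EFin \o f).
Proof.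
move=> mf ig fg; apply: le_integrable ig => //; first exact/measurable_EFinP.
by move=> w _ /=; rewrite lee_fin (le_trans (fg w))// ler_norm.
Qed.

Let intD (f g : Omega -> R) : P.-integrable setT (EFin \o f) ->
  P.-integrable setT (EFin \o g) ->
  P.-integrable setT (EFin \o (fun w => f w + g w)).
Proof. by move=> hf hg; exact: (integrableD measurableT hf hg). Qed.

Let intB (f g : Omega -> R) : P.-integrable setT (EFin \o f) ->
  P.-integrable setT (EFin \o g) ->
  P.-integrable setT (EFin \o (fun w => f w - g w)).
Proof. by move=> hf hg; exact: (integrableB measurableT hf hg). Qed.

Let intZ k (f : Omega -> R) : P.-integrable setT (EFin \o f) ->
  P.-integrable setT (EFin \o (fun w => k * f w)).
Proof. by move=> hf; exact: (integrableZl measurableT k hf). Qed.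

Let mY : measurable_fun setT Y. Proof. exact: measurable_funP. Qed.

Let int2 : P.-integrable setT (EFin \o (fun w => Y w ^+ 2)).
Proof.
apply: intE => [|w|]; first exact: measurable_funX.
  exact: sqr_ge0.
by move: hvar; rewrite unlock => ->; rewrite ltry.
Qed.

Let int0 : P.-integrable setT (EFin \o (fun=> 1 : R)).
Proof. exact: finite_measure_integrable_cst. Qed.

Let int1 : P.-integrable setT (EFin \o Y).
Proof.
apply: (@intP _ (fun w => 1 + Y w ^+ 2)) => // [|w].
  exact: intD.
rewrite ler_norml; have := sqr_ge0 (Y w + 1); have := sqr_ge0 (Y w - 1).
by move: (Y w) => y; rewrite sqrrB sqrrD => h1 h2; apply/andP; split; nra.
Qed.

(** The Taylor remainder is |th Y|^3 exp |th Y|. One factor exp (r |Y| / 2) dominates |Y|^3, a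
    second one exp |th Y|, and their product is at most exp (r Y) + exp (- r Y), which is
    integrable. *)
Lemma mgf_approx : exists th1 K, [/\ 0 < th1, 0 <= K & forall th, `|th| <= th1 ->
  P.-integrable setT (EFin \o (fun w => expR (th * Y w))) /\
  `|mgf th - (1 + th ^+ 2 * s2 / 2)| <= K * `|th| ^+ 3].
Proof.
have [th0 th00 hth] := hexp.
pose r := th0 / 2; have r0 : 0 < r by rewrite divr_gt0.
have rth : r < th0 by rewrite /r; lra.
have inte th : `|th| < th0 -> P.-integrable setT (EFin \o (fun w => expR (th * Y w))).
  move=> /hth; rewrite unlock => h; by apply: intE => //; exact: measurable_expM.
have ir : P.-integrable setT (EFin \o (fun w => expR (r * Y w))).
  by apply: inte; rewrite gtr0_norm.
have irN : P.-integrable setT (EFin \o (fun w => expR (- r * Y w))).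
  by apply: inte; rewrite normrN gtr0_norm.
(* From the cubic term of the series: (r y / 2)^3 / 3! <= exp (r y / 2). *)
pose c := 6 * (2 / r) ^+ 3.
have c0 : 0 < c by rewrite mulr_gt0// exprn_gt0// divr_gt0.
pose D w := c * (expR (r * Y w) + expR (- r * Y w)).
have iD : P.-integrable setT (EFin \o D).
  by apply: intZ; exact: intD.
exists (r / 2), (\int[P]_w D w); split; first by rewrite divr_gt0.
  by apply: Rintegral_ge0 => w _; rewrite mulr_ge0 ?(ltW c0)// addr_ge0 ?expR_ge0.
move=> th thr.
have ith : P.-integrable setT (EFin \o (fun w => expR (th * Y w))).
  by apply: inte; apply: le_lt_trans thr _; rewrite /r; lra.
split => //.
pose q w := 1 + (th * Y w + th ^+ 2 / 2 * Y w ^+ 2).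
have iq1 : P.-integrable setT (EFin \o (fun w => th * Y w)).
  exact: intZ.
have iq2 : P.-integrable setT (EFin \o (fun w => th ^+ 2 / 2 * Y w ^+ 2)).
  exact: intZ.
have iq3 : P.-integrable setT (EFin \o (fun w => th * Y w + th ^+ 2 / 2 * Y w ^+ 2)).
  exact: intD.
have iq : P.-integrable setT (EFin \o q) by exact: intD.
have E1 : \int[P]_w Y w = 0.
  by rewrite /Rintegral; move: hmean; rewrite unlock => ->.
have E2 : \int[P]_w (Y w ^+ 2) = s2.
  by rewrite /Rintegral; move: hvar; rewrite unlock => ->.
have Eq : \int[P]_w q w = 1 + th ^+ 2 * s2 / 2.
  rewrite RintegralD// RintegralD// RintegralZl// RintegralZl//.
  rewrite E1 E2 mulr0 add0r Rintegral_cst//= probability_setT/= mul1r.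
  by congr (_ + _); ring.
rewrite -Eq /mgf -RintegralB//.
have ie : P.-integrable setT (EFin \o (fun w => expR (th * Y w) - q w)).
  exact: intB.
apply: (le_trans (le_normr_Rintegral measurableT ie)).
rewrite mulrC -RintegralZl//.
apply: le_Rintegral => //.
- by apply: integrable_norm.
- exact: intZ.
move=> w _; rewrite /q.
have -> : expR (th * Y w) - (1 + (th * Y w + th ^+ 2 / 2 * Y w ^+ 2)) =
    expR (th * Y w) - (1 + th * Y w + (th * Y w) ^+ 2 / 2).
  by rewrite exprMn; ring.
apply: (le_trans (expR_taylor2 _)).
rewrite normrM exprMn -mulrA ler_wpM2l ?exprn_ge0//.
have y0 := normr_ge0 (Y w); set y := `|Y w| in y0 *.
have h1 : y ^+ 3 <= c * expR (r / 2 * y).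
  have ry0 : 0 <= r / 2 * y by rewrite mulr_ge0// ltW// divr_gt0.
  have := expR_ge1Dxn 2 ry0.
  rewrite exprMn -[3`!]/6%N => h.
  have {}h : (r / 2) ^+ 3 * y ^+ 3 / 6 <= expR (r / 2 * y).
    by apply: le_trans h; rewrite lerDr.
  move: h; rewrite ler_pdivrMr// -ler_pdivlMl ?exprn_gt0 ?divr_gt0// => h.
  apply: (le_trans h); rewrite /c -exprVn invf_div.
  by rewrite le_eqVlt; apply/orP; left; apply/eqP; ring.
have h2 : expR (`|th| * y) <= expR (r / 2 * y) by rewrite ler_expR ler_wpM2r.
have h3 : expR (r / 2 * y) * expR (r / 2 * y) <= expR (r * Y w) + expR (- r * Y w).
  rewrite -expRD -mulrDl -splitr /y; case: (ger0P (Y w)) => _.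
    by rewrite lerDl expR_ge0.
  by rewrite mulrN -mulNr lerDr expR_ge0.
apply: (@le_trans _ _ (c * expR (r / 2 * y) * expR (r / 2 * y))).
  by rewrite ler_pM ?expR_ge0// exprn_ge0.
by rewrite -mulrA /D ler_wpM2l// ltW.
Qed.

Lemma mgf_bounds (dl : R) : 0 < s2 -> 0 < dl -> dl <= 1 -> exists2 th1, 0 < th1 &
  forall th, `|th| <= th1 -> [/\
    (\int[P]_w (expR (th * Y w))%:E = (mgf th)%:E)%E,
    expR ((1 - dl) * (s2 * th ^+ 2 / 2)) <= mgf th &
    mgf th <= expR ((1 + dl) * (s2 * th ^+ 2 / 2))].
Proof.
move=> s20 dl0 dl1; have [th1 [K [th10 K0 hK]]] := mgf_approx.
(* For |th| <= a the cubic error is at most dl v / 2, where v = s2 th^2 / 2. *)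
pose a := dl * s2 / (4 * (K + 1)).
have K1 : 0 < 4 * (K + 1) by rewrite mulr_gt0// ltr_wpDl.
have a0 : 0 < a by rewrite divr_gt0// mulr_gt0.
(* For |th| <= c one has th^2 <= dl / (2 s2), hence v <= dl / 4, where exp u <= 1 + u + 2 u^2 can be
   used. *)
pose c := Num.min 1 (dl / (2 * s2)).
have c0 : 0 < c by rewrite lt_min ltr01/= divr_gt0// mulr_gt0.
exists (Num.min th1 (Num.min a c)); first by rewrite lt_min th10 lt_min a0 c0.
move=> th; rewrite le_min => /andP[h1]; rewrite le_min => /andP[h2].
rewrite le_min => /andP[h3 h4].
have [ith hm] := hK th h1.
have mE : (\int[P]_w (expR (th * Y w))%:E = (mgf th)%:E)%E.
  by rewrite /mgf /Rintegral fineK// integrable_fin_num.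
pose v := s2 * th ^+ 2 / 2.
have v0 : 0 <= v by rewrite divr_ge0// mulr_ge0 ?sqr_ge0// ltW.
have t0 := normr_ge0 th.
have tt : `|th| ^+ 2 = th ^+ 2 by rewrite real_normK ?num_real.
have Kv : K * `|th| ^+ 3 <= dl / 2 * v.
  have -> : K * `|th| ^+ 3 = K * `|th| * th ^+ 2 by rewrite -tt; ring.
  have -> : dl / 2 * v = (dl * s2 / 4) * th ^+ 2 by rewrite /v; field.
  rewrite ler_wpM2r ?sqr_ge0//.
  move: h2; rewrite /a ler_pdivlMr// => h2.
  by move: h2 t0 K0; move: (`|th|) => t ? ? ?; nra.
move: hm; have -> : 1 + th ^+ 2 * s2 / 2 = 1 + v by rewrite /v; ring.
rewrite ler_norml => /andP[lo up]; split => //; rewrite -/v.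
- have v4 : v <= dl / 4.
    have h5 : th ^+ 2 <= dl / (2 * s2).
      rewrite -tt expr2 -[leRHS]mul1r ler_pM//.
    rewrite /v; move: h5; rewrite ler_pdivlMr ?mulr_gt0// => h5.
    move: h5; move: (th ^+ 2) => t; nra.
  pose u := (1 - dl) * v.
  have u0 : 0 <= u by rewrite mulr_ge0// subr_ge0.
  have uv : u <= v by rewrite ler_piMl// gerBl ltW.
  have eu : expR u <= 1 + u + 2 * u ^+ 2.
    have h6 := expR_ge1Dx (- u).
    have u1 : 0 < 1 - u by move: uv v4 dl1; lra.
    rewrite -(ler_pM2r u1); apply: (@le_trans _ _ (expR u * expR (- u))).
      by rewrite ler_wpM2l// expR_ge0.
    rewrite expRxMexpNx_1.
    have := mulr_ge0 (sqr_ge0 u) (_ : 0 <= 1 - 2 * u).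
    by rewrite (_ : 0 <= 1 - 2 * u) => [/(_ isT)|]; move: uv v4 dl1; lra.
  apply: (le_trans eu).
  have : u ^+ 2 <= v * (dl / 4) by rewrite expr2 ler_pM// (le_trans uv).
  move: lo Kv; rewrite /u; nra.
- apply: le_trans (expR_ge1Dx _).
  by move: up Kv; nra.
Qed.

End Mgf.

(** * A maximal inequality for products of independent factors *)

Section Ville.
Context {R : realType} {d : measure_display} {Omega : measurableType d}.
Variable P : probability Omega R.
Variable omega : nat -> {RV P >-> R}.
Hypothesis hindep : mutually_independent P [set x | (1 <= x)%N]
                (fun x => omega x : Omega -> R).
Local Notation depends_on := (depends_on omega).

Lemma integral_markov (f : Omega -> R) (a : R) : measurable_fun setT f ->
  (forall w, 0 <= f w) -> 0 < a ->
  (P [set w | (a <= f w)%R] <= a^-1%:E * \int[P]_w (f w)%:E)%E.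
Proof.
move=> mf f0 a0; set D := [set w | _].
have mD : measurable D.
  have -> : D = f @^-1` `[a, +oo[%classic by apply/seteqP; split => w /=; rewrite in_itv/= andbT.
  by rewrite -[X in measurable X]setTI; apply: mf.
rewrite muleC lee_pdivlMr//.
have -> : (P D * a%:E = \int[P]_w (a * \1_D w)%:E)%E.
  under eq_integral do rewrite EFinM.
  rewrite ge0_integralZl ?lee_fin ?(ltW a0)//; last first.
    by apply/measurable_EFinP; exact: measurable_indic.
  by rewrite integral_indic// setIT muleC.
have mI : measurable_fun setT (fun w => a * \1_D w : R).
  by apply: measurable_funM => //; exact: measurable_indic.
apply: ge0_le_integral.
- exact: measurableT.
- by move=> w _; rewrite lee_fin mulr_ge0// ltW.
- exact/measurable_EFinP.
- exact/measurable_EFinP.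
move=> w _; rewrite lee_fin indicE; have [wD|wD] := boolP (w \in D).
  by rewrite mulr1; move: wD; rewrite inE.
by rewrite mulr0.
Qed.

Section stopped.
Variables (Y : nat -> Omega -> R) (x K : nat) (a : R).
Hypothesis Ydep : forall i, (x < i <= x + K)%N -> depends_on [set i] (Y i).
Hypothesis Y0 : forall i w, 0 <= Y i w.
Hypothesis Y1 : forall i, (x < i <= x + K)%N -> (\int[P]_w (Y i w)%:E <= 1)%E.
Hypothesis a0 : 0 < a.

(* The product is frozen once it reaches a, so its integral never exceeds 1 and
   Markov's inequality controls the maximum (Ville). *)
Fixpoint stopped_prod (k : nat) (w : Omega) : R :=
  if k is k'.+1 then
    if stopped_prod k' w < a then stopped_prod k' w * Y (x + k) w
    else stopped_prod k' w
  else 1.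
Local Notation M := stopped_prod.

Let window k := [set i | (x < i <= x + k)%N].

Lemma stopped_prod_ge0 k w : 0 <= M k w.
Proof. by elim: k => //= k IH; case: ifP => // _; rewrite mulr_ge0. Qed.

Let dep_lt f I (c : R) : depends_on I f ->
  measurable_fun [set: g_sigma_algebraType (rects omega I)]
    (fun w : g_sigma_algebraType (rects omega I) => f w < c).
Proof. by move=> mf; apply: measurable_fun_ltr => //; exact: measurable_cst. Qed.

Lemma stopped_prod_depends k : (k <= K)%N -> depends_on (window k) (M k).
Proof.
elim: k => [_|k IH kK]; first exact: measurable_cst.
have Mk : depends_on (window k.+1) (M k).
  apply: depends_on_sub (IH (ltnW kK)) => i /= /andP[xi ik].
  by apply/andP; split => //; rewrite addnS ltnW.
apply: measurable_fun_ifT => //; first exact: dep_lt.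
apply: measurable_funM => //.
apply: depends_on_sub (Ydep _) => [i /= ->|].
  by apply/andP; split=> //; rewrite addnS ltnS leq_addr.
by rewrite addnS ltnS leq_addr -addnS leq_add2l.
Qed.

Lemma stopped_prod_measurable k : (k <= K)%N -> measurable_fun setT (M k).
Proof. by move=> kK; exact: depends_on_measurable (stopped_prod_depends kK). Qed.

Lemma stopped_prod_integral k : (k <= K)%N -> (\int[P]_w (M k w)%:E <= 1)%E.
Proof.
elim: k => [_|k IH kK].
  rewrite -[leLHS]/(\int[P]_w cst 1%:E w)%E integral_cst// mul1e.
  exact: probability_le1.
have {}IH := IH (ltnW kK).
have dM := stopped_prod_depends (ltnW kK).
have kw : (x < x + k.+1 <= x + K)%N by rewrite addnS ltnS leq_addr -addnS leq_add2l.
pose F w := if M k w < a then M k w else 0.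
pose G w := if M k w < a then 0 else M k w.
have F0 w : 0 <= F w by rewrite /F; case: ifP => // _; exact: stopped_prod_ge0.
have G0 w : 0 <= G w by rewrite /G; case: ifP => // _; exact: stopped_prod_ge0.
have dF : depends_on (window k) F.
  by apply: measurable_fun_ifT => //; exact: dep_lt.
have dG : depends_on (window k) G.
  by apply: measurable_fun_ifT => //; exact: dep_lt.
have mF := depends_on_measurable dF.
have mG := depends_on_measurable dG.
have dY := Ydep kw.
have mYk := depends_on_measurable dY.
have -> : (\int[P]_w (M k.+1 w)%:E = \int[P]_w ((G w)%:E + (F w * Y (x + k.+1)%N w)%:E))%E.
  apply: eq_integral => w _ /=; rewrite /F /G -EFinD.
  by case: ifP => _; rewrite ?add0r// mul0r addr0.
rewrite ge0_integralD//; last 4 first.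
- by move=> w _; rewrite lee_fin.
- exact/measurable_EFinP.
- by move=> w _; rewrite lee_fin mulr_ge0.
- by apply/measurable_EFinP; exact: measurable_funM.
rewrite (@ge0_indep_integralM _ _ _ P F (Y (x + k.+1)%N))//; last first.
  apply: (depends_on_indep hindep _ _ _ dF dY).
  - by move=> i /= /andP[xi _]; rewrite (leq_trans _ xi).
  - by move=> i /= ->; rewrite addnS.
  - by apply/seteqP; split => i //= [/andP[_ ik] ie]; move: ik; rewrite ie addnS ltnn.
apply: (le_trans _ IH).
have -> : (\int[P]_w (M k w)%:E = \int[P]_w (G w)%:E + \int[P]_w (F w)%:E)%E.
  rewrite -ge0_integralD//; last 4 first.
  - by move=> w _; rewrite lee_fin.
  - exact/measurable_EFinP.
  - by move=> w _; rewrite lee_fin.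
  - exact/measurable_EFinP.
  apply: eq_integral => w _; rewrite /F /G -EFinD.
  by case: ifP => _; rewrite ?add0r ?addr0.
apply: leeD => //; rewrite -[leRHS]mule1; apply: lee_wpmul2l; last exact: Y1.
by apply: integral_ge0 => w _; rewrite lee_fin.
Qed.

Let pr k w := \prod_(x.+1 <= i < (x + k).+1) Y i w.

Let reach k w : a <= pr k w -> a <= M k w.
Proof.
have inv : a <= M k w \/ M k w = pr k w.
  elim: k => [|k IH]; first by right; rewrite /pr addn0 big_geq.
  rewrite /=; case: ltP => [lt|ge]; last by left.
  right; case: IH => [|->]; first by rewrite leNgt lt.
  by rewrite /pr addnS [RHS]big_nat_recr//= ltnS leq_addr.
by case: inv => // ->.
Qed.

Let stay k n w : a <= M k w -> a <= M (k + n)%N w.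
Proof.
move=> h; elim: n => [|n IH]; first by rewrite addn0.
by rewrite addnS /= ltNge IH.
Qed.

Lemma ville : exists D : set Omega, [/\ measurable D, (P D <= a^-1%:E)%E &
  forall w k, (k <= K)%N -> a <= pr k w -> D w].
Proof.
have mM := stopped_prod_measurable (leqnn K).
exists [set w | (a <= M K w)%R]; split.
- have -> : [set w | a <= M K w] = M K @^-1` `[a, +oo[%classic.
    by apply/seteqP; split => w /=; rewrite in_itv/= andbT.
  by rewrite -[X in measurable X]setTI; apply: mM.
- apply: (le_trans (integral_markov mM (stopped_prod_ge0 K) a0)).
  rewrite -[leRHS]mule1; apply: lee_wpmul2l; first by rewrite lee_fin invr_ge0 ltW.
  exact: stopped_prod_integral.
- by move=> w k kK h /=; rewrite -(subnKC kK); apply: stay; exact: reach.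
Qed.

End stopped.
End Ville.

(** * Exponential bounds for sums of the environment *)

Section IidExponential.
Context {R : realType} {d : measure_display} {Omega : measurableType d}.
Variable P : probability Omega R.
Variable omega : nat -> {RV P >-> R}.
Hypothesis hindep : mutually_independent P [set x | (1 <= x)%N]
                (fun x => omega x : Omega -> R).
Hypothesis hident : forall x : nat, (1 <= x)%N ->
  identically_distributed (omega x) (omega 1%N).
Local Notation depends_on := (depends_on omega).
Local Notation phi := (mgf (omega 1%N)).

Definition bsum (x l : nat) (w : Omega) : R :=
  \sum_(x.+1 <= i < (x + l).+1) omega i w.

Lemma bsumS x l w : bsum x l.+1 w = bsum x l w + omega (x + l.+1)%N w.
Proof. by rewrite /bsum addnS big_nat_recr//= ltnS leq_addr. Qed.

Lemma integral_exp_ident (th : R) i : (1 <= i)%N ->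
  (\int[P]_w (expR (th * omega i w))%:E = \int[P]_w (expR (th * omega 1%N w))%:E)%E.
Proof.
move=> i1; pose f (y : R) : \bar R := (expR (th * y))%:E.
have mf : measurable_fun setT f.
  apply/measurable_EFinP; apply: (measurableT_comp (f := expR)); first exact: measurable_expR.
  by apply: measurable_funM => //; exact: measurable_cst.
have f0 y : (0 <= f y)%E by rewrite lee_fin expR_ge0.
have e j : (\int[P]_w (expR (th * omega j w))%:E = \int[distribution P (omega j)]_y f y)%E.
  by rewrite ge0_integral_distribution.
rewrite !e; apply: eq_measure_integral => A mA _; exact: hident.
Qed.

Lemma depends_on_expM (I : set nat) (f : Omega -> R) (th c : R) :
  depends_on I f -> depends_on I (fun w => expR (th * f w - c)).
Proof.
move=> df; apply: (measurableT_comp (f := expR)); first exact: measurable_expR.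
apply: measurable_funB; last exact: measurable_cst.
by apply: measurable_funM => //; exact: measurable_cst.
Qed.

(** The compensator v may vary with i. In [single_barrier] it is th b i^(-alpha), and the sums
    become th times the increments of V. *)
Lemma exp_ville (x K : nat) (th a : R) (v : nat -> R) :
  (forall i, (x < i <= x + K)%N ->
     (\int[P]_w (expR (th * omega 1%N w))%:E <= (expR (v i))%:E)%E) ->
  exists D : set Omega, [/\ measurable D, (P D <= (expR (- a))%:E)%E &
    forall w k, (k <= K)%N ->
      a <= \sum_(x.+1 <= i < (x + k).+1) (th * omega i w - v i) -> D w].
Proof.
move=> hv; pose Y i w := expR (th * omega i w - v i).
have Yd i : (x < i <= x + K)%N -> depends_on [set i] (Y i).
  by move=> _; apply: depends_on_expM; exact: depends_on_coord.
have Y1 i : (x < i <= x + K)%N -> (\int[P]_w (Y i w)%:E <= 1)%E.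
  move=> xi; have i1 : (1 <= i)%N by case/andP: xi => /(leq_trans _) ->.
  have -> : (\int[P]_w (Y i w)%:E = (expR (- v i))%:E * \int[P]_w (expR (th * omega i w))%:E)%E.
    rewrite -ge0_integralZl ?lee_fin ?expR_ge0//; last first.
      by apply/measurable_EFinP; exact: measurable_expM.
    by apply: eq_integral => w _; rewrite /Y -EFinM -expRD addrC.
  rewrite integral_exp_ident//.
  apply: (@le_trans _ _ ((expR (- v i))%:E * (expR (v i))%:E)%E).
    by apply: lee_wpmul2l; [rewrite lee_fin expR_ge0|exact: hv].
  by rewrite -EFinM -expRD addNr expR0.
have [D [mD PD hD]] := ville hindep Yd (fun i w => expR_ge0 _) Y1 (expR_gt0 a).
exists D; split => //; first by rewrite expRN.
move=> w k kK ak; apply: hD kK _.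
by rewrite /Y -expR_sum ler_expR.
Qed.

Lemma bsum_depends x l : depends_on [set i | (x < i <= x + l)%N] (bsum x l).
Proof.
elim: l => [|l IH].
  rewrite (_ : bsum x 0 = cst 0); first exact: measurable_cst.
  by apply/funext => w; rewrite /bsum addn0 big_geq.
rewrite (_ : bsum x l.+1 = (fun w => bsum x l w + omega (x + l.+1)%N w)); last first.
  by apply/funext => w; rewrite bsumS.
apply: measurable_funD.
  apply: depends_on_sub IH => i /= /andP[xi il]; apply/andP; split => //.
  by rewrite addnS ltnW.
by apply: depends_on_coord; apply/andP; split => //; rewrite addnS ltnS leq_addr.
Qed.

Lemma bsum_measurable x l : measurable_fun setT (bsum x l).
Proof. exact: depends_on_measurable (@bsum_depends x l). Qed.

Lemma block_mgf x l (th : R) :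
  (\int[P]_w (expR (th * omega 1%N w))%:E = (phi th)%:E)%E ->
  (\int[P]_w (expR (th * bsum x l w))%:E = (phi th ^+ l)%:E)%E.
Proof.
move=> hth; elim: l => [|l IH].
  rewrite expr0 (_ : (fun w => _) = cst 1%E); last first.
    by apply/funext => w; rewrite /bsum addn0 big_geq// mulr0 expR0.
  by rewrite integral_cst// mul1e; exact: probability_setT.
have -> : (\int[P]_w (expR (th * bsum x l.+1 w))%:E =
   \int[P]_w (expR (th * bsum x l w) * expR (th * omega (x + l.+1)%N w))%:E)%E.
  by apply: eq_integral => w _; rewrite bsumS mulrDr expRD.
have de I f : depends_on I f -> depends_on I (fun w => expR (th * f w)).
  move=> df; have := @depends_on_expM _ _ th 0 df.
  by congr (depends_on I); apply/funext => w; rewrite subr0.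
have d1 := de _ _ (@bsum_depends x l).
have d2 : depends_on [set (x + l.+1)%N] (fun w => expR (th * omega (x + l.+1)%N w)).
  by apply: de; exact: depends_on_coord.
rewrite ge0_indep_integralM.
- rewrite IH integral_exp_ident; last by rewrite addnS.
  by rewrite hth -EFinM -exprSr.
- exact: depends_on_measurable d1.
- exact: depends_on_measurable d2.
- by move=> w; exact: expR_ge0.
- by move=> w; exact: expR_ge0.
apply: (depends_on_indep hindep _ _ _ d1 d2).
- by move=> i /= /andP[xi _]; rewrite (leq_trans _ xi).
- by move=> i /= ->; rewrite addnS.
- by apply/seteqP; split => i //= [/andP[_ ik] ie]; move: ik; rewrite ie addnS ltnn.
Qed.

(* Lower bound by exponential tilting at th: the parts of exp (th S) where S is
   not within a factor 1 +- e of c are removed by the tilts (1 +- e) th. *)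
Lemma tilting x l (th e c : R) : 0 < th -> 0 < e -> e <= 1 ->
  (forall t, `|t| <= 2 * th ->
    (\int[P]_w (expR (t * omega 1%N w))%:E = (phi t)%:E)%E) ->
  ((phi th ^+ l)%:E <= (expR ((1 + e) * th * c))%:E * P [set w | ((1 - e) * c <= bsum x l w)%R]
     + (phi ((1 + e) * th) ^+ l * expR (- (e * (1 + e) * th * c)))%:E
     + (phi ((1 - e) * th) ^+ l * expR (e * (1 - e) * th * c))%:E)%E.
Proof.
move=> th0 e0 e1 hphi.
have [mp mp0 mpP mpc] : [/\ 0 <= (1 + e) * th, (1 + e) * th <= 2 * th,
   0 <= (1 - e) * th & (1 - e) * th <= 2 * th].
  split; rewrite ?mulr_ge0 ?subr_ge0 ?addr_ge0 ?(ltW th0) ?(ltW e0)// ler_wpM2r ?(ltW th0)//; lra.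
set D := [set w | _].
have mS := bsum_measurable x l.
have mD : measurable D.
  have -> : D = bsum x l @^-1` `[(1 - e) * c, +oo[%classic.
    by apply/seteqP; split => w /=; rewrite in_itv/= andbT.
  by rewrite -[X in measurable X]setTI; apply: mS.
have mE t : measurable_fun setT (fun w => expR (t * bsum x l w)).
  apply: (measurableT_comp (f := expR)); first exact: measurable_expR.
  by apply: measurable_funM => //; exact: measurable_cst.
rewrite -(block_mgf x l); last by apply: hphi; rewrite gtr0_norm//; lra.
pose f1 w := expR ((1 + e) * th * c) * \1_D w.
pose f2 w := expR (- (e * (1 + e) * th * c)) * expR ((1 + e) * th * bsum x l w).
pose f3 w := expR (e * (1 - e) * th * c) * expR ((1 - e) * th * bsum x l w).
have f10 w : 0 <= f1 w by rewrite mulr_ge0 ?expR_ge0.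
have f20 w : 0 <= f2 w by rewrite mulr_ge0 ?expR_ge0.
have f30 w : 0 <= f3 w by rewrite mulr_ge0 ?expR_ge0.
have mf1 : measurable_fun setT f1.
  by apply: measurable_funM => //; exact: measurable_indic.
have mf2 : measurable_fun setT f2.
  by apply: measurable_funM => //; exact: mE.
have mf3 : measurable_fun setT f3.
  by apply: measurable_funM => //; exact: mE.
have I1 : ((expR ((1 + e) * th * c))%:E * P D = \int[P]_w (f1 w)%:E)%E.
  under eq_integral do rewrite EFinM.
  rewrite ge0_integralZl ?lee_fin ?expR_ge0//; last first.
    by apply/measurable_EFinP; exact: measurable_indic.
  by rewrite integral_indic// setIT.
have I2 : ((phi ((1 + e) * th) ^+ l * expR (- (e * (1 + e) * th * c)))%:E = \int[P]_w (f2 w)%:E)%E.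
  under eq_integral do rewrite EFinM.
  rewrite ge0_integralZl ?lee_fin ?expR_ge0//; last first.
    by apply/measurable_EFinP; exact: mE.
  rewrite block_mgf; last by apply: hphi; rewrite ger0_norm.
  by rewrite -EFinM mulrC.
have I3 : ((phi ((1 - e) * th) ^+ l * expR (e * (1 - e) * th * c))%:E = \int[P]_w (f3 w)%:E)%E.
  under eq_integral do rewrite EFinM.
  rewrite ge0_integralZl ?lee_fin ?expR_ge0//; last first.
    by apply/measurable_EFinP; exact: mE.
  rewrite block_mgf; last by apply: hphi; rewrite ger0_norm.
  by rewrite -EFinM mulrC.
have -> : ((expR ((1 + e) * th * c))%:E * P D
     + (phi ((1 + e) * th) ^+ l * expR (- (e * (1 + e) * th * c)))%:E
     + (phi ((1 - e) * th) ^+ l * expR (e * (1 - e) * th * c))%:E =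
   \int[P]_w ((f1 w + f2 w + f3 w)%R)%:E)%E.
  rewrite I1 I2 I3 -ge0_integralD//; try by
    [move=> w _; rewrite lee_fin|exact/measurable_EFinP].
  rewrite -ge0_integralD//; try by
    [move=> w _; rewrite -?EFinD lee_fin ?addr_ge0|exact/measurable_EFinP].
  by apply: emeasurable_funD; exact/measurable_EFinP.
apply: ge0_le_integral.
- exact: measurableT.
- by move=> w _; rewrite lee_fin expR_ge0.
- by apply/measurable_EFinP; exact: mE.
- by apply/measurable_EFinP; apply: measurable_funD => //; exact: measurable_funD.
move=> w _; rewrite lee_fin; have := f10 w; have := f20 w; have := f30 w.
have [hu|hu] := leP ((1 + e) * c) (bsum x l w).
  have : expR (th * bsum x l w) <= f2 w.
    rewrite /f2 -expRD ler_expR.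
    have := mulr_ge0 (mulr_ge0 (ltW e0) (ltW th0)) (_ : 0 <= bsum x l w - (1 + e) * c).
    by rewrite subr_ge0 => /(_ hu); move: (bsum x l w) => s; lra.
  by move: (f1 w) (f2 w) (f3 w) => ? ? ?; lra.
have [hl|hl] := leP ((1 - e) * c) (bsum x l w).
  have : expR (th * bsum x l w) <= f1 w.
    rewrite /f1 indicE (_ : w \in D) ?inE// mulr1 ler_expR.
    by rewrite [leRHS]mulrAC [leRHS]mulrC ler_wpM2l ?(ltW th0)// ltW.
  by move: (f1 w) (f2 w) (f3 w) => ? ? ?; lra.
have : expR (th * bsum x l w) <= f3 w.
  rewrite /f3 -expRD ler_expR.
  have := mulr_ge0 (mulr_ge0 (ltW e0) (ltW th0)) (_ : 0 <= (1 - e) * c - bsum x l w).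
  by rewrite subr_ge0 => /(_ (ltW hl)); move: (bsum x l w) => s; lra.
by move: (f1 w) (f2 w) (f3 w) => ? ? ?; lra.
Qed.

End IidExponential.

(** * Almost sure behaviour of the potential *)

Section EnvironmentLln.
Context {R : realType} {d : measure_display} {Omega : measurableType d}.
Variable P : probability Omega R.
Variable omega : nat -> {RV P >-> R}.
Hypothesis hindep : mutually_independent P [set x | (1 <= x)%N]
                (fun x => omega x : Omega -> R).
Hypothesis hident : forall x : nat, (1 <= x)%N ->
  identically_distributed (omega x) (omega 1%N).
Local Notation phi := (mgf (omega 1%N)).
Variable s2 : R.
Hypothesis s20 : 0 < s2.
Hypothesis phi_bounds : forall dl, 0 < dl -> dl <= 1 -> exists2 th1, 0 < th1 &
  forall th, `|th| <= th1 -> [/\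
    (\int[P]_w (expR (th * omega 1%N w))%:E = (phi th)%:E)%E,
    expR ((1 - dl) * (s2 * th ^+ 2 / 2)) <= phi th &
    phi th <= expR ((1 + dl) * (s2 * th ^+ 2 / 2))].

(** The main term and each removed part differ in exponent by 11 e^2 a / 16 >= 11 / 2, so together
    the removed parts take at most half. The remaining cost 2 (1 + e) a - (1 - e^2 / 16) a is at
    most (1 + 3 e) a. *)
Lemma tilt_alg (e a A B C X p : R) : 0 < e -> e <= 1 -> 8 <= e ^+ 2 * a ->
  expR ((1 - e ^+ 2 / 16) * a) <= A ->
  B <= expR ((1 - 3 * e ^+ 2 / 4) * a) -> C <= expR ((1 - 3 * e ^+ 2 / 4) * a) ->
  X = expR (2 * (1 + e) * a) -> A <= X * p + B + C ->
  2^-1 * expR (- ((1 + 3 * e) * a)) <= p.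
Proof.
move=> e0 e1 ea hA hB hC -> h.
have a0 : 0 <= a.
  rewrite leNgt; apply/negP => a0.
  have na : 0 <= - a by rewrite oppr_ge0 ltW.
  by have := mulr_ge0 (sqr_ge0 e) na; lra.
set E := expR ((1 - e ^+ 2 / 16) * a) in hA.
have E0 : 0 < E by exact: expR_gt0.
have small : 2 * expR ((1 - 3 * e ^+ 2 / 4) * a) <= E / 2.
  have -> : E = expR (11 / 16 * (e ^+ 2 * a)) * expR ((1 - 3 * e ^+ 2 / 4) * a).
    by rewrite -expRD /E; congr expR; field.
  have : 4 <= expR (11 / 16 * (e ^+ 2 * a)).
    apply: le_trans (expR_ge1Dx _); lra.
  move: (expR_gt0 ((1 - 3 * e ^+ 2 / 4) * a)).
  move: (expR (11 / 16 * _)) (expR ((1 - _) * a)) => x y y0 x4; nra.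
have hp : E / 2 <= expR (2 * (1 + e) * a) * p by lra.
rewrite -(ler_pM2l (expR_gt0 (2 * (1 + e) * a))); apply: le_trans hp.
rewrite mulrCA -expRD mulrC ler_wpM2r ?invr_ge0// ler_expR.
have q0 : 0 <= 1 - e by rewrite subr_ge0.
by have := mulr_ge0 (mulr_ge0 (ltW e0) q0) a0; lra.
Qed.

(** The level c = l s2 th is, to leading order, the mean of the block sum under the tilt th, and a =
    l s2 th^2 / 2 is the Gaussian cost; thus th c = 2 a. *)
Lemma block_tail (e : R) : 0 < e -> e <= 1 -> exists2 th1, 0 < th1 &
  forall th, 0 < th -> th <= th1 -> forall x l,
  8 <= e ^+ 2 * (l%:R * (s2 * th ^+ 2 / 2)) ->
  ((2^-1 * expR (- ((1 + 3 * e) * (l%:R * (s2 * th ^+ 2 / 2)))))%:E <=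
   P [set w | ((1 - e) * (l%:R * s2 * th) <= bsum omega x l w)%R])%E.
Proof.
move=> e0 e1; have d0 : 0 < e ^+ 2 / 16 by rewrite divr_gt0// exprn_gt0.
have e21 : e ^+ 2 <= 1 by rewrite exprn_ile1// ltW.
have d1 : e ^+ 2 / 16 <= 1 by lra.
have [th1 th10 hth] := phi_bounds d0 d1.
exists (th1 / 2); first by rewrite divr_gt0.
move=> th th0 thle x l; set a := l%:R * _ => ea.
have th2 : 2 * th <= th1 by lra.
have hphi t : `|t| <= 2 * th -> (\int[P]_w (expR (t * omega 1%N w))%:E = (phi t)%:E)%E.
  by move=> tt; have [] := hth t (le_trans tt th2).
pose c := l%:R * s2 * th.
have := tilting hindep hident x l c th0 e0 e1 hphi.
set D := [set w | _].
have mS := bsum_measurable omega x l.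
have mD : measurable D.
  have -> : D = bsum omega x l @^-1` `[(1 - e) * c, +oo[%classic.
    by apply/seteqP; split => w /=; rewrite in_itv/= andbT.
  by rewrite -[X in measurable X]setTI; apply: mS.
rewrite -[P D]fineK ?fin_num_measure// -EFinM -!EFinD !lee_fin.
have a0 : 0 <= a by rewrite /a mulr_ge0// divr_ge0// mulr_ge0 ?sqr_ge0// ltW.
have thc : th * c = 2 * a by rewrite /a /c; field.
apply: (tilt_alg e0 e1 ea).
- have thn : `|th| <= th1 by rewrite gtr0_norm//; lra.
  have [_ lo _] := hth th thn.
  have -> : (1 - e ^+ 2 / 16) * a = l%:R * ((1 - e ^+ 2 / 16) * (s2 * th ^+ 2 / 2)).
    by rewrite /a; ring.
  by rewrite expRM_natl lerXn2r ?nnegrE ?expR_ge0// (le_trans (expR_ge0 _) lo).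
- have m0 : 0 <= (1 + e) * th by rewrite mulr_ge0 ?addr_ge0// ltW.
  have tn : `|(1 + e) * th| <= th1.
    by rewrite ger0_norm// (le_trans _ th2)// ler_wpM2r ?(ltW th0)//; lra.
  have [_ lo up] := hth _ tn.
  apply: (@le_trans _ _ (expR (l%:R * ((1 + e ^+ 2 / 16) * (s2 * ((1 + e) * th) ^+ 2 / 2))) * expR (- (e * (1 + e) * th * c)))).
    rewrite ler_wpM2r ?expR_ge0// expRM_natl lerXn2r ?nnegrE ?expR_ge0//.
    exact: le_trans (expR_ge0 _) lo.
  rewrite -expRD ler_expR.
  have -> : l%:R * ((1 + e ^+ 2 / 16) * (s2 * ((1 + e) * th) ^+ 2 / 2)) - e * (1 + e) * th * c
     = ((1 + e ^+ 2 / 16) * (1 + e) ^+ 2 - 2 * e * (1 + e)) * a.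
    by rewrite -[_ * th * c]mulrA thc /a; field.
  rewrite ler_wpM2r//.
  have q0 : 0 <= (1 - e) * (3 + e) by rewrite mulr_ge0 ?subr_ge0// addr_ge0// ltW.
  by have := mulr_ge0 (sqr_ge0 e) q0; lra.
- have m0 : 0 <= (1 - e) * th by rewrite mulr_ge0 ?subr_ge0// ltW.
  have tn : `|(1 - e) * th| <= th1.
    by rewrite ger0_norm// (le_trans _ th2)// ler_wpM2r ?(ltW th0)//; lra.
  have [_ lo up] := hth _ tn.
  apply: (@le_trans _ _ (expR (l%:R * ((1 + e ^+ 2 / 16) * (s2 * ((1 - e) * th) ^+ 2 / 2))) * expR (e * (1 - e) * th * c))).
    rewrite ler_wpM2r ?expR_ge0// expRM_natl lerXn2r ?nnegrE ?expR_ge0//.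
    exact: le_trans (expR_ge0 _) lo.
  rewrite -expRD ler_expR.
  have -> : l%:R * ((1 + e ^+ 2 / 16) * (s2 * ((1 - e) * th) ^+ 2 / 2)) + e * (1 - e) * th * c
     = ((1 + e ^+ 2 / 16) * (1 - e) ^+ 2 + 2 * e * (1 - e)) * a.
    by rewrite -[_ * th * c]mulrA thc /a; field.
  rewrite ler_wpM2r//.
  have q0 : 0 <= (1 + e) * (3 - e) by rewrite mulr_ge0 ?subr_ge0 ?addr_ge0 ?(ltW e0)//; lra.
  by have := mulr_ge0 (sqr_ge0 e) q0; lra.
- by congr expR; rewrite -mulrA thc; ring.
Qed.

Lemma phi_upper : exists2 th1, 0 < th1 & forall th, `|th| <= th1 ->
  (\int[P]_w (expR (th * omega 1%N w))%:E <= (expR (s2 * th ^+ 2))%:E)%E.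
Proof.
have [th1 th10 hth] := phi_bounds ltr01 (lexx _).
exists th1 => // th /hth [-> _ h]; rewrite lee_fin (le_trans h)//.
by rewrite ler_expR le_eqVlt; apply/orP; left; apply/eqP; field.
Qed.

Variable alpha : R.
Hypotheses (al0 : 0 < alpha) (al1 : alpha < 1 / 2).

Lemma near_small_powR (k c : R) : 0 < c -> \forall x \near +oo, k * x `^ (- alpha) <= c.
Proof.
move=> c0; near=> x; have x0 : 0 < x by [].
rewrite powRN ler_pdivrMr ?powR_gt0// mulrC -ler_pdivrMr//.
by near: x; exact: near_powR_ge.
Unshelve. all: by end_near.
Qed.

Lemma as_lln1 (e : R) : 0 < e -> {ae P, forall w, \forall x \near \oo,
  ~ (e * x%:R `^ (1 - alpha) < `|wsum (fun i => omega i w) x|)}.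
Proof.
move=> e0; apply: ae_eventually_not.
have [th1 th10 hth] := phi_upper.
(* The maximiser of k e - s2 k^2, with maximum c = e^2 / (4 s2). The Chernoff exponent becomes c
   x^(1 - 2 alpha), a positive power since alpha < 1 / 2. *)
pose k := e / (2 * s2); have k0 : 0 < k by rewrite divr_gt0// mulr_gt0.
pose c := e ^+ 2 / (4 * s2); have c0 : 0 < c by rewrite divr_gt0 ?exprn_gt0// mulr_gt0.
have kap : 0 < 1 - 2 * alpha by move: al1; lra.
have N1 := near_natr (near_small_powR k th10).
have N2 := near_natr (near_exp_powR_ge 2 2 c0 kap).
near=> x.
have x1 : 1 <= x%:R :> R by rewrite ler1n; near: x; exact: nbhs_infty_ge.
have x0 : 0 < x%:R :> R by apply: lt_le_trans x1.
have thle : k * x%:R `^ (- alpha) <= th1 by near: x.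
have ale : 2 * x%:R ^+ 2 <= expR (c * x%:R `^ (1 - 2 * alpha)) by near: x.
set th := k * _ in thle.
have th0 : 0 <= th by rewrite mulr_ge0 ?powR_ge0// ltW.
set a := c * _ in ale.
have ae2 : expR (- a) <= 2^-1 * x%:R ^- 2.
  by rewrite -invfM expRN lef_pV2 ?posrE ?expR_gt0 ?mulr_gt0 ?exprn_gt0.
have pE : x%:R `^ (1 - alpha) * x%:R `^ (- alpha) = x%:R `^ (1 - 2 * alpha).
  rewrite -powRD; last by rewrite (gt_eqF x0) implybT.
  by congr (_ `^ _); ring.
have pE2 : x%:R * (x%:R `^ (- alpha)) ^+ 2 = x%:R `^ (1 - 2 * alpha).
  rewrite -pE powRD; last by rewrite (gt_eqF x0) implybT.
  by rewrite powRr1 ?(ltW x0)// expr2 mulrA.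
have aE : th * (e * x%:R `^ (1 - alpha)) - x%:R * (s2 * th ^+ 2) = a.
  have -> : x%:R * (s2 * th ^+ 2) = s2 * k ^+ 2 * (x%:R * (x%:R `^ (- alpha)) ^+ 2).
    by rewrite /th; ring.
  have -> : th * (e * x%:R `^ (1 - alpha)) = k * e * (x%:R `^ (1 - alpha) * x%:R `^ (- alpha)).
    by rewrite /th; ring.
  rewrite pE pE2 /a /c /k; field.
  by rewrite gt_eqF.
have V (sg : R) : `|sg| = 1 -> exists D : set Omega, [/\ measurable D,
    (P D <= (expR (- a))%:E)%E &
    forall w, e * x%:R `^ (1 - alpha) < sg * wsum (fun i => omega i w) x -> D w].
  move=> sg1.
  have hv i : (0 < i <= 0 + x)%N ->
     (\int[P]_w (expR (sg * th * omega 1%N w))%:E <= (expR (s2 * th ^+ 2))%:E)%E.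
    move=> _; have := hth (sg * th); rewrite normrM sg1 mul1r ger0_norm// => /(_ thle).
    by rewrite exprMn -(real_normK (num_real sg)) sg1 expr1n mul1r.
  have [D [mD PD hD]] := exp_ville hindep hident (x := 0) a hv.
  exists D; split => // w hw; apply: (hD w x); rewrite ?add0n//.
  rewrite sumrB sumr_const_nat subn1/= -mulr_sumr -[X in _ - X]mulr_natl -aE.
  rewrite lerD2r [sg * th]mulrC -[leRHS]mulrA ler_wpM2l//.
  exact: ltW.
have [D1 [mD1 PD1 h1]] := V 1 (normr1 _).
have [D2 [mD2 PD2 h2]] := V (-1) (normrN1 _).
exists (D1 `|` D2); split; first exact: measurableU.
  apply: (le_trans (measureU2 _ mD1 mD2)).
  apply: (le_trans (leeD PD1 PD2)); rewrite -EFinD lee_fin.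
  by have := lerD ae2 ae2; rewrite -mulrDl; lra.
move=> w; rewrite lter_normr => /orP[h|h]; [left; apply: h1|right; apply: h2].
  by rewrite mul1r.
by rewrite mulN1r.
Unshelve. all: by end_near.
Qed.

Lemma as_lln : {ae P, forall w, forall e, 0 < e -> \forall x \near \oo,
  `|wsum (fun i => omega i w) x| <= e * x%:R `^ (1 - alpha)}.
Proof.
have k0 (k : nat) : 0 < k.+1%:R^-1 :> R by rewrite invr_gt0.
have := ae_foralln (fun k => as_lln1 (k0 k)).
apply: filterS => w h e e0.
have [k ke] : exists k : nat, k.+1%:R^-1 <= e.
  by exists (Num.truncn e^-1); rewrite invf_ple ?posrE// ltW// truncnS_gt.
apply: filterS (h k) => x /negP; rewrite -leNgt => /le_trans; apply.
by rewrite ler_wpM2r// powR_ge0.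
Qed.

End EnvironmentLln.

(** * The largest rises of the potential *)

Section EnvironmentPotential.
Context {R : realType} {d : measure_display} {Omega : measurableType d}.
Variable P : probability Omega R.
Variable omega : nat -> {RV P >-> R}.
Hypothesis hindep : mutually_independent P [set x | (1 <= x)%N]
                (fun x => omega x : Omega -> R).
Hypothesis hident : forall x : nat, (1 <= x)%N ->
  identically_distributed (omega x) (omega 1%N).
Local Notation phi := (mgf (omega 1%N)).
Variable s2 : R.
Hypothesis s20 : 0 < s2.
Hypothesis phi_bounds : forall dl, 0 < dl -> dl <= 1 -> exists2 th1, 0 < th1 &
  forall th, `|th| <= th1 -> [/\
    (\int[P]_w (expR (th * omega 1%N w))%:E = (phi th)%:E)%E,
    expR ((1 - dl) * (s2 * th ^+ 2 / 2)) <= phi th &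
    phi th <= expR ((1 + dl) * (s2 * th ^+ 2 / 2))].

Variables (b alpha A : R).
Hypotheses (b0 : 0 < b) (al0 : 0 < alpha) (al1 : alpha < 1 / 2) (A0 : 0 < A).
Hypothesis AE : 2 * b * A = (1 - 2 * alpha) * s2.
Let H := barrier A alpha.
Let V w := potential b alpha (fun i => omega i w).

Lemma potential_diff w (x z : nat) : (x <= z)%N ->
  V w z - V w x = \sum_(x.+1 <= i < z.+1) (omega i w - b * i%:R `^ (- alpha)).
Proof.
by move=> xz; rewrite /V /potential (@big_cat_nat _ _ _ x.+1 1 z.+1)//= addrAC subrr add0r.
Qed.

Let kap0 : 0 < 1 - 2 * alpha. Proof. by move: al1; lra. Qed.

Let powR_split (x : R) : 0 < x -> x `^ (- alpha) * x `^ alpha = 1.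
Proof. by move=> x0; rewrite powRN mulVf// gt_eqF// powR_gt0. Qed.

(** The tilt is slightly below the critical 2 b x^(-alpha) / s2, so that exp (th (V z - V x)) is a
    supermartingale up to (1 + e) x. The factor rho pays twice for 1 + e: for the error in the
    moment generating function and for the weakening of the drift between x and (1 + e) x. *)
Lemma single_barrier (dl : R) : 0 < dl -> dl <= 1 -> \forall x \near \oo,
  exists D : set Omega, [/\ measurable D,
    (P D <= (expR (- ((1 + dl / 4) * (1 - 2 * alpha) * ln x%:R)))%:E)%E &
    forall w z, (x <= z)%N -> z%:R <= (1 + dl / 8) * x%:R ->
      (1 + dl) * H x%:R <= V w z - V w x -> D w].
Proof.
move=> dl0 dl1; pose e := dl / 8.
have e0 : 0 < e by rewrite divr_gt0.
have e1 : e <= 1 by rewrite /e; lra.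
have [th1 th10 hth] := phi_bounds e0 e1.
pose rho := ((1 + e) * (1 + e))^-1.
have e10 : 0 < 1 + e by rewrite addr_gt0.
have rho0 : 0 < rho by rewrite invr_gt0 mulr_gt0.
have rhod : (1 + dl / 4) <= rho * (1 + dl).
  rewrite ler_pdivlMl ?mulr_gt0// /e; have := mulr_ge0 (ltW dl0) (_ : 0 <= 1 - dl).
  rewrite subr_ge0 => /(_ dl1) h.
  have : dl * dl * dl <= dl * dl.
    by rewrite ler_piMr// mulr_ge0// ltW.
  by move: h; nra.
pose k := rho * 2 * b / s2.
have k0 : 0 < k by rewrite divr_gt0// !mulr_gt0.
have N1 := near_natr (near_small_powR al0 k th10).
near=> x.
have x1 : 1 <= x%:R :> R by rewrite ler1n; near: x; exact: nbhs_infty_ge.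
have x0 : 0 < x%:R :> R by apply: lt_le_trans x1.
have thle : k * x%:R `^ (- alpha) <= th1 by near: x.
set th := k * _ in thle.
have th0 : 0 < th by rewrite mulr_gt0 ?powR_gt0.
pose K := Num.truncn (e * x%:R).
pose a := th * ((1 + dl) * H x%:R).
have xx := powR_split x0.
have aE : a = rho * (1 + dl) * ((1 - 2 * alpha) * ln x%:R).
  have -> : a = (2 * b * A) * (rho * (1 + dl) / s2) * (x%:R `^ (- alpha) * x%:R `^ alpha) * ln x%:R.
    by rewrite /a /th /k /H /barrier; field; rewrite gt_eqF.
  by rewrite AE xx; field; rewrite gt_eqF.
have hv i : (x < i <= x + K)%N ->
   (\int[P]_w (expR (th * omega 1%N w))%:E <= (expR (th * (b * i%:R `^ (- alpha))))%:E)%E.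
  move=> /andP[xi iK]; have [|-> _ up] := hth th; first by rewrite gtr0_norm.
  rewrite lee_fin (le_trans up)// ler_expR.
  have i0 : 0 < i%:R :> R by rewrite ltr0n (leq_trans _ xi).
  have ix : i%:R <= (1 + e) * x%:R.
    have /truncn_itv/andP[Ke _] : 0 <= e * x%:R by rewrite mulr_ge0// ltW.
    rewrite mulrDl mul1r; apply: (@le_trans _ _ (x + K)%:R); first by rewrite ler_nat.
    by rewrite natrD lerD2l.
  have ia : x%:R `^ (- alpha) <= (1 + e) * i%:R `^ (- alpha).
    rewrite !powRN ler_pdivlMr ?powR_gt0// mulrC ler_pdivrMr ?powR_gt0//.
    apply: (@le_trans _ _ (((1 + e) * x%:R) `^ alpha)).
      by apply: ge0_ler_powR; rewrite ?nnegrE ?(ltW al0) ?(ltW i0) ?mulr_ge0 ?(ltW e10).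
    rewrite powRM ?(ltW e10)// ler_wpM2r ?powR_ge0// ler1_powR ?lerDl ?(ltW e0)//.
    by move: al1; lra.
  have -> : (1 + e) * (s2 * th ^+ 2 / 2) = th * (b * ((1 + e)^-1 * x%:R `^ (- alpha))).
    by rewrite /th /k /rho; field; rewrite !gt_eqF.
  rewrite ler_wpM2l ?(ltW th0)// ler_wpM2l ?(ltW b0)//.
  by rewrite ler_pdivrMl.
have [D [mD PD hD]] := exp_ville hindep hident a hv.
exists D; split => //.
  apply: (le_trans PD); rewrite lee_fin ler_expR lerN2 aE -mulrA ler_wpM2r//.
  by rewrite mulr_ge0 ?ln_ge0// ltW.
move=> w z xz zx hw; apply: (hD w (z - x)%N).
  rewrite truncn_ge_nat; last by rewrite mulr_ge0// ltW.
  by rewrite natrB// lerBlDr; move: zx; rewrite -/e mulrDl mul1r addrC.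
rewrite subnKC//.
have -> : \sum_(x.+1 <= i < z.+1) (th * omega i w - th * (b * i%:R `^ (- alpha))) =
   th * (V w z - V w x).
  by rewrite potential_diff// mulr_sumr; apply: eq_bigr => i _; rewrite mulrBr.
by rewrite /a ler_wpM2l// ltW.
Unshelve. all: by end_near.
Qed.

(** Over x^(2 alpha) steps both the drift and the typical fluctuation of V are of order x^alpha,
    smaller than H(x) by a logarithm. *)
Lemma inner_block (dl : R) : 0 < dl -> \forall x \near \oo, forall L : nat,
  L%:R <= x%:R `^ (2 * alpha) ->
  exists D : set Omega, [/\ measurable D,
    (P D <= (expR (- (2 * ln x%:R)))%:E)%E &
    forall w y, (x <= y)%N -> (y <= x + L)%N ->
      dl * H x%:R <= V w x - V w y -> D w].
Proof.
move=> dl0; have [th1 th10 hth] := phi_upper phi_bounds.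
(* With th = k x^(-alpha), th dl H(x) is exactly 3 ln x; drift and variance cost at most the
   constant C, so for C <= ln x an exponent of 2 ln x remains. *)
pose k := 3 / (dl * A).
have k0 : 0 < k by rewrite divr_gt0// mulr_gt0.
pose C := k * b + s2 * k ^+ 2.
have N1 := near_natr (near_small_powR al0 k th10).
have N2 := near_natr (near_ln_ge C).
near=> x => L hL.
have x1 : 1 <= x%:R :> R by rewrite ler1n; near: x; exact: nbhs_infty_ge.
have x0 : 0 < x%:R :> R by apply: lt_le_trans x1.
have thle : k * x%:R `^ (- alpha) <= th1 by near: x.
have Cle : C <= ln x%:R by near: x.
set th := k * _ in thle.
have th0 : 0 < th by rewrite mulr_gt0 ?powR_gt0.
pose a := 3 * ln x%:R - C.
have hv i : (x < i <= x + L)%N ->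
   (\int[P]_w (expR (- th * omega 1%N w))%:E <= (expR (s2 * th ^+ 2))%:E)%E.
  by move=> _; rewrite -[th ^+ 2]sqrrN; apply: hth; rewrite normrN gtr0_norm.
have [D [mD PD hD]] := exp_ville hindep hident a hv.
exists D; split => //.
  by apply: (le_trans PD); rewrite lee_fin ler_expR lerN2 /a; lra.
move=> w y xy yL hw; apply: (hD w (y - x)%N); first by rewrite leq_subLR.
rewrite subnKC//.
rewrite sumrB sumr_const_nat subSS -mulr_sumr -[X in _ - X]mulr_natl.
have xx := powR_split x0.
have yx : (y - x)%:R <= x%:R `^ (2 * alpha) :> R.
  by apply: le_trans hL; rewrite ler_nat leq_subLR.
have p2 : x%:R `^ (2 * alpha) * x%:R `^ (- alpha) = x%:R `^ alpha :> R.
  by rewrite -powRD ?(gt_eqF x0) ?implybT//; congr (_ `^ _); ring.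
have dr : V w x - V w y = - (\sum_(x.+1 <= i < y.+1) omega i w) +
    b * \sum_(x.+1 <= i < y.+1) i%:R `^ (- alpha).
  by rewrite -opprB potential_diff// sumrB -mulr_sumr; ring.
have sle : \sum_(x.+1 <= i < y.+1) i%:R `^ (- alpha) <= x%:R `^ alpha :> R.
  apply: (@le_trans _ _ (\sum_(x.+1 <= i < y.+1) x%:R `^ (- alpha))).
    rewrite big_nat [leRHS]big_nat; apply: ler_sum => i /andP[xi _].
    have i0 : (0 < i)%N by rewrite (leq_trans _ xi).
    have xn0 : (0 < x)%N by rewrite -(ltr0n R).
    rewrite !powRN lef_pV2 ?posrE ?powR_gt0 ?ltr0n//.
    by apply: powR_natr_mono; [exact: ltW|exact: ltnW].
  by rewrite sumr_const_nat subSS -[leLHS]mulr_natl -p2 ler_wpM2r ?powR_ge0.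
move: hw; rewrite dr; set S := \sum_(_ <= i < _) omega i w => hw.
have h1 : dl * H x%:R - b * x%:R `^ alpha <= - S.
  by have := ler_wpM2l (ltW b0) sle; lra.
have h2 := ler_wpM2l (ltW th0) h1.
have e1 : th * (dl * H x%:R - b * x%:R `^ alpha) = 3 * ln x%:R - k * b.
  have -> : th * (dl * H x%:R - b * x%:R `^ alpha) =
     (k * dl * A * ln x%:R - k * b) * (x%:R `^ (- alpha) * x%:R `^ alpha).
    by rewrite /th /H /barrier; ring.
  by rewrite xx mulr1 /k; field; rewrite !gt_eqF.
have h3 : (y - x)%:R * (s2 * th ^+ 2) <= s2 * k ^+ 2.
  have -> : s2 * k ^+ 2 = x%:R `^ (2 * alpha) * (s2 * th ^+ 2).
    have -> : x%:R `^ (2 * alpha) * (s2 * th ^+ 2) =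
      s2 * k ^+ 2 * (x%:R `^ (- alpha) * (x%:R `^ (2 * alpha) * x%:R `^ (- alpha))).
      by rewrite /th; ring.
    by rewrite p2 xx mulr1.
  by rewrite ler_wpM2r// mulr_ge0 ?sqr_ge0// ltW.
rewrite /a /C; move: h2 h3; rewrite e1 mulrN mulNr; lra.
Unshelve. all: by end_near.
Qed.

Lemma near_dyadic (Q : nat -> Prop) :
  (\forall x \near \oo, Q x) -> \forall k \near \oo, forall x, (2 ^ k <= x)%N -> Q x.
Proof.
move=> [N _ hN]; exists N => // k /= Nk x kx; apply: hN => /=.
by rewrite (leq_trans Nk)// (leq_trans _ kx)// ltnW// ltn_expl.
Qed.

(* A block of length L <= x^(2 alpha) starting at x costs the same up to constants
   as its starting point alone, so only about X^(1 - 2 alpha) points of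
   [X, 2 X) enter the union bound. *)
Lemma dyadic_barrier (dl : R) : 0 < dl -> dl <= 1 ->
  {ae P, forall w, \forall k \near \oo, ~ (exists y z : nat,
    [/\ (2 ^ k <= y)%N, (y < 2 ^ k.+1)%N, (y <= z)%N, z%:R <= (1 + dl / 16) * y%:R &
        (1 + 2 * dl) * H y%:R < V w z - V w y])}.
Proof.
move=> dl0 dl1; apply: ae_eventually_not.
have S := near_dyadic (single_barrier dl0 dl1).
have I := near_dyadic (inner_block dl0).
have dl32 : 0 < dl / 32 by rewrite divr_gt0.
have al21 : 2 * alpha < 1 by move: al1; lra.
have B := near_dyadic (near_natr (near_powR_ge (dl / 32)^-1 kap0)).
pose c := dl / 4 * (1 - 2 * alpha) * ln 2.
have ln20 : 0 < ln 2 :> R by rewrite ln_gt0// ltr1n.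
have c0 : 0 < c by rewrite !mulr_gt0.
have E := near_natr (near_exp_powR_ge 2 6 c0 ltr01).
near=> k.
pose X := (2 ^ k)%N; pose XR : R := X%:R.
have X1 : 1 <= XR by rewrite ler1n expn_gt0.
have X0 : 0 < XR := lt_le_trans ltr01 X1.
pose L := Num.truncn (XR `^ (2 * alpha)).
have p1 : 1 <= XR `^ (2 * alpha).
  by rewrite -[leLHS](powRr0 XR) ler_powR// mulr_ge0// ltW.
have L1 : (0 < L)%N by rewrite truncn_ge_nat// powR_ge0.
have /truncn_itv/andP[Lle Lgt] := powR_ge0 XR (2 * alpha).
pose N := (X %/ L).+1.
pose x i := (X + i * L)%N.
have Xx i : (X <= x i)%N by rewrite leq_addr.
have xL i : L%:R <= (x i)%:R `^ (2 * alpha) :> R.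
  apply: (le_trans Lle); apply: powR_natr_mono => //.
  by rewrite mulr_ge0// ltW.
have Sk : forall y, (2 ^ k <= y)%N -> exists D : set Omega, [/\ measurable D,
    (P D <= (expR (- ((1 + dl / 4) * (1 - 2 * alpha) * ln y%:R)))%:E)%E &
    forall w z, (y <= z)%N -> z%:R <= (1 + dl / 8) * y%:R ->
      (1 + dl) * H y%:R <= V w z - V w y -> D w] by near: k.
have Ik : forall y, (2 ^ k <= y)%N -> forall L : nat,
  L%:R <= y%:R `^ (2 * alpha) ->
  exists D : set Omega, [/\ measurable D,
    (P D <= (expR (- (2 * ln y%:R)))%:E)%E &
    forall w u, (y <= u)%N -> (u <= y + L)%N ->
      dl * H y%:R <= V w y - V w u -> D w] by near: k.
have Bk : forall y, (2 ^ k <= y)%N -> (dl / 32)^-1 <= y%:R `^ (1 - 2 * alpha) by near: k.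
have Ek : 6 * k%:R ^+ 2 <= expR (c * k%:R `^ 1) by near: k.
have /choice[D hD] : forall i : nat, exists D : set Omega, [/\ measurable D,
    (P D <= (2 * expR (- ((1 + dl / 4) * (1 - 2 * alpha) * ln XR)))%:E)%E &
    forall w y z, (x i <= y)%N -> (y <= x i + L)%N -> (y <= z)%N ->
      z%:R <= (1 + dl / 8) * (x i)%:R ->
      (1 + 2 * dl) * H y%:R < V w z - V w y -> D w].
  move=> i.
  have [D1 [mD1 PD1 h1]] := Sk _ (Xx i).
  have [D2 [mD2 PD2 h2]] := Ik _ (Xx i) L (xL i).
  have lnX : ln XR <= ln (x i)%:R.
    by rewrite ler_ln ?posrE// ?ler_nat// (lt_le_trans X0)// ler_nat.
  have lnX0 : 0 <= ln XR by rewrite ln_ge0.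
  exists (D1 `|` D2); split; first exact: measurableU.
    apply: (le_trans (measureU2 _ mD1 mD2)); apply: (le_trans (leeD PD1 PD2)).
    rewrite -EFinD lee_fin [leRHS]mulr_natl mulr2n; apply: lerD; rewrite ler_expR lerN2.
      by rewrite ler_wpM2l// mulr_ge0 ?(ltW kap0)// addr_ge0// ltW// divr_gt0.
    apply: (@le_trans _ _ (2 * ln XR)); last by rewrite ler_wpM2l.
    rewrite ler_wpM2r//; have : (1 + dl / 4) * (1 - 2 * alpha) <= (1 + 1) * 1.
      apply: ler_pM; [by rewrite addr_ge0// ltW// divr_gt0|exact: ltW| |].
        by move: dl0 dl1; lra.
      by rewrite gerBl mulr_ge0// ltW.
    by rewrite mulr1 => /le_trans; apply.
  move=> w y z xy yL yz zx hw.
  (* A rise above (1 + 2 dl) H(y) from y is either a rise of (1 + dl) H from the start of the block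
     or comes with a fall of dl H inside the block. *)
  have [h|h] := leP ((1 + dl) * H (x i)%:R) (V w z - V w (x i)).
    by left; apply: h1 h => //; exact: leq_trans yz.
  right; apply: (h2 w y) => //.
  have x1 : 1 <= (x i)%:R :> R by rewrite ler1n (leq_trans _ (Xx i))// expn_gt0.
  have Hm : H (x i)%:R <= H y%:R by apply: barrier_mono => //; rewrite ler_nat.
  have := ler_wpM2l (_ : 0 <= 1 + 2 * dl) Hm.
  rewrite addr_ge0 ?mulr_ge0 ?(ltW dl0)// => /(_ isT).
  by move: h hw; lra.
have mD i : measurable (D i) by have [] := hD i.
exists (\big[setU/set0]_(i < N) D i); split.
- exact: bigsetU_measurable.
- apply: (le_trans (Boole_inequality P (fun i _ => mD i))).
  apply: (@le_trans _ _ (\sum_(i < N) (2 * expR (- ((1 + dl / 4) * (1 - 2 * alpha) * ln XR)))%:E)%E).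
    by apply: lee_sum => i _; have [] := hD i.
  rewrite sumEFin lee_fin sumr_const card_ord -[leLHS]mulr_natl.
  have Nle : N%:R <= 3 * XR `^ (1 - 2 * alpha).
    rewrite /N -natr1.
    have q1 : 1 <= XR `^ (1 - 2 * alpha).
      by rewrite -[leLHS](powRr0 XR) ler_powR// ltW.
    suff : (X %/ L)%:R <= 2 * XR `^ (1 - 2 * alpha) by lra.
    have L0 : 0 < L%:R :> R by rewrite ltr0n.
    rewrite -(ler_pM2r L0) -natrM.
    apply: (@le_trans _ _ XR); first by rewrite ler_nat leq_trunc_div.
    have XE : XR = XR `^ (1 - 2 * alpha) * XR `^ (2 * alpha).
      by rewrite -powRD ?(gt_eqF X0) ?implybT// subrK powRr1// ltW.
    rewrite {1}XE mulrAC [leRHS]mulrC; apply: ler_wpM2l; first exact: powR_ge0.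
    have : 1 <= L%:R :> R by rewrite ler1n.
    by move: Lgt; rewrite -natr1; lra.
  apply: (@le_trans _ _ (3 * XR `^ (1 - 2 * alpha) * (2 * expR (- ((1 + dl / 4) * (1 - 2 * alpha) * ln XR))))).
    by rewrite ler_wpM2r// mulr_ge0// expR_ge0.
  have -> : XR `^ (1 - 2 * alpha) = expR ((1 - 2 * alpha) * ln XR).
    by rewrite /powR gt_eqF.
  (* The number X^(1 - 2 alpha) of blocks cancels against the leading part of the probability. What
     remains is a small negative power of X = 2^k, hence exponentially small in k. *)
  have -> : 3 * expR ((1 - 2 * alpha) * ln XR) * (2 * expR (- ((1 + dl / 4) * (1 - 2 * alpha) * ln XR)))
     = 6 * expR (- (dl / 4 * (1 - 2 * alpha) * ln XR)).
    rewrite mulrACA -expRD; congr (_ * expR _); ring.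
  have -> : dl / 4 * (1 - 2 * alpha) * ln XR = c * k%:R `^ 1.
    rewrite /XR /X natrX lnXn// powRr1// /c -[ln 2 *+ k]mulr_natl; ring.
  rewrite expRN ler_pdivrMr ?expR_gt0// mulrC.
  have [k0|k0] := posnP k; last first.
    by rewrite ler_pdivlMr// exprn_gt0// ltr0n.
  exfalso; have : (0 < k)%N by near: k; exact: nbhs_infty_gt.
  by rewrite k0.
move=> w [y [z [yX yX2 yz zy hw]]].
pose i := ((y - X) %/ L)%N.
have iN : (i < N)%N.
  rewrite /N ltnS leq_div2r// leq_subLR addnn -mul2n -expnS.
  exact: ltnW.
have xy : (x i <= y)%N by rewrite /x -(subnKC yX) leq_add2l -/X leq_trunc_div.
have yxL : (y <= x i + L)%N.
  rewrite /x -(subnKC yX) -addnA leq_add2l -/X -[X in (_ <= _ + X)%N]mul1n -mulnDl addn1.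
  by rewrite ltnW// ltn_ceil.
have Dw : D i w.
  have [_ _ h] := hD i; apply: (h w y z) => //.
  apply: (le_trans zy).
  have Bx := Bk _ (Xx i).
  have x0 : 0 < (x i)%:R :> R by rewrite (lt_le_trans X0)// ler_nat.
  have Lx : L%:R <= dl / 32 * (x i)%:R.
    apply: (le_trans (xL i)).
    have {2}-> : (x i)%:R = (x i)%:R `^ (1 - 2 * alpha) * (x i)%:R `^ (2 * alpha) :> R.
      by rewrite -powRD ?(gt_eqF x0) ?implybT// subrK powRr1// ltW.
    rewrite mulrA ler_peMl ?powR_ge0//.
    by rewrite -ler_pdivrMl// mulr1.
  have yx : y%:R <= (x i)%:R + dl / 32 * (x i)%:R.
    apply: (@le_trans _ _ (x i + L)%:R); first by rewrite ler_nat.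
    by rewrite natrD lerD2l.
  apply: (@le_trans _ _ ((1 + dl / 16) * ((x i)%:R + dl / 32 * (x i)%:R))).
    by rewrite ler_wpM2l// addr_ge0// divr_ge0// ltW.
  have -> : (1 + dl / 16) * ((x i)%:R + dl / 32 * (x i)%:R) =
    ((1 + dl / 16) * (1 + dl / 32)) * (x i)%:R by ring.
  rewrite ler_wpM2r// ?ltW//; have : dl * dl <= dl * 1 by rewrite ler_wpM2l// ltW.
  by lra.
by rewrite -bigcup_mkord; exists i.
Unshelve. all: by end_near.
Qed.

(** For z beyond (1 + dl / 16) y the potential has already fallen below V y by [potential_drop]; for
    nearer z, apply [dyadic_barrier] to the dyadic block of y. *)
Lemma as_barrier : {ae P, forall w, forall e, 0 < e -> \forall y \near \oo,
  forall z, (y <= z)%N -> V w z - V w y <= (1 + e) * H y%:R}.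
Proof.
have k0 (k : nat) : 0 < k.+1%:R^-1 :> R by rewrite invr_gt0.
have k1 (k : nat) : k.+1%:R^-1 <= 1 :> R by rewrite invf_le1// ler1n.
have a1 := ae_foralln (fun k => dyadic_barrier (k0 k) (k1 k)).
have a2 := as_lln hindep hident s20 phi_bounds al0 al1.
apply: filterS2 a1 a2 => w h lln e e0.
pose m := Num.truncn (e / 2)^-1; pose dl : R := m.+1%:R^-1.
have dle : 2 * dl <= e.
  have e20 : 0 < e / 2 by rewrite divr_gt0.
  have : dl <= e / 2 by rewrite invf_ple ?posrE// ltW// truncnS_gt.
  lra.
have dl0 : 0 < dl by exact: k0.
have dl16 : 0 < dl / 16 by rewrite divr_gt0.
(* Chosen so that y <= (1 - e') z means z >= (1 + dl / 16) y. *)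
pose e' := 1 - (1 + dl / 16)^-1.
have g1 : 1 < 1 + dl / 16 by rewrite ltrDl.
have g0 : 0 < 1 + dl / 16 by rewrite (lt_trans ltr01).
have e'0 : 0 < e' by rewrite subr_gt0 invf_lt1.
have e'1 : e' < 1 by rewrite ltrBlDr ltrDl invr_gt0.
have [c c0 drop] := potential_drop b0 al0 al1 lln e'0 e'1.
have [K _ hK] := h m.
near=> y => z yz.
have y1 : 1 <= y%:R :> R by rewrite ler1n; near: y; exact: nbhs_infty_ge.
have H0 : 0 <= H y%:R by exact: barrier_ge0.
have [zy|zy] := leP z%:R ((1 + dl / 16) * y%:R); last first.
  have dy : forall z : nat, y%:R <= (1 - e') * z%:R ->
     V w z - V w y <= - (c * z%:R `^ (1 - alpha)) by near: y.
  apply: (le_trans (dy z _)).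
    rewrite /e' opprB addrC subrK mulrC ler_pdivlMr// mulrC.
    exact: ltW.
  apply: (@le_trans _ _ 0); first by rewrite oppr_le0 mulr_ge0 ?powR_ge0// ltW.
  by rewrite mulr_ge0// addr_ge0// ltW.
have y0 : (0 < y)%N by rewrite -(ltr0n R) (lt_le_trans ltr01).
have [k1' k2'] := andP (trunc_log_bounds (leqnn 2) y0).
have Kk : (K <= trunc_log 2 y)%N.
  apply: trunc_log_max => //.
  by near: y; exact: nbhs_infty_ge.
have := hK _ Kk; rewrite leNgt => nbad; apply/negP => bad; apply: nbad.
exists y, z; split => //.
apply: le_lt_trans bad; rewrite ler_wpM2r// lerD2l.
exact: dle.
Unshelve. all: by end_near.
Qed.

Definition block_success (c : R) (m l j : nat) : set Omega :=
  [set w | c <= bsum omega (m + j * l) l w].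

(** Recursive, so that the last block can be split off by independence. *)
Fixpoint no_success (c : R) (m l J : nat) : set Omega :=
  if J is J'.+1 then no_success c m l J' `&` ~` block_success c m l J'
  else setT.

Lemma no_successP c m l J w :
  (forall j, (j < J)%N -> ~ block_success c m l j w) -> no_success c m l J w.
Proof.
elim: J => //= J IH h; split; last exact: h.
by apply: IH => j jJ; apply: h; rewrite ltnS ltnW.
Qed.

Lemma block_success_sigma c m l j : <<s rects omega
  [set i | (m + j * l < i <= m + j * l + l)%N] >> (block_success c m l j).
Proof.
have -> : block_success c m l j = [set: Omega] `&` bsum omega (m + j * l) l @^-1` `[c, +oo[%classic.
  by rewrite setTI; apply/seteqP; split => w /=; rewrite in_itv/= andbT.
exact: (@bsum_depends _ _ _ P omega (m + j * l) l).
Qed.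

Lemma sigma_rects_sub (I1 I2 : set nat) : I1 `<=` I2 ->
  <<s rects omega I1 >> `<=` <<s rects omega I2 >>.
Proof.
move=> I12; apply: sub_smallest2r; first exact: smallest_sigma_algebra.
move=> C [J [B' [JI mB' ->]]]; exists J, B'; split => //.
exact: subset_trans JI I12.
Qed.

Lemma no_success_sigma c m l J : <<s rects omega
  [set i | (m < i <= m + J * l)%N] >> (no_success c m l J).
Proof.
elim: J => [|J IH] /=.
  exact: (@measurableT _ (g_sigma_algebraType (rects omega [set i | (m < i <= m + 0 * l)%N]))).
have s1 : [set i | (m < i <= m + J * l)%N] `<=` [set i | (m < i <= m + J.+1 * l)%N].
  move=> i /= /andP[-> h]; rewrite (leq_trans h)// leq_add2l leq_mul2r.
  by rewrite leqnSn orbT.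
have s2' : [set i | (m + J * l < i <= m + J * l + l)%N] `<=` [set i | (m < i <= m + J.+1 * l)%N].
  move=> i /= /andP[h1 h2]; rewrite (leq_ltn_trans (leq_addr _ _) h1)/=.
  by rewrite mulSnr addnA.
apply: (@measurableI _ (g_sigma_algebraType (rects omega [set i | (m < i <= m + J.+1 * l)%N]))).
  by apply: (sigma_rects_sub s1); exact: IH.
apply: (@measurableC _ (g_sigma_algebraType (rects omega [set i | (m < i <= m + J.+1 * l)%N]))).
by apply: (sigma_rects_sub s2'); exact: block_success_sigma.
Qed.

Lemma no_success_prob c m l J (p : R) : p <= 1 ->
  (forall j, (p%:E <= P (block_success c m l j))%E) ->
  (P (no_success c m l J) <= ((1 - p) ^+ J)%:E)%E.
Proof.
move=> p1 hp; elim: J => [|J IH] /=; first by rewrite expr0; exact: probability_le1.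
have mb : measurable (block_success c m l J).
  by apply: sigma_rects_measurable; exact: block_success_sigma.
rewrite (sigma_rects_indep hindep (I1 := [set i | (m < i <= m + J * l)%N])
  (I2 := [set i | (m + J * l < i <= m + J * l + l)%N])).
- rewrite exprSr EFinM; apply: lee_pmul => //.
  rewrite probability_setC// EFinB; apply: leeB => //.
- by move=> i /= /andP[h _]; rewrite (leq_trans _ h).
- by move=> i /= /andP[h _]; rewrite (leq_trans _ h).
- apply/seteqP; split => i //= [/andP[_ h1] /andP[h2 _]].
  by move: h2; rewrite ltnNge h1.
- exact: no_success_sigma.
- apply: (@measurableC _ (g_sigma_algebraType (rects omega [set i | (m + J * l < i <= m + J * l + l)%N]))).
  exact: block_success_sigma.
Qed.

Lemma block_fits (n m l j : nat) : (j < (n - m - 1) %/ l)%N ->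
  (m + j * l + l < n)%N.
Proof.
move=> jJ; have := leq_trunc_div (n - m - 1) l.
have l0 : (0 < l)%N by case: l jJ.
have : (j.+1 * l <= (n - m - 1) %/ l * l)%N by rewrite leq_mul2r jJ orbT.
have : (0 < j.+1 * l)%N by rewrite muln_gt0 l0.
rewrite -addnA -mulSnr; move: (j.+1 * l)%N ((n - m - 1) %/ l * l)%N => u v.
by move=> ? ? ?; lia.
Qed.

(** Disjoint blocks of the optimal length l, about (1 - dl) H(n) n^alpha / b, fill the part of [0,
    n) above r n, where the drift per site is at most (1 + e) b n^(-alpha). In a successful block
    the sum of omega is about twice the drift, so V gains about l b n^(-alpha). The double negation
    is the form in which [ae_eventually_not] excludes the absence of a valley. *)
Lemma valley_event (dl : R) : 0 < dl -> dl < 1 -> {ae P, forall w,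
  \forall n \near \oo, ~ ~ exists y z : nat, (y <= z < n)%N /\
     (1 - dl) * H n%:R <= V w z - V w y}.
Proof.
move=> dl0 dl1; apply: ae_eventually_not.
(* Makes (1 + 3 e) (1 + 2 e)^2 <= 1 + 12 e = 1 + dl / 2, and (1 + dl / 2) (1 - dl) <= 1 - dl / 2
   then bounds the exponent of a success. *)
pose e := dl / 24.
have e0 : 0 < e by rewrite divr_gt0.
have e24 : e <= 1 / 24 by rewrite /e; lra.
have e1 : e <= 1 by lra.
have e10 : 0 < 1 + e by rewrite addr_gt0.
have [th1 th10 tail] := block_tail hindep hident s20 phi_bounds e0 e1.
pose r := (1 + e)^-1.
have r0 : 0 < r by rewrite invr_gt0.
have r1 : r < 1 by rewrite invf_lt1// ltrDl.
(* A power n^g absorbs the logarithm in l, leaving at least c2 n^(1 - 2 alpha - g) blocks. A success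
   has probability of order n^(-(1 - 4 g') (1 - 2 alpha)) with g' = dl / 8, so p J is at least of
   order n^(3 g), which exceeds 2 ln n. *)
pose g := dl / 8 * (1 - 2 * alpha).
have g0 : 0 < g by rewrite mulr_gt0// divr_gt0.
(* The critical tilt raised by 1 + 2 e, so that the gain 2 (1 - e) (1 + 2 e) exceeds the drift 1 + e
   by at least 1, in units of l b n^(-alpha). *)
pose k := (1 + 2 * e) * 2 * b / s2.
have k0 : 0 < k by rewrite divr_gt0// !mulr_gt0// addr_gt0// mulr_gt0.
pose C1 := (1 - dl) * A / b.
have g2 : 2 * alpha < 2 * alpha + g by rewrite ltrDl.
have al2g : 0 < 2 * alpha + g by rewrite addr_gt0// mulr_gt0.
have half0 : 0 < 2^-1 :> R by rewrite invr_gt0.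
pose q := 1 - (2 * alpha + g).
have q0 : 0 < q.
  have : g <= 1 / 8 * (1 - 2 * alpha) by rewrite /g ler_wpM2r ?(ltW kap0)//; lra.
  by rewrite /q; move: kap0; lra.
pose c2 := (1 - r) / 4.
have c20 : 0 < c2 by rewrite divr_gt0// subr_gt0.
pose c3 := 2^-1 * expR (- 2) * c2.
have c30 : 0 < c3 by rewrite mulr_gt0// mulr_gt0// expR_gt0.
have g30 : 0 < 3 * g by rewrite mulr_gt0.
have c320 : 0 < c3 / 2 by rewrite divr_gt0.
have al20 : 0 < 2 * alpha by rewrite mulr_gt0.
have N1 := near_natr (near_small_powR al0 k th10).
have N2 := near_natr (near_small_powR al20 (2 * b ^+ 2 / s2) ltr01).
have N3 := near_natr (near_ln_ge (8 / (e ^+ 2 * ((1 - dl) * (1 - 2 * alpha))))).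
have N4 := near_natr (near_powR_ln_le C1 g2 half0).
have N5 := near_natr (near_powR_ge 2 al2g).
have N6 := near_natr (near_powR_ge c2^-1 q0).
have N7 := near_natr (near_ln_le_powR g30 c320).
have N8 := near_natr (nbhs_pinfty_ge (num_real (4 / (1 - r)))).
near=> n.
have n1 : 1 <= n%:R :> R by rewrite ler1n; near: n; exact: nbhs_infty_ge.
have n0 : 0 < n%:R :> R by apply: lt_le_trans n1.
have M1 : k * n%:R `^ (- alpha) <= th1 by near: n.
have M2 : 2 * b ^+ 2 / s2 * n%:R `^ (- (2 * alpha)) <= 1 by near: n.
have M3 : 8 / (e ^+ 2 * ((1 - dl) * (1 - 2 * alpha))) <= ln n%:R by near: n.
have M4 : C1 * (n%:R `^ (2 * alpha) * ln n%:R) <= 2^-1 * n%:R `^ (2 * alpha + g) by near: n.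
have M5 : 2 <= n%:R `^ (2 * alpha + g) by near: n.
have M6 : c2^-1 <= n%:R `^ q by near: n.
have M7 : ln n%:R <= c3 / 2 * n%:R `^ (3 * g) by near: n.
have M8 : 4 / (1 - r) <= n%:R by near: n.
set th := k * _ in M1.
have th0 : 0 < th by rewrite mulr_gt0 ?powR_gt0.
have ln0 : 0 <= ln n%:R :> R by rewrite ln_ge0.
pose Hb := (1 - dl) * H n%:R * n%:R `^ alpha / b.
have dl1' : 0 <= 1 - dl by rewrite subr_ge0 ltW.
have Hb0 : 0 <= Hb.
  by rewrite /Hb !mulr_ge0 ?powR_ge0// ?invr_ge0 ?(ltW b0)// ?(ltW A0).
have HbE : Hb = C1 * (n%:R `^ (2 * alpha) * ln n%:R).
  have -> : n%:R `^ (2 * alpha) = n%:R `^ alpha * n%:R `^ alpha :> R.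
    by rewrite -powRD ?(gt_eqF n0) ?implybT//; congr (_ `^ _); ring.
  by rewrite /Hb /C1 /H /barrier; ring.
pose l := (Num.truncn Hb).+1.
have /truncn_itv/andP[lle lgt] := Hb0.
have {}lgt : Hb < l%:R := lgt.
have {}lle : l%:R <= Hb + 1 by rewrite /l -natr1 lerD2r.
pose a : R := l%:R * (s2 * th ^+ 2 / 2).
have xx := powR_split n0.
have n2al : n%:R `^ (- (2 * alpha)) = n%:R `^ (- alpha) * n%:R `^ (- alpha) :> R.
  by rewrite -powRD ?(gt_eqF n0) ?implybT//; congr (_ `^ _); ring.
have thE : s2 * th ^+ 2 / 2 = (1 + 2 * e) ^+ 2 * (2 * b ^+ 2 / s2 * n%:R `^ (- (2 * alpha))).
  by rewrite n2al /th /k; field; rewrite gt_eqF.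
have HbaE : Hb * (2 * b ^+ 2 / s2 * n%:R `^ (- (2 * alpha))) = (1 - dl) * ((1 - 2 * alpha) * ln n%:R).
  have -> : Hb * (2 * b ^+ 2 / s2 * n%:R `^ (- (2 * alpha))) =
    (1 - dl) * (2 * b * A) / s2 * ln n%:R * (n%:R `^ (- alpha) * n%:R `^ alpha) ^+ 2.
    by rewrite n2al /Hb /H /barrier; field; rewrite !gt_eqF.
  by rewrite xx AE expr1n; field; rewrite gt_eqF.
have w0 : 0 <= 2 * b ^+ 2 / s2 * n%:R `^ (- (2 * alpha)).
  by rewrite mulr_ge0 ?powR_ge0// divr_ge0 ?(ltW s20)// mulr_ge0// exprn_ge0// ltW.
have s1e : 1 <= (1 + 2 * e) ^+ 2 by rewrite exprn_ege1// lerDl mulr_ge0// ltW.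
move: HbaE thE w0 M2; set W := 2 * b ^+ 2 / s2 * _ => HbaE thE w0 M2.
have alo : (1 - dl) * ((1 - 2 * alpha) * ln n%:R) <= a.
  rewrite -HbaE /a thE [leRHS]mulrCA -[leLHS]mul1r.
  apply: ler_pM => //; first exact: mulr_ge0.
  by rewrite ler_wpM2r// ltW.
have aup : a <= (1 + 2 * e) ^+ 2 * ((1 - dl) * ((1 - 2 * alpha) * ln n%:R) + 1).
  rewrite /a thE [leLHS]mulrCA -HbaE ler_wpM2l ?sqr_ge0//.
  apply: (@le_trans _ _ ((Hb + 1) * W)); first by rewrite ler_wpM2r.
  by rewrite mulrDl mul1r lerD2l.
have ea : 8 <= e ^+ 2 * a.
  apply: (@le_trans _ _ (e ^+ 2 * ((1 - dl) * ((1 - 2 * alpha) * ln n%:R)))); last by rewrite ler_wpM2l// sqr_ge0.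
  move: M3; rewrite ler_pdivrMr; last by rewrite !mulr_gt0// ?exprn_gt0// subr_gt0.
  by move=> /le_trans; apply; rewrite le_eqVlt; apply/orP; left; apply/eqP; ring.
pose p := 2^-1 * expR (- ((1 - dl / 2) * ((1 - 2 * alpha) * ln n%:R) + 2)).
have expo : (1 + 3 * e) * a <= (1 - dl / 2) * ((1 - 2 * alpha) * ln n%:R) + 2.
  pose Z := (1 - 2 * alpha) * ln n%:R.
  have Z0 : 0 <= Z by rewrite mulr_ge0// ltW.
  have u0 : 0 <= 1 + 3 * e by rewrite addr_ge0// mulr_ge0// ltW.
  have h1 := ler_wpM2l u0 aup; rewrite -/Z in h1 *.
  have h2 : (1 + 3 * e) * (1 + 2 * e) ^+ 2 <= 1 + dl / 2.
    have : e * e <= e * (1 / 24) by rewrite ler_wpM2l// ltW.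
    have : e * e * e <= e * e * (1 / 24) by rewrite ler_wpM2l// mulr_ge0// ltW.
    have -> : dl / 2 = 12 * e by rewrite /e; field.
    by move: e0; lra.
  have ZZ : 0 <= (1 - dl) * Z + 1 by rewrite addr_ge0// mulr_ge0.
  have h3 := ler_wpM2r ZZ h2.
  have h4 : 0 <= dl * dl * Z by rewrite !mulr_ge0// ltW.
  apply: (le_trans h1); rewrite mulrA; apply: (le_trans h3).
  by move: h4 dl1; lra.
have p0 : 0 < p by rewrite mulr_gt0// expR_gt0.
have p1 : p <= 1.
  rewrite /p; apply: (@le_trans _ _ (1 * 1)); last by rewrite mulr1.
  apply: ler_pM; rewrite ?(ltW half0) ?expR_ge0//; first by rewrite invf_le1 ?ler1n.
  rewrite expR_le1 oppr_le0 addr_ge0// mulr_ge0 ?mulr_ge0 ?(ltW kap0)//.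
  by move: dl1; lra.
pose m := (Num.truncn (r * n%:R)).+1.
have rn0 : 0 <= r * n%:R by rewrite mulr_ge0// ltW.
have /truncn_itv/andP[mle mgt] := rn0.
have {}mgt : r * n%:R < m%:R := mgt.
have {}mle : m%:R <= r * n%:R + 1 by rewrite /m -natr1 lerD2r.
pose c := (1 - e) * (l%:R * s2 * th).
pose J := ((n - m - 1) %/ l)%N.
have hp j : (p%:E <= P (block_success c m l j))%E.
  apply: le_trans (tail th th0 M1 (m + j * l)%N l ea); rewrite lee_fin.
  by rewrite ler_wpM2l ?(ltW half0)// ler_expR lerN2.
exists (no_success c m l J); split.
- by apply: sigma_rects_measurable; exact: no_success_sigma.
- apply: (le_trans (no_success_prob J p1 hp)); rewrite lee_fin.
  have JE : 2 * ln n%:R <= p * J%:R.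
    have nm : 2 * c2 * n%:R <= (n - m - 1)%:R.
      rewrite ler_pdivrMr ?subr_gt0// in M8.
      have mn1 : (m + 1 <= n)%N.
        rewrite -(ler_nat R) natrD; move: mle M8; lra.
      rewrite -subnDA natrB// natrD /c2; move: mle M8; lra.
    have l0 : 0 < l%:R :> R by rewrite ltr0n.
    have ln2 : l%:R <= n%:R `^ (2 * alpha + g).
      by apply: (le_trans lle); rewrite HbE; move: M4 M5; lra.
    have JJ : (n - m - 1)%:R <= (J%:R + 1) * l%:R :> R.
      by rewrite natr1 -natrM ler_nat ltnW// /J ltn_ceil.
    have nE : n%:R = n%:R `^ q * n%:R `^ (2 * alpha + g) :> R.
      by rewrite -powRD ?(gt_eqF n0) ?implybT// subrK powRr1// ltW.
    have J1 : 2 * c2 * n%:R `^ q <= J%:R + 1.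
      have t0 : 0 < n%:R `^ (2 * alpha + g) :> R by rewrite powR_gt0.
      rewrite -(ler_pM2r t0) -[leLHS]mulrA -nE.
      apply: (le_trans nm); apply: (le_trans JJ).
      by rewrite ler_wpM2l// addr_ge0.
    have J2 : c2 * n%:R `^ q <= J%:R.
      have : 1 <= c2 * n%:R `^ q by rewrite -ler_pdivrMl// mulr1.
      by move: J1; lra.
    have pE : p = 2^-1 * expR (- 2) * n%:R `^ (- ((1 - dl / 2) * (1 - 2 * alpha))).
      rewrite /p -mulrA [n%:R `^ _]/powR (gt_eqF n0) -expRD; congr (_ * expR _); ring.
    apply: (@le_trans _ _ (p * (c2 * n%:R `^ q))); last by rewrite ler_wpM2l// ltW.
    have -> : p * (c2 * n%:R `^ q) = c3 * n%:R `^ (3 * g).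
      have -> : n%:R `^ (3 * g) = n%:R `^ (- ((1 - dl / 2) * (1 - 2 * alpha))) * n%:R `^ q :> R.
        by rewrite -powRD ?(gt_eqF n0) ?implybT//; congr (_ `^ _); rewrite /q /g; field.
      by rewrite pE /c3; ring.
    by move: M7; lra.
  have p10 : 0 <= 1 - p by rewrite subr_ge0.
  apply: (@le_trans _ _ (expR (- p) ^+ J)).
    by rewrite lerXn2r ?nnegrE ?expR_ge0//; exact: expR_ge1Dx.
  rewrite -expRM_natl -[n%:R ^+ 2]lnK ?posrE ?exprn_gt0// -expRN ler_expR.
  rewrite lnXn// mulrN lerN2 -[ln n%:R *+ 2]mulr_natl [leRHS]mulrC.
  exact: JE.
move=> w nov; apply: no_successP => j jJ ok; apply: nov.
pose x := (m + j * l)%N.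
exists x, (x + l)%N; split.
  by rewrite leq_addr/=; exact: block_fits.
rewrite potential_diff ?leq_addr// sumrB -mulr_sumr.
have sle : \sum_(x.+1 <= i < (x + l).+1) i%:R `^ (- alpha) <= l%:R * ((1 + e) * n%:R `^ (- alpha)) :> R.
  apply: (@le_trans _ _ (\sum_(x.+1 <= i < (x + l).+1) (1 + e) * n%:R `^ (- alpha))); last first.
    by rewrite sumr_const_nat subSS addKn -[leLHS]mulr_natl.
  rewrite big_nat [leRHS]big_nat; apply: ler_sum => i /andP[xi _].
  have i0 : 0 < i%:R :> R by rewrite ltr0n (leq_trans _ xi).
  have ri : r * n%:R <= i%:R.
    rewrite (le_trans (ltW mgt))// ler_nat (leq_trans _ (ltnW xi))//.
    exact: leq_addr.
  rewrite !powRN -[leRHS]invf_div lef_pV2 ?posrE ?divr_gt0 ?powR_gt0//.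
  rewrite ler_pdivrMr//.
  apply: (@le_trans _ _ (((1 + e) * i%:R) `^ alpha)).
    apply: ge0_ler_powR; rewrite ?nnegrE ?(ltW al0) ?(ltW n0) ?mulr_ge0 ?(ltW e10) ?(ltW i0)//.
    by rewrite -ler_pdivrMl.
  rewrite powRM ?(ltW e10) ?(ltW i0)// mulrC ler_wpM2l ?powR_ge0//.
  rewrite ler1_powR ?lerDl ?(ltW e0)//.
  by move: al1; lra.
have okw : c <= \sum_(x.+1 <= i < (x + l).+1) omega i w := ok.
have lb : 0 <= l%:R * (b * n%:R `^ (- alpha)) by rewrite !mulr_ge0 ?powR_ge0// ltW.
have cE : c = 2 * ((1 - e) * (1 + 2 * e)) * (l%:R * (b * n%:R `^ (- alpha))).
  by rewrite /c /th /k; field; rewrite gt_eqF.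
have Hle : (1 - dl) * H n%:R <= l%:R * (b * n%:R `^ (- alpha)).
  have := ler_wpM2r (_ : 0 <= b * n%:R `^ (- alpha)) (ltW lgt).
  rewrite mulr_ge0 ?powR_ge0 ?(ltW b0)// => /(_ isT); apply: le_trans.
  have -> : Hb * (b * n%:R `^ (- alpha)) = (1 - dl) * H n%:R * (n%:R `^ (- alpha) * n%:R `^ alpha).
    by rewrite /Hb; field; rewrite gt_eqF.
  by rewrite xx mulr1.
have bs := ler_wpM2l (ltW b0) sle.
have sg : 1 <= 2 * ((1 - e) * (1 + 2 * e)) - (1 + e).
  have : e * e <= e * (1 / 24) by rewrite ler_wpM2l// ltW.
  by move: e0; lra.
have h5 := ler_wpM2r lb sg.
apply: (le_trans Hle); rewrite mul1r in h5; apply: (le_trans h5).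
rewrite mulrBl -cE; apply: lerD => //; rewrite lerN2; apply: (le_trans bs).
by rewrite le_eqVlt; apply/orP; left; apply/eqP; ring.
Unshelve. all: by end_near.
Qed.

Lemma as_valley : {ae P, forall w, forall e, 0 < e -> \forall n \near \oo,
  exists y z : nat, (y <= z < n)%N /\ (1 - e) * H n%:R <= V w z - V w y}.
Proof.
have k0 (k : nat) : 0 < k.+2%:R^-1 :> R by rewrite invr_gt0.
have k1 (k : nat) : k.+2%:R^-1 < 1 :> R by rewrite invf_lt1// ltr1n.
have := ae_foralln (fun k => valley_event (k0 k) (k1 k)).
apply: filterS => w h e e0.
have [k ke] : exists k : nat, k.+2%:R^-1 <= e.
  exists (Num.truncn e^-1); rewrite invf_ple ?posrE// ltW//.
  by rewrite (lt_le_trans (truncnS_gt _))// ler_nat.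
near=> n.
have n1 : 1 <= n%:R :> R by rewrite ler1n; near: n; exact: nbhs_infty_ge.
have /contrapT[y [z [yz hw]]] : ~ ~ exists y z : nat, (y <= z < n)%N /\
     (1 - k.+2%:R^-1) * H n%:R <= V w z - V w y by near: n; exact: h.
exists y, z; split => //; apply: le_trans hw.
by rewrite ler_wpM2r ?barrier_ge0// lerD2l lerN2.
Unshelve. all: by end_near.
Qed.

End EnvironmentPotential.

Theorem theorem1p1 (R : realType) (b alpha sigma2 : R)
    (d : measure_display) (Omega : measurableType d) (P : probability Omega R)
    (omega : nat -> {RV P >-> R})
    (hb : 0 < b) (halpha0 : 0 < alpha) (halpha1 : alpha < 1 / 2)
    (hindep : mutually_independent P [set x | (1 <= x)%N]
                (fun x => omega x : Omega -> R))
    (hident : forall x : nat, (1 <= x)%N ->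
       identically_distributed (omega x) (omega 1%N))
    (hmean : ('E_P[omega 1%N] = 0)%E)
    (hvar : ('E_P[fun w => (omega 1%N w ^+ 2)%R] = sigma2%:E)%E)
    (hsigma2 : 0 < sigma2)
    (hexp : exists2 theta0 : R, 0 < theta0 &
       forall theta : R, `|theta| < theta0 ->
         ('E_P[fun w => expR (theta * omega 1%N w)%R] < +oo)%E) :
  let Cstar := 2 * alpha * b / (sigma2 * (1 - 2 * alpha)) in
  {ae P, forall w : Omega,
    forall (d' : measure_display) (T : measurableType d')
           (Q : probability T R) (X : R -> T -> nat),
      quenched_walk b alpha (fun x => omega x w) Q X ->
      {ae Q, forall x : T,
        (X t x)%:R / (Cstar * (ln (ln t))^-1 * ln t) `^ (1 / alpha)
          @[t --> +oo] --> (1 : R)}}.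
Proof.
move=> Cstar.
have kap0 : 0 < 1 - 2 * alpha by lra.
pose A := (1 - 2 * alpha) * sigma2 / (2 * b).
have A0 : 0 < A by rewrite divr_gt0 ?mulr_gt0.
have AE : 2 * b * A = (1 - 2 * alpha) * sigma2.
  by rewrite /A mulrC divfK// gt_eqF// mulr_gt0.
have bounds dl := mgf_bounds (dl := dl) hmean hvar hexp hsigma2.
have a1 := as_lln hindep hident hsigma2 bounds halpha0 halpha1.
have a2 := as_barrier hindep hident hsigma2 bounds hb halpha0 halpha1 A0 AE.
have a3 := as_valley hindep hident hsigma2 bounds hb halpha0 halpha1 A0 AE.
apply: filterS3 a1 a2 a3 => w lln barrier valley d' T Q X qX.
have good : good_env b alpha A (fun x => omega x w) by [].
have -> : Cstar = alpha / A.
  by rewrite /Cstar /A; field; rewrite !gt_eqF.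
exact: (quenched_limit hb halpha0 halpha1 A0 good qX).
Qed.
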